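(* Let $n\ge 3$. Each of the following moves, applied to a book representation of $K_n$ in $S^3$, yields a book representation that is ambient isotopic to the original one in $S^3$: 1. Rotating vertices: increase or decrease all vertex labels by one, mod $n$. 2. Shifting sheets: with $s$ the number of sheets, increase or decrease all sheet numbers by one, mod $s$. 3. Edge move: if an edge does not intersect any of the edges in an adjacent sheet, move the edge into that sheet. 4. Vertex exchange: if $v$ and $w$ are consecutively labelled vertices on the boundary circle (consecutive mod $n$), and if the sheet number of each edge incident to $v$ is higher than the sheet number of any edge incident to $w$ (the edge $vw$ itself being disregarded), then exchange the positions of the vertices $v$ and $w$ and relabel; that is, for every vertex $x\neq v,w$, the edge $vx$ of the new representation lies in the sheet which contained the edge $wx$ in the old one, the edge $wx$ of the new representation lies in the sheet which contained $vx$, and all edges not incident to $v$ or $w$ keep their sheets. 5. Sheet insertion/deletion: add or remove an empty sheet between any two sheets. 6. Double reflection: compose any pair of reflections, each of which is either a reflection through a diameter of the boundary circle (permuting the vertices) or the reflection through the plane containing the boundary circle (reversing the order of the sheets).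
   Context: Let $C$ be a circle (the boundary circle) in a plane in $\mathbb{R}^3\subset S^3$ with $n$ equally spaced vertices on it labelled $1,\dots,n$ clockwise. For $a<b$, $ab$ denotes the edge joining $a$ and $b$. Two edges intersect if the corresponding chords of $C$ cross in the interior of the disk bounded by $C$ (four distinct endpoints alternating around $C$). A book representation of $K_n$ on $s$ sheets is a spatial embedding of $K_n$ in which the vertices are the $n$ equally spaced points of $C$ labelled $1,\dots,n$ clockwise and the edges are distributed among $s$ sheets, numbered $1$ (top) to $s$ (bottom). The sheets are topological disks with common boundary $C$ and pairwise disjoint interiors, stacked in order. Each edge lies in one sheet and projects to its chord in the plane of $C$, and edges in the same sheet do not intersect. Exterior edges (joining vertices consecutive on $C$) intersect no other edge and may be placed in any sheet; all other edges are interior edges. A book representation is thus given combinatorially by an assignment of edges to ordered sheets such that edges in the same sheet do not intersect. Two sheets are adjacent if their numbers are consecutive (cyclically, sheet $s$ being adjacent to sheet $1$). A sheet is empty if it contains no edges. Two book representations are ambient isotopic if they are so as spatial graphs in $S^3$, without requiring vertex labels to be preserved. *)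

(* Defs.v *)
From HB Require Import structures.
From mathcomp Require Import all_boot all_order all_algebra all_fingroup.
From mathcomp Require Import all_classical all_reals all_analysis.
Import Order.TTheory GRing.Theory Num.Theory numFieldNormedType.Exports.

Set Implicit Arguments.
Unset Strict Implicit.
Unset Printing Implicit Defensive.

Local Open Scope classical_set_scope.
Local Open Scope ring_scope.

(* A point of R^3 is ((x, y), z); the plane of the boundary circle is z = 0 and
   [fst] is the vertical projection onto it. *)
Definition R3 (R : realType) : Type := (R * R * R)%type.

Definition S3 (R : realType) : topologicalType :=
  one_point_compactification (R * R * R)%type.

Definition R3_in_S3 (R : realType) (x : R3 R) : S3 R := Some x.

(* Edges of K_n are the two-element sets of vertices; functions on
   [{set 'I_n}] are only ever meaningful on edges. *)
Definition is_edge n (e : {set 'I_n}) : bool := #|e| == 2.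

Record spatial_graph (R : realType) (n : nat) : Type := SpatialGraph {
  vtx : 'I_n -> S3 R;
  edge_arc : {set 'I_n} -> set (S3 R)
}.

Definition is_arc_between (T : topologicalType) (R : realType)
    (x y : T) (A : set T) : Prop :=
  exists gamma : R -> T,
    [/\ {within `[0, 1], continuous gamma},
        {in `[0, 1] &, injective gamma},
        gamma 0 = x, gamma 1 = y & gamma @` `[0, 1] = A].

Definition spatial_embedding (R : realType) n (G : spatial_graph R n) : Prop :=
  [/\ injective (vtx G),
      forall i j, i != j ->
        is_arc_between R (vtx G i) (vtx G j) (edge_arc G [set i; j]%SET),
      forall i e, is_edge e -> edge_arc G e (vtx G i) -> i \in e
    & forall e f, is_edge e -> is_edge f -> e != f ->
        edge_arc G e `&` edge_arc G f `<=` [set vtx G i | i in [set` e :&: f]]].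

Definition homeomorphism (T : topologicalType) (f : T -> T) : Prop :=
  continuous f /\
  exists g : T -> T, [/\ continuous g, cancel f g & cancel g f].

Definition ambient_isotopy (R : realType) (H : R -> S3 R -> S3 R) : Prop :=
  [/\ {within `[0, 1] `*` setT,
        continuous (fun p : R * S3 R => H p.1 p.2)},
      H 0 = id
    & forall t, t \in `[0, 1] -> homeomorphism (H t)].

(* The permutation [pi] accounts for vertex labels not being preserved. *)
Definition ambient_isotopic (R : realType) n (G G' : spatial_graph R n) : Prop :=
  exists H : R -> S3 R -> S3 R, ambient_isotopy H /\
  exists pi : {perm 'I_n},
    (forall i, H 1 (vtx G i) = vtx G' (pi i)) /\
    (forall e, is_edge e -> H 1 @` edge_arc G e = edge_arc G' (pi @: e)%SET).

(* [s] ordered sheets; sheet [0] of ['I_s] is the top one. *)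
Definition assignment (n s : nat) : Type := {set 'I_n} -> 'I_s.

Definition crossing n (e f : {set 'I_n}) : Prop :=
  exists a b c d : 'I_n,
    [/\ (a < b)%N, (b < c)%N, (c < d)%N
      & (e = [set a; c] /\ f = [set b; d])%SET \/
        (e = [set b; d] /\ f = [set a; c])%SET].

Definition sheets_noncrossing n s (B : assignment n s) : Prop :=
  forall e f, is_edge e -> is_edge f -> B e = B f -> ~ crossing e f.

(* The minus sign makes the labelling clockwise when seen from above. *)
Definition circle_vertex (R : realType) n (i : 'I_n) : R * R :=
  (cos (2 * pi * i%:R / n%:R), - sin (2 * pi * i%:R / n%:R)).

Definition chord (R : realType) (p q : R * R) : set (R * R) :=
  [set ((1 - t) * p.1 + t * q.1, (1 - t) * p.2 + t * q.2)
     | t in [set t : R | 0 <= t <= 1]].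

Definition closed_disk (R : realType) : set (R * R) :=
  [set p | p.1 ^+ 2 + p.2 ^+ 2 <= 1].
Definition open_disk (R : realType) : set (R * R) :=
  [set p | p.1 ^+ 2 + p.2 ^+ 2 < 1].
Definition boundary_circle (R : realType) : set (R * R) :=
  [set p | p.1 ^+ 2 + p.2 ^+ 2 = 1].

(* Sheets are given by height functions over the disk: each sheet is a
   topological disk with boundary the circle, interiors are pairwise disjoint,
   and sheets with smaller numbers lie above. *)
Definition sheet_stack (R : realType) s (h : 'I_s -> R * R -> R) : Prop :=
  [/\ forall k, {within @closed_disk R, continuous (h k)},
      forall k p, boundary_circle p -> h k p = 0
    & forall (k l : 'I_s) p, (k < l)%N -> open_disk p -> h l p < h k p].

Definition sheet (R : realType) (h : R * R -> R) : set (R3 R) :=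
  [set (p, h p) | p in @closed_disk R].

Definition book_representation (R : realType) n s (B : assignment n s)
    (G : spatial_graph R n) : Prop :=
  [/\ sheets_noncrossing B,
      spatial_embedding G,
      forall i, vtx G i = R3_in_S3 (circle_vertex R i, 0)
    & exists h : 'I_s -> R * R -> R, sheet_stack h /\
      forall i j, i != j ->
        edge_arc G [set i; j]%SET `<=` (@R3_in_S3 R) @` sheet (h (B [set i; j]%SET)) /\
        fst @` ((@R3_in_S3 R) @^-1` edge_arc G [set i; j]%SET)
          = chord (circle_vertex R i) (circle_vertex R j)].

(* [ordS] and [ord_pred] are the cyclic successor and predecessor. *)
Definition rotating_vertices n s (B B' : assignment n s) : Prop :=
  (forall e, is_edge e -> B' (@ordS n @: e)%SET = B e) \/
  (forall e, is_edge e -> B' (@ord_pred n @: e)%SET = B e).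

Definition shifting_sheets n s (B B' : assignment n s) : Prop :=
  (forall e, is_edge e -> B' e = ordS (B e)) \/
  (forall e, is_edge e -> B' e = ord_pred (B e)).

Definition adjacent_sheets s (k l : 'I_s) : Prop := l = ordS k \/ k = ordS l.

Definition edge_move n s (B B' : assignment n s) : Prop :=
  exists (e : {set 'I_n}) (k : 'I_s),
    [/\ is_edge e, adjacent_sheets (B e) k,
        forall f, is_edge f -> B f = k -> ~ crossing e f,
        B' e = k
      & forall f, is_edge f -> f != e -> B' f = B f].

(* The sheet of the exterior edge [vw] in [B'] is left free: it crosses no
   other edge and may be placed in any sheet. *)
Definition vertex_exchange n s (B B' : assignment n s) : Prop :=
  exists v w : 'I_n,
    [/\ w = ordS v \/ v = ordS w,
        forall x y, x \notin [set v; w]%SET -> y \notin [set v; w]%SET ->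
          (B [set w; y]%SET < B [set v; x]%SET)%N,
        forall x, x \notin [set v; w]%SET ->
          B' [set v; x]%SET = B [set w; x]%SET /\
          B' [set w; x]%SET = B [set v; x]%SET
      & forall e, is_edge e -> v \notin e -> w \notin e -> B' e = B e].

(* [lift k] skips the new empty sheet [k]. *)
Definition sheet_insertion n s (B : assignment n s) (B' : assignment n s.+1) :
    Prop :=
  exists k : 'I_s.+1, forall e, is_edge e -> B' e = lift k (B e).

(* Reflection through the diameter of direction (cos theta, sin theta). *)
Definition diameter_reflection (R : realType) (theta : R) (p : R * R) : R * R :=
  (cos (2 * theta) * p.1 + sin (2 * theta) * p.2,
   sin (2 * theta) * p.1 - cos (2 * theta) * p.2).

Definition reflection (R : realType) n s (B B' : assignment n s) : Prop :=
  (exists (theta : R) (rho : 'I_n -> 'I_n),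
     (forall i, circle_vertex R (rho i)
                = diameter_reflection theta (circle_vertex R i)) /\
     (forall e, is_edge e -> B' (rho @: e)%SET = B e)) \/
  (forall e, is_edge e -> B' e = rev_ord (B e)).

Definition double_reflection (R : realType) n s (B B' : assignment n s) : Prop :=
  exists B1 : assignment n s, reflection R B B1 /\ reflection R B1 B'.

Inductive book_move (R : realType) (n : nat) :
    forall s s' : nat, assignment n s -> assignment n s' -> Prop :=
| RotatingVertices s (B B' : assignment n s) :
    rotating_vertices B B' -> book_move R B B'
| ShiftingSheets s (B B' : assignment n s) :
    shifting_sheets B B' -> book_move R B B'
| EdgeMove s (B B' : assignment n s) :
    edge_move B B' -> book_move R B B'
| VertexExchange s (B B' : assignment n s) :
    vertex_exchange B B' -> book_move R B B'
| SheetInsertion s (B : assignment n s) (B' : assignment n s.+1) :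
    sheet_insertion B B' -> book_move R B B'
| SheetDeletion s (B : assignment n s.+1) (B' : assignment n s) :
    sheet_insertion B' B -> book_move R B B'
| DoubleReflection s (B B' : assignment n s) :
    double_reflection R B B' -> book_move R B B'.

(* Main.v *)
(* Two drawings of the same book are isotopic: vertical piecewise affine maps
   carry one stack of sheets to the other, so each move may be checked on drawings
   of our choice. Inserting a sheet, or moving an edge to the next sheet, does not
   change a suitable drawing at all: the sheets can be bent so that one and the
   same graph lies on both stacks. Rotations and double reflections are realised
   by rigid motions. To shift the sheets cyclically, take them as pages with slopes
   near 1 and -1, rotate S^3 in the plane of the vertical axis and infinity, and
   correct the slopes by Lorentz boosts. In a vertex exchange, v and w trade places
   along straight lines, w above and v below, with edges of parabolic shape whose
   heights grow geometrically with the sheet; the relative velocity of two points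
   is bounded by a multiple of their distance, so the motion extends to an isotopy
   of space, composed of small Lipschitz perturbations of the identity. An
   edge move between the last and the first sheet is conjugate, by a shift, to one
   between consecutive sheets. *)
From HB Require Import structures.
Require Import Defs.
From mathcomp Require Import all_boot all_order all_algebra all_fingroup.
From mathcomp Require Import all_classical all_reals all_analysis.
From mathcomp Require Import ring lra.
Import Order.TTheory GRing.Theory Num.Theory numFieldNormedType.Exports.

Set Implicit Arguments.
Unset Strict Implicit.
Unset Printing Implicit Defensive.

Local Open Scope classical_set_scope.
Local Open Scope ring_scope.

(** Since S^3 is compact and Hausdorff, a jointly continuous family of bijections is already an
    ambient isotopy; no inverse has to be shown continuous. The delicate point is infinity. A motion
    of R^3 extends by fixing it once preimages of bounded sets stay bounded uniformly in time. The
    motion that shifts the sheets moves infinity itself, which is why S^3 is also modelled as the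
    unit sphere of R^4. The obstacle in the vertex exchange is that points of one edge, or of two
    edges with a common vertex, come arbitrarily close, so that absence of collisions alone gives no
    Lipschitz bound. The difference of two such points is therefore divided by the difference, or by
    the sum, of their arc parameters; the quotient is continuous and nowhere zero on a compact box,
    hence bounded below. Actual collisions are excluded by the ratio [K] of successive heights,
    chosen from a lower bound [mu] for the orientations of vertex triples and a lower bound [m] for
    the squared chord lengths. *)

Definition cont_at (T U : topologicalType) (f : T -> U) (x : T) : Prop :=
  {for x, continuous f}.

Lemma cont_at_nbhs (T U : topologicalType) (f : T -> U) (x : T) (A : set U) :
  cont_at f x -> nbhs (f x) A -> nbhs x (f @^-1` A).
Proof. by move=> cf; exact: cf. Qed.

(** * Pointwise continuity, with a syntax-directed tactic *)

Section Continuity.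
Variables (R : realType) (T : topologicalType).
Implicit Types (f g : T -> R) (x : T).

Lemma cont_cst (U : topologicalType) (c : U) x : cont_at (fun _ : T => c) x.
Proof. exact: cvg_cst. Qed.

Lemma cont_add f g x : cont_at f x -> cont_at g x ->
  cont_at (fun y => f y + g y) x.
Proof. by move=> cf cg; apply: (@cvgD R R T _ _ f g). Qed.

Lemma cont_opp f x : cont_at f x -> cont_at (fun y => - f y) x.
Proof. by move=> cf; apply: (@cvgN R R T _ _ f). Qed.

Lemma cont_mul f g x : cont_at f x -> cont_at g x ->
  cont_at (fun y => f y * g y) x.
Proof. by move=> cf cg; apply: (@cvgM R T _ _ f g). Qed.

Lemma cont_inv f x : cont_at f x -> f x != 0 ->
  cont_at (fun y => (f y)^-1) x.
Proof. by move=> cf f0; apply: (@cvgV R T _ _ f). Qed.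

Lemma cont_comp (U V : topologicalType) (f : T -> U) (g : U -> V) x :
  cont_at f x -> cont_at g (f x) ->
  cont_at (fun y => g (f y)) x.
Proof. by move=> cf cg; apply: (@continuous_comp T U V f g x). Qed.

Lemma cont_sqrt f x : cont_at f x ->
  cont_at (fun y => Num.sqrt (f y)) x.
Proof. move=> cf; apply: (@cont_comp _ _ f Num.sqrt x cf); exact: sqrt_continuous. Qed.

Lemma cont_exp f n x : cont_at f x -> cont_at (fun y => f y ^+ n) x.
Proof. move=> cf; apply: (@cont_comp _ _ f (fun u => u ^+ n) x cf); exact: exprn_continuous. Qed.

Lemma cont_max f g x : cont_at f x -> cont_at g x ->
  cont_at (fun y => Num.max (f y) (g y)) x.
Proof. by move=> cf cg; apply: (@continuous_max R T f g x). Qed.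

Lemma cont_min f g x : cont_at f x -> cont_at g x ->
  cont_at (fun y => Num.min (f y) (g y)) x.
Proof. by move=> cf cg; apply: (@continuous_min R T f g x). Qed.

Lemma cont_norm f x : cont_at f x -> cont_at (fun y => `|f y|) x.
Proof. move=> cf; apply: (@cont_comp _ _ f Num.norm x cf); exact: norm_continuous. Qed.

Lemma cont_sin f x : cont_at f x -> cont_at (fun y => sin (f y)) x.
Proof. move=> cf; apply: (@cont_comp _ _ f sin x cf); exact: continuous_sin. Qed.

Lemma cont_cos f x : cont_at f x -> cont_at (fun y => cos (f y)) x.
Proof. move=> cf; apply: (@cont_comp _ _ f cos x cf); exact: continuous_cos. Qed.

Lemma cont_pair (U V : topologicalType) (f : T -> U) (g : T -> V) x :
  cont_at f x -> cont_at g x ->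
  cont_at (fun y => (f y, g y)) x.
Proof. by move=> cf cg; apply: cvg_pair. Qed.

Lemma cont_fst (U V : topologicalType) (f : T -> U * V) x :
  cont_at f x -> cont_at (fun y => (f y).1) x.
Proof. move=> cf; apply: (@cont_comp _ _ f fst x cf); exact: cvg_fst. Qed.

Lemma cont_snd (U V : topologicalType) (f : T -> U * V) x :
  cont_at f x -> cont_at (fun y => (f y).2) x.
Proof. move=> cf; apply: (@cont_comp _ _ f snd x cf); exact: cvg_snd. Qed.

Lemma cont_id x : cont_at (fun y : T => y) x.
Proof. exact: cvg_id. Qed.

Lemma cont_sum (I : Type) (r : seq I) (F : I -> T -> R) x :
  (forall i, cont_at (F i) x) ->
  cont_at (fun y => \sum_(i <- r) F i y) x.
Proof.
move=> cF; elim: r => [|i r IH].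
  rewrite (_ : (fun y => _) = fun _ => 0); first exact: cont_cst.
  by apply/funext => y; rewrite big_nil.
rewrite (_ : (fun y => _) = fun y => F i y + \sum_(i <- r) F i y).
  exact: cont_add.
by apply/funext => y; rewrite big_cons.
Qed.

End Continuity.

Lemma cont_mull (R : realType) (c x : R) : cont_at ( *%R c) x.
Proof. exact: (cont_mul (@cont_cst R R c x) (@cont_id R x)). Qed.

Lemma cont_addl (R : realType) (c x : R) : cont_at (+%R c) x.
Proof. exact: (cont_add (@cont_cst R R c x) (@cont_id R x)). Qed.

(** Projections are tried only after hypotheses, so that a known continuity of a coordinate is used
    as it stands. An inverse leaves the nonvanishing of its argument as a goal, closed when it is a
    hypothesis. *)
Ltac cont_step := first
  [ lazymatch goal with |- cont_at ?h _ =>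
      lazymatch h with
      | (fun y : ?T => @?f y + @?g y) => apply: cont_add
      | (fun y : ?T => - @?f y) => apply: cont_opp
      | (fun y : ?T => @?f y * @?g y) => apply: cont_mul
      | (fun y : ?T => Num.sqrt (@?f y)) => apply: cont_sqrt
      | (fun y : ?T => @?f y ^+ _) => apply: cont_exp
      | (fun y : ?T => Order.max (@?f y) (@?g y)) => apply: cont_max
      | (fun y : ?T => Order.min (@?f y) (@?g y)) => apply: cont_min
      | (fun y : ?T => `|@?f y|) => apply: cont_norm
      | (fun y : ?T => sin (@?f y)) => apply: cont_sin
      | (fun y : ?T => cos (@?f y)) => apply: cont_cos
      | (fun y : ?T => (@?f y, @?g y)) => apply: cont_pair
      end end
  | exact: cont_id | exact: cont_cst | assumption
  | exact: cont_mull | exact: cont_addl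
  | lazymatch goal with |- cont_at ?h _ =>
      lazymatch h with
      | (fun y : ?T => fst (@?f y)) => apply: cont_fst
      | (fun y : ?T => snd (@?f y)) => apply: cont_snd
      | (fun y : ?T => (@?f y)^-1) => apply: cont_inv
      | -%R => exact: (cont_opp (@cont_id _ _))
      | sin => exact: (cont_sin (@cont_id _ _))
      | cos => exact: (cont_cos (@cont_id _ _))
      | Num.norm => exact: (cont_norm (@cont_id _ _))
      | Num.sqrt => exact: (cont_sqrt (@cont_id _ _))
      | fst => exact: cvg_fst
      | snd => exact: cvg_snd
      end end ].
Ltac cont := repeat cont_step.

(** * Isotopies of the 3-sphere *)

(** Closed sets are compact, hence have compact and therefore closed images. *)
Lemma continuous_bijection_homeomorphism (T : topologicalType) (f : T -> T) :
  compact [set: T] -> hausdorff_space T -> continuous f -> bijective f ->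
  homeomorphism f.
Proof.
move=> cT hT cf [g fg gf]; split=> //; exists g; split=> //.
apply/continuous_closedP => A cA.
have -> : g @^-1` A = f @` A.
  apply/seteqP; split=> [x Ax|_ [x Ax <-]] /=; last by rewrite fg.
  by exists (g x).
apply: compact_closed hT _; apply: continuous_compact.
  exact: continuous_subspaceT.
exact: subclosed_compact cA cT _.
Qed.

(** * The 3-sphere as a compactification of R^3 and as the unit sphere of R^4 *)

Section R3facts.
Variable R : realType.
Local Notation V := (R * R * R)%type.

Lemma norm3E (x y z : R) : `|(x, y, z) : V| = Num.max (Num.max `|x| `|y|) `|z|.
Proof. by []. Qed.

Lemma norm3_le (X : V) (r : R) :
  (`|X| <= r) = [&& `|X.1.1| <= r, `|X.1.2| <= r & `|X.2| <= r].
Proof. by case: X => -[x y] z; rewrite norm3E !ge_max andbA. Qed.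

Lemma norm3_coord (X : V) :
  [/\ `|X.1.1| <= `|X|, `|X.1.2| <= `|X| & `|X.2| <= `|X|].
Proof. by apply/and3P; rewrite -norm3_le. Qed.

Lemma ball3_compact (r : R) : compact [set X : V | `|X| <= r].
Proof.
have -> : [set X : V | `|X| <= r] = (`[-r, r] `*` `[-r, r]) `*` `[-r, r].
  apply/seteqP; split=> X /=; rewrite norm3_le !in_itv/= !ler_norml.
    by move=> /and3P[].
  by move=> [[-> ->] ->].
by do 2?apply: compact_setX; exact: segment_compact.
Qed.

Lemma V_hausdorff : hausdorff_space V.
Proof. exact: norm_hausdorff. Qed.

Lemma compact3_bounded (C : set V) : compact C ->
  exists2 r, 0 < r & forall X, C X -> `|X| <= r.
Proof.
move=> /compact_bounded[M [_ MC]]; exists (Num.max 0 M + 1).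
  by rewrite ltr_wpDl ?le_max ?lexx.
by move=> X CX; apply: (MC (Num.max 0 M + 1)) => //; rewrite ltr_pwDr// le_max lexx orbT.
Qed.

Lemma nbhs_infty (A : set (S3 R)) (r : R) :
  A None -> (forall X, r < `|X| -> A (Some X)) -> nbhs (None : S3 R) A.
Proof.
move=> AN AX; exists [set X : V | `|X| <= r].
  split; first exact: ball3_compact.
  exact: (compact_closed V_hausdorff (@ball3_compact r)).
by move=> P [[X /= /negP]|->//]; rewrite -ltNge => /AX ? <-.
Qed.

Lemma infty_nbhs (A : set (S3 R)) : nbhs (None : S3 R) A ->
  exists2 r : R, 0 < r & forall X, r < `|X| -> A (Some X).
Proof.
case=> C [cC _] CA; have [r r0 rC] := compact3_bounded cC.
exists r => // X rX; apply: CA; left; exists X => //= CX.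
by move: rX; rewrite ltNge rC.
Qed.

Lemma cont_at_Some (T : topologicalType) (f : S3 R -> T) (X : V) :
  cont_at (fun Y : V => f (Some Y)) X -> cont_at f (Some X).
Proof. by move=> cf A /cf. Qed.

Lemma cont_at_infty (f : S3 R -> R) :
  (forall e, 0 < e -> exists r : R, forall X, r < `|X| -> `|f None - f (Some X)| < e) ->
  cont_at f None.
Proof.
move=> H; have FF : Filter (nbhs (None : S3 R)) by exact: nbhs_filter.
apply/(@cvgrPdist_lt R R _ _ FF) => e e0; have [r rH] := H e e0.
apply: (@nbhs_infty [set P | `|f None - f P| < e] r) => //=.
by rewrite subrr normr0.
Qed.

Definition bulk (X : V) : R := X.1.1 ^+ 2 + X.1.2 ^+ 2 + X.2 ^+ 2.

Lemma bulk_ge0 X : 0 <= bulk X.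
Proof. by rewrite !addr_ge0 ?sqr_ge0. Qed.

Lemma bulk_eq0 X : bulk X = 0 -> X = 0.
Proof.
case: X => -[x y] z /eqP; rewrite /bulk/= !paddr_eq0 ?addr_ge0 ?sqr_ge0//.
by rewrite !sqrf_eq0 => /andP[/andP[/eqP-> /eqP->] /eqP->].
Qed.

Lemma norm3_bulk X : `|X| ^+ 2 <= bulk X.
Proof.
have : `|X| <= Num.sqrt (bulk X).
  rewrite norm3_le /bulk; apply/and3P; split; rewrite -sqrtr_sqr ler_sqrt ?sqr_ge0//;
  by rewrite ?addr_ge0 ?sqr_ge0// ?lerDr ?addr_ge0 ?sqr_ge0// -?addrA ?lerDl ?lerDr ?addr_ge0 ?sqr_ge0 // addrCA lerDl ?addr_ge0 ?sqr_ge0.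
by move=> h; rewrite -(sqr_sqrtr (bulk_ge0 X)) ler_sqr ?nnegrE ?sqrtr_ge0.
Qed.

(* R^3 u {oo} as the unit sphere of R^4: the unit ball is lifted vertically to
   the lower hemisphere, so that horizontal coordinates inside the ball are
   kept; its complement goes to the upper hemisphere by inversion. *)
Definition to_sphere (P : S3 R) : R * R * R * R :=
  if P is Some X then
    let m := Num.max 1 (bulk X) in
    (X.1.1 / m, X.1.2 / m, X.2 / m,
     Num.sqrt (1 - m^-1) - Num.sqrt (1 - bulk X))
  else (0, 0, 0, 1).

Definition of_sphere (Q : R * R * R * R) : S3 R :=
  if Q.2 <= 0 then Some Q.1
  else if bulk Q.1 == 0 then None
  else Some (Q.1.1.1 / bulk Q.1, Q.1.1.2 / bulk Q.1, Q.1.2 / bulk Q.1).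

Definition on_sphere (Q : R * R * R * R) : Prop := bulk Q.1 + Q.2 ^+ 2 = 1.

Lemma bulk_scale (X : V) (c : R) :
  bulk (X.1.1 / c, X.1.2 / c, X.2 / c) = bulk X / c ^+ 2.
Proof. by rewrite /bulk/= !exprMn !exprVn -!mulrDl. Qed.

(** [Num.sqrt] is 0 on negative numbers, so at most one of the two roots in [to_sphere] is nonzero,
    and the sign of the last coordinate tells the ball from its complement. *)
Lemma to_sphereK P : of_sphere (to_sphere P) = P.
Proof.
rewrite /of_sphere; case: P => [[[x y] z]|] /=; last first.
  by rewrite ler10 /bulk/= !expr0n/= !addr0 eqxx.
set X := (x, y, z); set q := bulk X; case: (leP q 1) => q1.
  rewrite invr1 subrr sqrtr0 sub0r oppr_le0 sqrtr_ge0.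
  by rewrite !mulr1.
have -> : Num.sqrt (1 - q) = 0 by rewrite ler0_sqrtr// subr_le0 ltW.
rewrite subr0.
have q0 : 0 < q by exact: lt_trans q1.
rewrite leNgt sqrtr_gt0 subr_gt0 invf_lt1// q1/=.
rewrite (bulk_scale X q) -/q expr2 invfM mulrA divff ?(gt_eqF q0)// mul1r.
by rewrite invr_eq0 (gt_eqF q0) invrK !mulfVK ?gt_eqF.
Qed.

Lemma of_sphereK Q : on_sphere Q -> to_sphere (of_sphere Q) = Q.
Proof.
rewrite /of_sphere; case: Q => [[[x y] z] u]; rewrite /on_sphere /=.
set X := (x, y, z); set q := bulk X => q1.
have qu : 1 - q = u ^+ 2 by rewrite -q1 addrAC subrr add0r.
have qle : q <= 1 by rewrite -subr_ge0 qu sqr_ge0.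
case: leP => u0 /=.
  rewrite -/q (max_idPl qle) invr1 subrr sqrtr0 sub0r !mulr1 qu sqrtr_sqr.
  by rewrite ler0_norm// opprK.
case: eqP => [q0|/eqP q0] /=.
  have := bulk_eq0 q0; rewrite /X => -[-> -> ->].
  have : u ^+ 2 = 1 by rewrite -q1 q0 add0r.
  by move/eqP; rewrite sqrf_eq1 => /orP[/eqP->//|/eqP u1]; move: u0; rewrite u1 oppr_gt0 ltr10.
have qp : 0 < q by rewrite lt_def q0 bulk_ge0.
rewrite (bulk_scale X q) -/q expr2 invfM mulrA divff// mul1r.
rewrite (max_idPr _) ?invf_ge1// invrK !mulfVK// qu.
rewrite sqrtr_sqr gtr0_norm// (@ler0_sqrtr _ (1 - q^-1)) ?subr0//.
by rewrite subr_le0 invf_ge1.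
Qed.

Lemma on_sphere_to P : on_sphere (to_sphere P).
Proof.
rewrite /on_sphere; case: P => [X|] /=; last first.
  by rewrite /bulk/= !expr0n/= !addr0 add0r expr1n.
set q := bulk X; set m := Num.max _ _.
rewrite (bulk_scale X m) -/q {}/m; case: (leP q 1) => q1.
  rewrite invr1 subrr sqrtr0 sub0r sqrrN sqr_sqrtr ?subr_ge0// expr1n divr1.
  by rewrite addrC subrK.
have q0 : 0 < q by exact: lt_trans q1.
have -> : Num.sqrt (1 - q) = 0 by rewrite ler0_sqrtr// subr_le0 ltW.
rewrite subr0.
rewrite sqr_sqrtr ?subr_ge0 ?invf_le1 ?ltW//.
by rewrite expr2 invfM mulrA divff ?(gt_eqF q0)// mul1r addrC subrK.
Qed.

Lemma to_sphere_inj : injective to_sphere.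
Proof. exact: can_inj to_sphereK. Qed.

(** Estimates for continuity at infinity: [bulk X] dominates the square of the norm, so a coordinate
    divided by it is at most the inverse of the norm. *)
Lemma inv_lt_eps (e : R) : 0 < e -> forall X : V, Num.max 1 e^-1 < `|X| ->
  [/\ 1 < bulk X, (bulk X)^-1 < e & forall c, `|c| <= `|X| -> `|c / bulk X| < e].
Proof.
move=> e0 X; rewrite gt_max => /andP[X1 Xe].
have X0 : 0 < `|X| by exact: lt_trans X1.
have XX : `|X| < `|X| ^+ 2 by rewrite expr2 ltr_pMr.
have qX : `|X| < bulk X := lt_le_trans XX (norm3_bulk X).
have q0 := lt_trans X0 qX.
split; first exact: lt_trans qX.
- by rewrite invf_plt ?posrE// (lt_trans Xe).
- move=> c cX; rewrite normrM normfV (gtr0_norm q0) ltr_pdivrMr//.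
  apply: le_lt_trans cX _; apply: (@lt_le_trans _ _ (e * `|X| ^+ 2)); last first.
    by rewrite ler_pM2l ?norm3_bulk.
  by rewrite expr2 mulrA ltr_pMl// mulrC -ltr_pdivrMr// div1r.
Qed.

Lemma to_sphere_continuous : continuous to_sphere.
Proof.
move=> P; change (cont_at to_sphere P); case: P => [X|].
  by apply: cont_at_Some; rewrite /to_sphere /bulk; cont;
    rewrite gt_eqF// lt_max ltr01.
rewrite (_ : to_sphere = fun P => ((to_sphere P).1.1.1, (to_sphere P).1.1.2,
  (to_sphere P).1.2, (to_sphere P).2)); last first.
  by apply/funext => P; case: (to_sphere P) => [[[]]].
do 3?apply: cont_pair; apply: cont_at_infty => e e0; exists (Num.max 1 e^-1) => X /(inv_lt_eps e0)[q1 qe H] /=.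
- by rewrite (max_idPr (ltW q1)) sub0r normrN; apply: H; have [] := norm3_coord X.
- by rewrite (max_idPr (ltW q1)) sub0r normrN; apply: H; have [] := norm3_coord X.
- by rewrite (max_idPr (ltW q1)) sub0r normrN; apply: H; have [] := norm3_coord X.
have -> : Num.sqrt (1 - bulk X) = 0 by rewrite ler0_sqrtr// subr_le0 ltW.
rewrite (max_idPr (ltW q1)) subr0.
have q0 : 0 < bulk X by exact: lt_trans q1.
set w := (bulk X)^-1; have w0 : 0 < w by rewrite invr_gt0.
have w1 : w < 1 by rewrite invf_lt1.
have s1 : Num.sqrt (1 - w) <= 1 by rewrite -[leRHS]sqrtr1 ler_sqrt// gerBl ltW.
rewrite ger0_norm ?subr_ge0//; apply: le_lt_trans qe; rewrite -/w.
(* This is 1 - w <= sqrt (1 - w), true because 1 - w lies between 0 and 1. *)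
rewrite lerBlDr -lerBlDl -[leLHS]sqr_sqrtr ?subr_ge0 ?(ltW w1)//.
by rewrite expr2 ler_piMl ?sqrtr_ge0.
Qed.

Lemma S3_hausdorff : hausdorff_space (S3 R).
Proof.
move=> P Q clPQ; apply: to_sphere_inj.
have h : hausdorff_space (R * R * R * R)%type by exact: norm_hausdorff.
apply: h => A B /to_sphere_continuous A' /to_sphere_continuous B'.
by have [x [xA xB]] := clPQ _ _ A' B'; exists (to_sphere x).
Qed.

Lemma S3_compact : compact [set: S3 R].
Proof. exact: one_point_compactification_compact. Qed.

(** [to_sphere] is a continuous injection of a compact space, hence a closed map onto its image, so
    continuity into S^3 can be tested in R^4. *)
Lemma cont_to_sphere (T : topologicalType) (f : T -> S3 R) (x : T) :
  cont_at (fun y => to_sphere (f y)) x -> cont_at f x.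
Proof.
move=> cf A fxA; have [U oU [Ux UA]] : exists2 U, open U & U (f x) /\ U `<=` A.
  by move: fxA; rewrite nbhsE => -[U [oU Ux] UA]; exists U.
have cC : compact (to_sphere @` (~` U)).
  apply: continuous_compact; first exact/continuous_subspaceT/to_sphere_continuous.
  by apply: subclosed_compact S3_compact _; rewrite ?closedC.
have clC : closed (to_sphere @` (~` U)).
  by apply: compact_closed cC; exact: norm_hausdorff.
have : nbhs (to_sphere (f x)) (~` (to_sphere @` (~` U))).
  by apply: open_nbhs_nbhs; split; [exact: closed_openC|move=> [z Uz /to_sphere_inj zE]; apply: Uz; rewrite zE].
move=> /cf N; have {}N : nbhs x ((fun y => to_sphere (f y)) @^-1` (~` (to_sphere @` (~` U)))) := N.
suff: nbhs x (f @^-1` A) by []; apply: filterS N => y /= nU; apply: UA.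
by apply: contrapT => nUy; apply: nU; exists (f y).
Qed.

End R3facts.

Section Isotopies.
Variable R : realType.
Local Notation V := (R * R * R)%type.

(** Continuity is asked for all real times, not only within [0, 1], and homeomorphisms are replaced
    by bijections; in this form composition is immediate. *)
Definition sphere_isotopy (H : R -> S3 R -> S3 R) : Prop :=
  [/\ continuous (fun p : R * S3 R => H p.1 p.2), H 0 = id
    & forall t, t \in `[0, 1] -> bijective (H t)].

Lemma sphere_isotopy_ambient H : sphere_isotopy H -> ambient_isotopy H.
Proof.
move=> [cH H0 bH]; split=> //; first exact: continuous_subspaceT.
move=> t /bH; apply: continuous_bijection_homeomorphism.
- exact: S3_compact.
- exact: S3_hausdorff.
- move=> P; apply: (@cont_comp _ _ _ (fun P : S3 R => (t, P)) (fun p => H p.1 p.2)).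
    by cont.
  exact: cH.
Qed.

Lemma sphere_isotopy_comp H K : sphere_isotopy H -> sphere_isotopy K ->
  sphere_isotopy (fun t => K t \o H t).
Proof.
move=> [cH H0 bH] [cK K0 bK]; split.
- move=> p.
  apply: (@cont_comp _ _ _ (fun p : R * S3 R => (p.1, H p.1 p.2)) (fun p => K p.1 p.2)).
    by apply: cont_pair; [cont|exact: cH].
  exact: cK.
- by rewrite H0 K0.
- by move=> t t01; apply: bij_comp; [exact: bK|exact: bH].
Qed.

Definition clamp01 (t : R) : R := Num.max 0 (Num.min 1 t).

Lemma clamp01_itv t : 0 <= clamp01 t <= 1.
Proof. by rewrite /clamp01 le_max lexx /= ge_max ler01 ge_min lexx. Qed.

Lemma clamp01_id t : 0 <= t <= 1 -> clamp01 t = t.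
Proof. by move=> /andP[t0 t1]; rewrite /clamp01 (min_idPr t1) (max_idPr t0). Qed.

(** The last hypothesis is properness uniform in time; it is exactly continuity at the fixed point
    at infinity. Truncating the time by [clamp01] extends the family to all real times. *)
Lemma extend_isotopy (F : R -> V -> V) :
  continuous (fun p : R * V => F p.1 p.2) -> F 0 = id ->
  (forall t, 0 <= t <= 1 -> bijective (F t)) ->
  (forall r, exists r', forall t X, 0 <= t <= 1 -> `|F t X| <= r -> `|X| <= r') ->
  exists H, sphere_isotopy H /\ forall X, H 1 (Some X) = Some (F 1 X).
Proof.
move=> cF F0 bF pF; exists (fun t P => omap (F (clamp01 t)) P); split; last first.
  by move=> X /=; rewrite clamp01_id// ler01 lexx.
split; last first.
- move=> t _; have [g fg gf] := bF _ (clamp01_itv t).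
  by exists (omap g) => -[X|]//=; rewrite ?fg ?gf.
- by apply/funext => -[X|]//=; rewrite clamp01_id ?lexx ?ler01// F0.
- case=> t [X|] A /= nA.
    have c : cont_at (fun p : R * V => F (clamp01 p.1) p.2) (t, X).
      apply: (@cont_comp _ _ _ (fun p : R * V => (clamp01 p.1, p.2)) (fun p => F p.1 p.2)).
        by rewrite /clamp01; cont.
      exact: cF.
    have [[U W] [/= nU nW] UW] := c _ nA.
    exists (U, Some @` W); first by split=> //; exact: one_point_compactification_some_nbhs.
    by move=> [u _] [/= Uu [x Wx <-]] /=; apply: (UW (u, x)).
  have [r _ rA] := infty_nbhs nA; have [r' r'F] := pF r.
  exists (setT, [set P | if P is Some X then r' < `|X| else True]).
    by split; [exact: filterT|exact: (@nbhs_infty _ _ r')].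
  move=> [u [X|]] /= [_ rX]; last exact: nbhs_singleton nA.
  apply: rA; rewrite ltNge; apply/negP => /(r'F _ _ (clamp01_itv u)).
  by rewrite leNgt rX.
Qed.

(** Here infinity is an ordinary point of the sphere and may move. *)
Lemma sphere_isotopy_R4 (T T' : R -> R * R * R * R -> R * R * R * R) :
  continuous (fun p : R * (R * R * R * R) => T p.1 p.2) ->
  (forall Q, T 0 Q = Q) ->
  (forall t Q, on_sphere Q -> on_sphere (T t Q)) ->
  (forall t Q, on_sphere Q -> on_sphere (T' t Q)) ->
  (forall t Q, on_sphere Q -> T' t (T t Q) = Q) ->
  (forall t Q, on_sphere Q -> T t (T' t Q) = Q) ->
  exists H, sphere_isotopy H /\
    forall P, H 1 P = of_sphere (T 1 (to_sphere P)).
Proof.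
move=> cT T0 sT sT' TK T'K.
exists (fun t P => of_sphere (T t (to_sphere P))); split=> //; split.
- move=> p; apply: cont_to_sphere.
  rewrite (_ : (fun _ => _) = fun p : R * S3 R => T p.1 (to_sphere p.2)); last first.
    by apply/funext => q; rewrite of_sphereK//; exact/sT/on_sphere_to.
  apply: (@cont_comp _ _ _ (fun p : R * S3 R => (p.1, to_sphere p.2)) (fun p => T p.1 p.2)).
    apply: cont_pair; first by cont.
    by apply: cont_comp; [cont|exact: to_sphere_continuous].
  exact: cT.
- by apply/funext => P; rewrite T0 to_sphereK.
- move=> t _; exists (fun P => of_sphere (T' t (to_sphere P))) => P;
    have Ps := on_sphere_to P.
    by rewrite of_sphereK ?TK ?to_sphereK//; exact: sT.
  by rewrite of_sphereK ?T'K ?to_sphereK//; exact: sT'.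
Qed.

End Isotopies.

(** * Chords of the circle *)

Section PlaneGeometry.
Variable R : realType.
Implicit Types (p q r : R * R) (s t : R).

Definition norm2 p : R := p.1 ^+ 2 + p.2 ^+ 2.

Definition seg p q s : R * R :=
  ((1 - s) * p.1 + s * q.1, (1 - s) * p.2 + s * q.2).

Definition orient p q r : R :=
  (q.1 - p.1) * (r.2 - p.2) - (q.2 - p.2) * (r.1 - p.1).

Lemma seg0 p q : seg p q 0 = p.
Proof. by case: p => x y; rewrite /seg/= subr0 !mul1r !mul0r !addr0. Qed.

Lemma seg1 p q : seg p q 1 = q.
Proof. by case: q => x y; rewrite /seg/= subrr !mul1r !mul0r !add0r. Qed.

Lemma cont_seg p q s : cont_at (seg p q) s.
Proof. by change (cont_at (fun s => seg p q s) s); rewrite /seg; cont. Qed.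

Lemma segC p q s : seg q p (1 - s) = seg p q s.
Proof. by rewrite /seg /=; congr (_, _); ring. Qed.

Lemma orient_seg p q a b s :
  orient p q (seg a b s) = (1 - s) * orient p q a + s * orient p q b.
Proof. by rewrite /orient /seg /=; ring. Qed.

Lemma orientC p q r : orient q p r = - orient p q r.
Proof. by rewrite /orient; ring. Qed.

Lemma orient_rot p q r : orient q r p = orient p q r.
Proof. by rewrite /orient; ring. Qed.

Lemma orient_swap p q r : orient p r q = - orient p q r.
Proof. by rewrite /orient; ring. Qed.

Lemma orientpp p q : orient p q p = 0 /\ orient p q q = 0.
Proof. by split; rewrite /orient; ring. Qed.

Lemma norm2_ge0 p : 0 <= norm2 p.
Proof. by rewrite addr_ge0 ?sqr_ge0. Qed.

Lemma norm2_seg p q s : norm2 (seg p q s) = (1 - s) * norm2 p + s * norm2 q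
  - s * (1 - s) * norm2 (p.1 - q.1, p.2 - q.2).
Proof. by rewrite /norm2 /seg /=; ring. Qed.

Lemma norm2_dist_eq0 p q : norm2 (p.1 - q.1, p.2 - q.2) = 0 -> p = q.
Proof.
case: p q => [a b] [c d] /eqP; rewrite /norm2 /= paddr_eq0 ?sqr_ge0//.
by rewrite !sqrf_eq0 !subr_eq0 => /andP[/eqP-> /eqP->].
Qed.

Lemma norm2_dist_gt0 p q : p != q -> 0 < norm2 (p.1 - q.1, p.2 - q.2).
Proof.
move=> pq; rewrite lt_def norm2_ge0 andbT; apply: contra pq => /eqP.
by move/norm2_dist_eq0 ->.
Qed.

(** Strict convexity of the disk, read off the last term of [norm2_seg]. *)
Lemma disk_extreme p q s : norm2 p <= 1 -> norm2 q <= 1 -> 0 <= s <= 1 ->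
  1 <= norm2 (seg p q s) -> [\/ s = 0, s = 1 | p = q].
Proof.
move=> p1 q1 /andP[s0 s1]; rewrite norm2_seg => H.
have d0 := norm2_ge0 (p.1 - q.1, p.2 - q.2).
have : s * (1 - s) * norm2 (p.1 - q.1, p.2 - q.2) = 0.
  apply/eqP; rewrite eq_le; apply/andP; split; last first.
    by rewrite !mulr_ge0// subr_ge0.
  have := ler_wpM2l (_ : 0 <= 1 - s) p1; rewrite subr_ge0 s1 => /(_ isT).
  by have := ler_wpM2l s0 q1; lra.
move/eqP; rewrite !mulf_eq0 subr_eq0 => /orP[/orP[/eqP|/eqP/esym]|/eqP].
- by move=> ->; apply: Or31.
- by move=> ->; apply: Or32.
- by move/norm2_dist_eq0 => ->; apply: Or33.
Qed.

Lemma seg_in_disk p q s : norm2 p <= 1 -> norm2 q <= 1 -> 0 <= s <= 1 ->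
  norm2 (seg p q s) <= 1.
Proof.
move=> p1 q1 /andP[s0 s1]; rewrite norm2_seg.
have d0 := norm2_ge0 (p.1 - q.1, p.2 - q.2).
have := ler_wpM2l (_ : 0 <= 1 - s) p1; rewrite subr_ge0 s1 => /(_ isT).
have := ler_wpM2l s0 q1.
have : 0 <= s * (1 - s) * norm2 (p.1 - q.1, p.2 - q.2) by rewrite !mulr_ge0// subr_ge0.
lra.
Qed.

Lemma seg_inj p q : p != q -> injective (seg p q).
Proof.
case: p q => [a b] [c d] pq s t [] e1 e2; apply/eqP; rewrite -subr_eq0.
apply: contraNT pq => st; apply/eqP; congr (_, _).
  have /eqP : (s - t) * (c - a) = 0 by lra.
  by rewrite mulf_eq0 (negPf st)/= subr_eq0 eq_sym => /eqP.
have /eqP : (s - t) * (d - b) = 0 by lra.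
by rewrite mulf_eq0 (negPf st)/= subr_eq0 eq_sym => /eqP.
Qed.

(** If both parameters were nonzero, one of the circle points [q], [r] would lie on the segment from
    [p] to the other, against strict convexity. *)
Lemma rays_distinct p q r s t : norm2 p <= 1 -> norm2 q = 1 -> norm2 r = 1 ->
  p != q -> p != r -> q != r -> 0 <= s <= 1 -> 0 <= t <= 1 ->
  s * (q.1 - p.1) = t * (r.1 - p.1) -> s * (q.2 - p.2) = t * (r.2 - p.2) ->
  s = 0 /\ t = 0.
Proof.
move=> p1; wlog st : q r s t / s <= t.
  move=> H q1 r1 pq pr qr s01 t01 e1 e2; have [st|/ltW ts] := leP s t.
    exact: (H q r s t).
  by have [] := H r q t s ts r1 q1 pr pq _ t01 s01 (esym e1) (esym e2); rewrite // eq_sym.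
move=> q1 r1 pq pr qr /andP[s0 s1] /andP[t0 t1] e1 e2.
have [t_0|t_0] := eqVneq t 0; first by split=> //; apply/eqP; rewrite eq_le s0 andbT -t_0.
have tp : 0 < t by rewrite lt_def t_0.
have rE : r = seg p q (s / t).
  case: (r) (e1) (e2) => a b /= e1' e2'; rewrite /seg; congr (_, _).
    apply: (mulfI t_0); have -> : t * ((1 - s / t) * p.1 + s / t * q.1) =
      t * p.1 + s * (q.1 - p.1) by field.
    lra.
  apply: (mulfI t_0); have -> : t * ((1 - s / t) * p.2 + s / t * q.2) =
    t * p.2 + s * (q.2 - p.2) by field.
  lra.
have st01 : 0 <= s / t <= 1 by rewrite divr_ge0//= ler_pdivrMr// mul1r.
have := @disk_extreme p q (s / t) p1; rewrite q1 -rE r1 lexx => /(_ isT st01 isT)[E|E|E].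
- by move: pr; rewrite rE E seg0 eqxx.
- by move: qr; rewrite rE E seg1 eqxx.
- by move: pq; rewrite E eqxx.
Qed.

End PlaneGeometry.

Section CircleVertices.
Variables (R : realType) (n : nat).
Implicit Types i j k l : 'I_n.
Local Notation cv := (@circle_vertex R n).

Lemma cv_norm2 i : norm2 (cv i) = 1.
Proof. by rewrite /norm2 /= sqrrN cos2Dsin2. Qed.

(** Half the central angle: differences for i < j then lie in (0, pi), where the sine is
    positive. *)
Let ang i : R := pi * i%:R / n%:R.

Lemma ang_sin_gt0 i j : (i < j)%N -> 0 < sin (ang j - ang i).
Proof.
move=> ij; have n0 : (0 < n)%N by exact: leq_ltn_trans (ltn_ord i).
have -> : ang j - ang i = pi * ((j - i)%:R / n%:R).
  by rewrite /ang natrB ?(ltnW ij)//; ring.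
have n0' : 0 < n%:R :> R by rewrite ltr0n.
apply: sin_gt0_pi; rewrite mulr_gt0 ?pi_gt0 ?divr_gt0 ?ltr0n ?subn_gt0//=.
rewrite gtr_pMr ?pi_gt0// ltr_pdivrMr// mul1r ltr_nat.
by rewrite (leq_ltn_trans _ (ltn_ord j))// leq_subr.
Qed.

Lemma orient_cvE i j k : orient (cv i) (cv j) (cv k) =
  - (4 * sin (ang j - ang i) * sin (ang k - ang j) * sin (ang k - ang i)).
Proof.
have dbl i0 : 2 * pi * i0%:R / n%:R = ang i0 + ang i0 by rewrite /ang; ring.
rewrite /orient /circle_vertex /= !dbl !cosD !sinD !sinN !cosN.
have hi := cos2Dsin2 (ang i); have hj := cos2Dsin2 (ang j).
have hk := cos2Dsin2 (ang k); move: hi hj hk.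
move: (cos (ang i)) (sin (ang i)) (cos (ang j)) (sin (ang j)) (cos (ang k)) (sin (ang k)).
move=> a b c d e f hi hj hk.
(* Each term is multiplied by a sum of squares equal to 1; made homogeneous in this way, the formula
   is a polynomial identity. *)
transitivity (- (
  ((c * c - d * d) * (f * e + e * f) - (d * c + c * d) * (e * e - f * f)) * (a ^+ 2 + b ^+ 2)
  - ((c * c - d * d) * (b * a + a * b) - (d * c + c * d) * (a * a - b * b)) * (e ^+ 2 + f ^+ 2)
  - ((a * a - b * b) * (f * e + e * f) - (b * a + a * b) * (e * e - f * f)) * (c ^+ 2 + d ^+ 2))).
  by rewrite hi hj hk; ring.
ring.
Qed.

Lemma orient_cv_lt0 i j k : (i < j)%N -> (j < k)%N ->
  orient (cv i) (cv j) (cv k) < 0.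
Proof.
move=> ij jk; rewrite orient_cvE oppr_lt0 !mulr_gt0 ?ang_sin_gt0//.
exact: ltn_trans jk.
Qed.

Lemma orient_cv_neq0 i j k : i != j -> j != k -> i != k ->
  orient (cv i) (cv j) (cv k) != 0.
Proof.
move=> ij jk ik.
have h a b : a != b -> sin (ang b - ang a) != 0.
  rewrite -val_eqE /= neq_ltn => /orP[] ab; first by rewrite gt_eqF ?ang_sin_gt0.
  by rewrite -opprB sinN oppr_eq0 gt_eqF ?ang_sin_gt0.
by rewrite orient_cvE oppr_eq0 !mulf_neq0 ?h ?pnatr_eq0.
Qed.

Lemma cv_inj : injective cv.
Proof.
move=> i j E; apply/eqP; apply: contraT; rewrite -val_eqE /= neq_ltn.
have key (a b : 'I_n) : (a < b)%N -> cv a = cv b -> false.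
  move=> ab Eab; have := ang_sin_gt0 ab; have [E1 E2] := Eab.
  move: E1 E2; rewrite (_ : 2 * pi * a%:R / n%:R = ang a + ang a); last by rewrite /ang; ring.
  rewrite (_ : 2 * pi * b%:R / n%:R = ang b + ang b); last by rewrite /ang; ring.
  move=> E1 /oppr_inj E2.
  have : cos ((ang b + ang b) - (ang a + ang a)) = 1.
    by rewrite cosB E1 E2 -!expr2 cos2Dsin2.
  rewrite (_ : _ - _ = (ang b - ang a) + (ang b - ang a)); last by ring.
  rewrite cosD -!expr2; have := cos2Dsin2 (ang b - ang a).
  set c := cos _; set s := sin _ => h1 h2 s0.
  have : 0 < s ^+ 2 by rewrite exprn_gt0.
  lra.
by case/orP=> /key; [move/(_ E)|move/(_ (esym E))].
Qed.

(** Separation by one of the two chords suffices: on a circle, if the line through the first chord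
    separates the ends of the second, the four ends alternate. *)
Lemma crossing_orient (e f : {set 'I_n}) : crossing e f <->
  exists i j k l, [/\ e = [set i; j]%SET, f = [set k; l]%SET &
    orient (cv i) (cv j) (cv k) * orient (cv i) (cv j) (cv l) < 0].
Proof.
split=> [[a [b [c [d [ab bc cd []]]]]] [-> ->]|[i [j [k [l [-> -> ]]]]]].
- exists a, c, b, d; split=> //.
  rewrite orient_swap mulNr oppr_lt0 nmulr_rgt0 orient_cv_lt0//.
  exact: ltn_trans bc.
- exists b, d, a, c; split=> //.
  rewrite orient_rot (orient_swap (cv b) (cv c)) mulrN oppr_lt0.
  by rewrite nmulr_rgt0 orient_cv_lt0// (ltn_trans bc).
wlog ij : i j / (i <= j)%N.
  move=> H; have [/H//|/ltnW /H ji] := leqP i j.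
  by rewrite orientC [X in _ * X]orientC mulrNN finset.setUC; exact: ji.
wlog kl : k l / (0 < orient (cv i) (cv j) (cv k)).
  move=> H pr; have [kp|] := ltP 0 (orient (cv i) (cv j) (cv k)); first exact: H.
  rewrite le_eqVlt => /orP[/eqP k0|kn]; first by move: pr; rewrite k0 mul0r ltxx.
  by rewrite [[set k; l]%SET]finset.setUC; apply: H; [rewrite -(nmulr_rlt0 _ kn)|rewrite mulrC].
rewrite pmulr_rlt0// => ln.
(* The labels run clockwise, so increasing triples have negative orientation: [k] on the positive
   side lies strictly between [i] and [j], and [l] on the negative side lies outside. *)
have [z1 z2] := orientpp (cv i) (cv j).
have lij : (i < j)%N.
  rewrite ltn_neqAle ij andbT; apply/eqP => /val_inj E; move: kl.
  by rewrite E /orient !subrr !mul0r subrr ltxx.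
have ik : (i < k)%N.
  rewrite ltnNge leq_eqVlt; apply/negP => /orP[/eqP/val_inj E|ki].
    by move: kl; rewrite E z1 ltxx.
  by move: kl; rewrite orient_rot ltNge ltW// orient_cv_lt0.
have kj : (k < j)%N.
  rewrite ltnNge leq_eqVlt; apply/negP => /orP[/eqP/val_inj E|ki].
    by move: kl; rewrite -E z2 ltxx.
  by move: kl; rewrite ltNge ltW// orient_cv_lt0.
have [li|] := ltnP l i.
  by exists l, i, k, j; split=> //; right; split=> //; rewrite finset.setUC.
rewrite leq_eqVlt => /orP[/eqP/val_inj E|il]; first by move: ln; rewrite -E z1 ltxx.
have [jl|] := ltnP j l; first by exists i, k, j, l; split=> //; left.
rewrite leq_eqVlt => /orP[/eqP/val_inj E|lj]; first by move: ln; rewrite E z2 ltxx.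
move: ln; rewrite orient_swap oppr_lt0 => /lt_trans/(_ (orient_cv_lt0 il lj)).
by rewrite ltxx.
Qed.

Lemma crossing_sym (e f : {set 'I_n}) : crossing e f -> crossing f e.
Proof.
move=> [a [b [c [d [ab bc cd [[-> ->]|[-> ->]]]]]]]; exists a, b, c, d; split=> //;
by [left|right].
Qed.

Lemma chords_meet i j k l s t : i != j -> k != l ->
  [set i; j]%SET != [set k; l]%SET -> 0 <= s <= 1 -> 0 <= t <= 1 ->
  seg (cv i) (cv j) s = seg (cv k) (cv l) t ->
  crossing [set i; j]%SET [set k; l]%SET \/
  exists2 m, m \in ([set i; j] :&: [set k; l])%SET & seg (cv i) (cv j) s = cv m.
Proof.
have share a b c s' t' : a != b -> a != c -> b != c ->
    0 <= s' <= 1 -> 0 <= t' <= 1 ->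
    seg (cv a) (cv b) s' = seg (cv a) (cv c) t' -> seg (cv a) (cv b) s' = cv a.
  move=> ab ac bc s01 t01 [e1 e2].
  have := @rays_distinct R (cv a) (cv b) (cv c) s' t'; rewrite !cv_norm2 lexx.
  rewrite !(inj_eq cv_inj) ab ac bc s01 t01 => /(_ isT erefl erefl isT isT isT isT isT).
  move=> [||-> _]; last by rewrite seg0.
    by rewrite /=; lra.
  by rewrite /=; lra.
have C01 (u : R) : 0 <= u <= 1 -> 0 <= 1 - u <= 1 by lra.
move=> ij kl eqe s01 t01 E; have s01' := C01 _ s01; have t01' := C01 _ t01.
have [ik|ik] := eqVneq i k.
  right; exists i; first by rewrite !inE ik eqxx.
  by subst k; apply: (@share _ _ l s t) => //; apply: contraNneq eqe => ->.
have [il|il] := eqVneq i l.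
  right; exists i; first by rewrite !inE il eqxx orbT.
  subst l; move: E; rewrite -[RHS]segC => E; apply: (@share _ _ k s (1 - t)) => //.
  by apply: contraNneq eqe => ->; rewrite finset.setUC.
have [jk|jk] := eqVneq j k.
  right; exists j; first by rewrite !inE jk eqxx ?orbT.
  subst k; move: E; rewrite -segC => E; apply: (@share _ _ l (1 - s) t) => //.
  by rewrite eq_sym.
have [jl|jl] := eqVneq j l.
  right; exists j; first by rewrite !inE jl eqxx ?orbT.
  subst l; move: E; rewrite -segC -[RHS]segC => E.
  apply: (@share _ _ k (1 - s) (1 - t)) => //; first by rewrite eq_sym.
left; apply/crossing_orient; exists i, j, k, l; split=> //.
have Lk := orient_cv_neq0 ij jk ik; have Ll := orient_cv_neq0 ij jl il.
have : orient (cv i) (cv j) (seg (cv k) (cv l) t) = 0.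
  by rewrite -E orient_seg; have [-> ->] := orientpp (cv i) (cv j); rewrite !mulr0 addr0.
rewrite orient_seg; move: Lk Ll; set a := orient _ _ _; set b := orient _ _ _.
case/andP: t01 => t0 t1 a0 b0 h.
have {}h : (1 - t) * (a * a) + t * (a * b) = 0.
  by rewrite -[RHS](mulr0 a) -h; ring.
have aa : 0 < a * a by rewrite -expr2 exprn_even_gt0.
rewrite lt_neqAle mulf_neq0//= leNgt; apply/negP => ab.
have := mulr_ge0 t0 (ltW ab); have [t_0|t_0] := eqVneq t 0.
  by move: h; rewrite t_0; lra.
have tp : 0 < t by rewrite lt_def t_0.
have := mulr_gt0 tp ab; have : 0 <= (1 - t) * (a * a) by rewrite mulr_ge0 ?subr_ge0 ?(ltW aa).
lra.
Qed.

End CircleVertices.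

(** * Drawings of books *)

Section BookGraphs.
Variables (R : realType) (n : nat).
Local Notation cv := (@circle_vertex R n).
Local Notation V := (R * R * R)%type.

(* Height functions are extended by 0 outside the disk. *)
Definition good_stack s (h : 'I_s -> R * R -> R) : Prop :=
  [/\ forall k, continuous (h k),
      forall k p, 1 <= norm2 p -> h k p = 0
    & forall (k l : 'I_s) p, (k < l)%N -> norm2 p < 1 -> h l p < h k p].

Lemma continuous_extension (h : R * R -> R) :
  {within @closed_disk R, continuous h} ->
  (forall p, norm2 p = 1 -> h p = 0) ->
  continuous (fun p => if norm2 p <= 1 then h p else 0).
Proof.
move=> /subspace_continuousP ch h0 p; set F := fun p => _.
suff H A : nbhs (F p) A -> nbhs p (F @^-1` A) by exact: H.
rewrite {1}/F.
have cn : cont_at (@norm2 R) p by rewrite /norm2; cont.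
case: ifPn => [p1 nA|]; last first.
  rewrite -ltNge => p1 /nbhs_singleton A0.
  have := cont_at_nbhs cn (lt_nbhsr p1); apply: filterS => q /= q1.
  by rewrite /F leNgt q1.
have N : nbhs p [set q | norm2 q <= 1 -> A (h q)] := ch p p1 A nA.
move: p1; rewrite le_eqVlt => /orP[/eqP p1|p1].
  have A0 : A 0 by rewrite -(h0 p p1); exact: nbhs_singleton nA.
  apply: filterS N => q /= Aq; rewrite /F; case: ifP => // qd; exact: Aq.
have := cont_at_nbhs cn (lt_nbhsl p1); move: N; apply: filterS2 => q /= Aq q1.
by rewrite /F (ltW q1); apply: Aq; exact: ltW.
Qed.

Lemma good_stack_sheet s (h : 'I_s -> R * R -> R) : good_stack h -> sheet_stack h.
Proof.
move=> [c0 c1 c2]; split=> //; first by move=> k; exact: continuous_subspaceT.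
by move=> k p p1; apply: c1; rewrite /norm2 p1.
Qed.

Lemma sheet_stack_good s (h : 'I_s -> R * R -> R) : sheet_stack h ->
  exists h', good_stack h' /\ forall k p, norm2 p <= 1 -> h' k p = h k p.
Proof.
move=> [c0 c1 c2]; exists (fun k p => if norm2 p <= 1 then h k p else 0); split; last first.
  by move=> k p ->.
split=> [k|k p p1|k l p kl p1]; last by rewrite (ltW p1); exact: c2.
- by apply: continuous_extension => // p; exact: c1.
- by case: ifPn => // p1'; apply: c1; apply/eqP; rewrite eq_le p1'.
Qed.

Definition arc_point s (B : assignment n s) (h : 'I_s -> R * R -> R) i j t : V :=
  (seg (cv i) (cv j) t, h (B [set i; j]%SET) (seg (cv i) (cv j) t)).

Lemma arc_pointC s (B : assignment n s) h i j t :
  arc_point B h j i (1 - t) = arc_point B h i j t.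
Proof. by rewrite /arc_point segC finset.setUC. Qed.

Lemma seg_cv_disk (i j : 'I_n) t : 0 <= t <= 1 -> norm2 (seg (cv i) (cv j) t) <= 1.
Proof. by move=> t01; rewrite seg_in_disk ?cv_norm2. Qed.

Definition drawn_on s (B : assignment n s) (h : 'I_s -> R * R -> R)
    (G : spatial_graph R n) : Prop :=
  (forall i, vtx G i = R3_in_S3 (cv i, 0)) /\
  (forall i j, i != j -> edge_arc G [set i; j]%SET =
     [set Some (arc_point B h i j t) | t in [set t : R | 0 <= t <= 1]]).

(** An arc that lies in a sheet and projects onto the whole chord can only be the graph of the
    height function over the chord. *)
Lemma book_representation_drawn s (B : assignment n s) G :
  book_representation B G ->
  sheets_noncrossing B /\ exists h, good_stack h /\ drawn_on B h G.
Proof.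
move=> [ncB _ vG [h0 [st arcs]]]; split=> //.
have [h [gh hE]] := sheet_stack_good st; exists h; split=> //; split=> // i j ij.
have [sub pr] := arcs i j ij.
have E t : 0 <= t <= 1 -> arc_point B h i j t =
    (seg (cv i) (cv j) t, h0 (B [set i; j]%SET) (seg (cv i) (cv j) t)).
  by move=> t01; rewrite /arc_point hE// seg_cv_disk.
apply/seteqP; split=> [P GP|_ [t t01 <-]].
  have [_ [p pD <-] PE] := sub _ GP.
  have : chord (cv i) (cv j) p.
    by rewrite -pr; exists (p, h0 (B [set i; j]%SET) p) => //; move: GP; rewrite -PE.
  by move=> [t t01 tp]; exists t => //; rewrite E// -PE /R3_in_S3 -tp.
have : chord (cv i) (cv j) (seg (cv i) (cv j) t) by exists t.
rewrite -pr => -[[p z] /= Gpz pE].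
have [_ [q qD <-] [qE zE]] := sub _ Gpz; rewrite (E t t01) -pE.
by move: Gpz; rewrite /R3_in_S3 -zE qE.
Qed.

(** Two arcs can meet only over a common point of their chords. This is a shared vertex or a
    crossing; crossing edges lie in different sheets, whose heights differ over the open disk. *)
Lemma drawn_book_representation s (B : assignment n s) h G :
  sheets_noncrossing B -> good_stack h -> drawn_on B h G -> book_representation B G.
Proof.
move=> ncB gh [vG arcs]; have [ch h0 hlt] := gh.
have hcv k i : h k (cv i) = 0 by rewrite h0 ?cv_norm2.
have cvE i j : (cv i == cv j) = (i == j) by rewrite (inj_eq (@cv_inj R n)).
have edge (e : {set 'I_n}) : is_edge e -> exists i j, i != j /\ e = [set i; j]%SET.
  by move=> /cards2P[i [j [ij ->]]]; exists i, j.
split=> //.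
  split.
  - by move=> i j; rewrite !vG => /(congr1 (odflt (cv i, 0)))/(congr1 fst)/(@cv_inj R n).
  - move=> i j ij; exists (fun t => Some (arc_point B h i j t)); split.
    + apply: continuous_subspaceT => t.
      apply: (@cont_comp R V (S3 R) (fun t : R => arc_point B h i j t) Some).
        rewrite /arc_point; apply: cont_pair; first exact: cont_seg.
        apply: (@cont_comp _ _ _ (seg (cv i) (cv j))); first exact: cont_seg.
        exact: ch.
      exact: one_point_compactification_some_continuous.
    + by move=> t u _ _ [] /= e1 e2 _; apply: (@seg_inj _ (cv i) (cv j)); rewrite ?cvE// /seg e1 e2.
    + by rewrite vG /arc_point seg0 hcv.
    + by rewrite vG /arc_point seg1 hcv.
    + by rewrite arcs.
  - move=> k e /edge[i [j [ij ->]]]; rewrite arcs// vG => -[t t01].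
    move=> /(congr1 (odflt (cv i, 0)))/(congr1 fst) /= E.
    have := @disk_extreme R (cv i) (cv j) t; rewrite E !cv_norm2 lexx.
    move=> /(_ isT isT t01 isT)[t0|t1|/eqP]; last by rewrite cvE (negPf ij).
      by move: E; rewrite t0 seg0 => /(@cv_inj R n) ->; rewrite !inE eqxx.
    by move: E; rewrite t1 seg1 => /(@cv_inj R n) ->; rewrite !inE eqxx orbT.
  - move=> e f /edge[i [j [ij ->]]] /edge[k [l [kl ->]]] ef P [].
    rewrite !arcs// => -[t t01 <-] [u u01] /(congr1 (odflt (cv i, 0))).
    move=> /[dup] /(congr1 fst) /= /esym E /(congr1 snd) /= Ez.
    have vert m : m \in ([set i; j] :&: [set k; l])%SET -> seg (cv i) (cv j) t = cv m ->
        exists2 i0, i0 \in ([set i; j] :&: [set k; l])%SET & vtx G i0 = Some (arc_point B h i j t).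
      by move=> mI mE; exists m; rewrite // vG /arc_point mE hcv.
    have [cr|[m mI mE]] := chords_meet ij kl ef t01 u01 E; last exact: vert mI mE.
    (* On the circle the point would be an end of both chords, whereas crossing edges have no common
       end. *)
    have oc : norm2 (seg (cv i) (cv j) t) < 1.
      rewrite lt_neqAle seg_cv_disk// andbT; apply/eqP => n1.
      have K1 := @disk_extreme R (cv i) (cv j) t; have K2 := @disk_extreme R (cv k) (cv l) u.
      move: K1 K2; rewrite -E n1 !cv_norm2 lexx => /(_ isT isT t01 isT) K1 /(_ isT isT u01 isT) K2.
      have [a aI aE] : exists2 a, a \in [set i; j]%SET & seg (cv i) (cv j) t = cv a.
        case: K1 => [->|->|/eqP]; last by rewrite cvE (negPf ij).
          by exists i; rewrite ?seg0// !inE eqxx.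
        by exists j; rewrite ?seg1// !inE eqxx orbT.
      have [b bI bE] : exists2 b, b \in [set k; l]%SET & seg (cv k) (cv l) u = cv b.
        case: K2 => [->|->|/eqP]; last by rewrite cvE (negPf kl).
          by exists k; rewrite ?seg0// !inE eqxx.
        by exists l; rewrite ?seg1// !inE eqxx orbT.
      have ab : a = b by apply: (@cv_inj R n); rewrite -aE -bE E.
      move/(@crossing_orient R): cr => [i' [j' [k' [l' [e1 e2 pr]]]]].
      rewrite e1 in aI; rewrite e2 -ab in bI.
      have [z1 z2] := orientpp (cv i') (cv j'); move: pr.
      move: aI; rewrite !inE => /orP[]/eqP aa; move: bI; rewrite !inE => /orP[]/eqP bb;
        by move: z1 z2; rewrite -?aa -?bb => z1 z2; rewrite ?z1 ?z2 ?mul0r ?mulr0 ltxx.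
    exfalso; move: cr; apply: ncB; rewrite /is_edge ?cards2 ?ij ?kl//.
    apply: ord_inj.
    case: (ltngtP (B [set i; j]%SET) (B [set k; l]%SET)) => // /hlt/(_ oc);
      by rewrite -Ez E ltxx.
exists h; split; first exact: good_stack_sheet.
move=> i j ij; rewrite arcs//; split.
  move=> _ [t t01 <-]; exists (arc_point B h i j t) => //.
  by exists (seg (cv i) (cv j) t) => //; exact: seg_cv_disk.
apply/seteqP; split=> [_ [[p z] [t t01 [<- _] <-]]|_ [t t01 <-]]; first by exists t.
by exists (arc_point B h i j t) => //; exists t.
Qed.

Definition book_graph s (B : assignment n s) h : spatial_graph R n :=
  SpatialGraph (fun i => R3_in_S3 (cv i, 0))
    (fun e => [set P | exists i j t, [/\ i != j, e = [set i; j]%SET, 0 <= t <= 1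
                       & P = Some (arc_point B h i j t)]]).

Lemma book_graph_drawn s (B : assignment n s) h : drawn_on B h (book_graph B h).
Proof.
split=> // i j ij; apply/seteqP; split=> P /=; last first.
  by move=> [t t01 <-]; exists i, j, t.
move=> [i' [j' [t [ij' E t01 ->]]]].
have : i' \in [set i; j]%SET by rewrite E !inE eqxx.
have : j' \in [set i; j]%SET by rewrite E !inE eqxx orbT.
rewrite !inE => /orP[]/eqP jE /orP[]/eqP iE; subst i' j'; rewrite ?eqxx// in ij' *.
- by exists (1 - t); [lra|rewrite arc_pointC].
- by exists t.
Qed.

Definition sphere_isotopic (G G' : spatial_graph R n) : Prop :=
  exists H : R -> S3 R -> S3 R, sphere_isotopy H /\
  exists sg : {perm 'I_n},
    (forall i, H 1 (vtx G i) = vtx G' (sg i)) /\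
    (forall e, is_edge e -> H 1 @` edge_arc G e = edge_arc G' (sg @: e)%SET).

Lemma sphere_isotopic_ambient G G' : sphere_isotopic G G' -> ambient_isotopic G G'.
Proof.
by move=> [H [iH HG]]; exists H; split=> //; exact: sphere_isotopy_ambient.
Qed.

Lemma sphere_isotopic_trans G1 G2 G3 :
  sphere_isotopic G1 G2 -> sphere_isotopic G2 G3 -> sphere_isotopic G1 G3.
Proof.
move=> [H [iH [sg [Hv He]]]] [K [iK [tg [Kv Ke]]]].
exists (fun t => K t \o H t); split; first exact: sphere_isotopy_comp.
exists (sg * tg)%g; split=> [i|e ie]; first by rewrite /= Hv Kv permM.
have ie' : is_edge (sg @: e) by rewrite /is_edge card_imset//; exact: perm_inj.
rewrite -image_comp He// Ke// -imset_comp; congr (edge_arc _ _).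
by apply: eq_imset => i; rewrite /= permM.
Qed.

Lemma isotopic_of_points s s' (B : assignment n s) (B' : assignment n s') h h' G G' H
    (sg : {perm 'I_n}) : (2 <= n)%N -> good_stack h -> good_stack h' ->
  drawn_on B h G -> drawn_on B' h' G' -> sphere_isotopy H ->
  (forall i j t, i != j -> 0 <= t <= 1 ->
     H 1 (Some (arc_point B h i j t)) = Some (arc_point B' h' (sg i) (sg j) t)) ->
  sphere_isotopic G G'.
Proof.
move=> n2 [_ h0 _] [_ h0' _] [vG aG] [vG' aG'] iH HP.
exists H; split=> //.
have edgeE i j : (sg @: [set i; j] = [set sg i; sg j])%SET by rewrite imsetU1 imset_set1.
exists sg; split.
  (* The image of a vertex is read off as the end t = 0 of an arc, which requires a second
     vertex. *)
  move=> i; have [j ij] : exists j, i != j.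
    have [i0|i0] := eqVneq (i : nat) 0%N.
      by exists (Ordinal n2); rewrite -val_eqE /= i0.
    have n0 : (0 < n)%N by exact: ltnW.
    by exists (Ordinal n0); rewrite -val_eqE /=.
  have := HP i j 0 ij; rewrite lexx ler01 => /(_ isT).
  by rewrite /arc_point !seg0 vG vG' h0 ?h0' ?cv_norm2.
move=> e /cards2P[i [j [ij ->]]]; rewrite edgeE aG// aG' ?(inj_eq perm_inj)//.
apply/seteqP; split=> [_ [_ [t t01 <-] <-]|_ [t t01 <-]].
  by exists t => //; rewrite HP.
by exists (Some (arc_point B h i j t)); [exists t|rewrite HP].
Qed.

End BookGraphs.

(** * Vertical isotopies *)

Lemma inj_surj_bijective (T U : choiceType) (f : T -> U) :
  injective f -> (forall y, exists x, f x = y) -> bijective f.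
Proof.
move=> fi fs; have h y := boolp.cid (fs y).
by exists (fun y => projT1 (h y)) => x; [apply: fi|]; exact: projT2 (h _).
Qed.

Section Interpolation.
Variables (R : realType) (m : nat) (a b : nat -> R).

(* The increasing piecewise affine map sending a k to b k for k <= m, with
   slope 1 outside of [a m, a 0]. *)
Definition interp (z : R) : R :=
  b m + Num.min (z - a m) 0
  + \sum_(k < m) (b k - b k.+1) * clamp01 ((z - a k.+1) / (a k - a k.+1))
  + Num.max (z - a 0%N) 0.

Lemma clamp01_ge1 (x : R) : 1 <= x -> clamp01 x = 1.
Proof. by move=> x1; rewrite /clamp01 (min_idPl x1) (max_idPr _)// ler01. Qed.

Lemma clamp01_le0 (x : R) : x <= 0 -> clamp01 x = 0.
Proof.
by move=> x0; rewrite /clamp01 (min_idPr _) ?(max_idPl _)// (le_trans x0) ?ler01.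
Qed.

Lemma clamp01_le (x y : R) : x <= y -> clamp01 x <= clamp01 y.
Proof.
move=> xy; rewrite /clamp01 ge_max !le_max lexx /=; apply/orP; right.
by rewrite le_min !ge_min lexx xy orbT.
Qed.

Section Strict.
Hypothesis a_decr : forall k, (k < m)%N -> a k.+1 < a k.
Hypothesis b_decr : forall k, (k < m)%N -> b k.+1 < b k.

Lemma decr_le (c : nat -> R) : (forall k, (k < m)%N -> c k.+1 < c k) ->
  forall i j, (i <= j <= m)%N -> c j <= c i.
Proof.
move=> cd i j /andP[ij jm]; elim: j ij jm => [|j IH].
  by rewrite leqn0 => /eqP ->.
rewrite leq_eqVlt => /orP[/eqP->//|ij jm].
by apply: le_trans (IH ij (ltnW jm)); exact/ltW/cd.
Qed.

Lemma interp_node j : (j <= m)%N -> interp (a j) = b j.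
Proof.
move=> jm; rewrite /interp (min_idPr _) ?subr_ge0 ?decr_le ?jm ?leqnn//.
rewrite (max_idPr _) ?subr_le0 ?decr_le ?leq0n// !addr0.
rewrite (_ : \sum_(k < m) _ = b j - b m); first by rewrite addrC subrK.
rewrite (_ : \sum_(k < m) _ = \sum_(0 <= k < m)
  (if (j <= k)%N then b k - b k.+1 else 0)).
  rewrite (big_cat_nat (n := j))//= big_nat big1 ?add0r; last first.
    by move=> i /andP[_ ij]; rewrite leqNgt ij.
  rewrite big_nat (eq_bigr (fun k => - (b k.+1 - b k))); last first.
    by move=> i /andP[-> _]; rewrite opprB.
  by rewrite -big_nat sumrN telescope_sumr// opprB.
rewrite big_mkord; apply: eq_bigr => k _.
have d0 : 0 < a k - a k.+1 by rewrite subr_gt0 a_decr.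
case: leqP => kj.
  rewrite clamp01_ge1 ?mulr1// ler_pdivlMr// mul1r lerB// decr_le// kj/=.
  exact: ltnW.
by rewrite clamp01_le0 ?mulr0// pmulr_lle0 ?invr_gt0// subr_le0 decr_le// kj.
Qed.

(** Every summand is nondecreasing, so a failure forces each of them to agree at [x] and [y]. Then
    [y] is pushed below one node after another, down to [a m], which is at most [x]. *)
Lemma interp_strict x y : x < y -> interp x < interp y.
Proof.
move=> xy; rewrite /interp -!addrA ltrD2l.
have mn : Num.min (x - a m) 0 <= Num.min (y - a m) 0.
  by rewrite le_min !ge_min lexx orbT andbT lerD2r (ltW xy).
have mx : Num.max (x - a 0%N) 0 <= Num.max (y - a 0%N) 0.
  by rewrite ge_max !le_max lexx orbT andbT lerD2r (ltW xy).
have term (k : 'I_m) : (b k - b k.+1) * clamp01 ((x - a k.+1) / (a k - a k.+1)) <=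
    (b k - b k.+1) * clamp01 ((y - a k.+1) / (a k - a k.+1)).
  apply: ler_wpM2l; first by rewrite subr_ge0 ltW// b_decr.
  by apply: clamp01_le; rewrite ler_pM2r ?invr_gt0 ?subr_gt0 ?a_decr// lerB// ltW.
have sm : \sum_(k < m) (b k - b k.+1) * clamp01 ((x - a k.+1) / (a k - a k.+1)) <=
    \sum_(k < m) (b k - b k.+1) * clamp01 ((y - a k.+1) / (a k - a k.+1)).
  by apply: ler_sum => k _; exact: term.
rewrite ltNge; apply/negP => le.
have [y_le|y_gt] := leP y (a 0%N); last first.
  have : Num.max (x - a 0%N) 0 < Num.max (y - a 0%N) 0.
    have ? := xy; have ? : 0 < y - a 0%N by rewrite subr_gt0.
    by rewrite gt_max !lt_max; apply/andP; split; apply/orP; left => //; lra.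
  lra.
have [x_ge|x_lt] := leP (a m) x; last first.
  have : Num.min (x - a m) 0 < Num.min (y - a m) 0.
    have ? := xy; have ? : x - a m < 0 by rewrite subr_lt0.
    by rewrite lt_min !gt_min; apply/andP; split; apply/orP; left => //; lra.
  lra.
have all_eq (k : 'I_m) : clamp01 ((x - a k.+1) / (a k - a k.+1)) =
    clamp01 ((y - a k.+1) / (a k - a k.+1)).
  apply/eqP; rewrite eq_le; apply/andP; split.
    by apply: clamp01_le; rewrite ler_pM2r ?invr_gt0 ?subr_gt0 ?a_decr// lerB// ltW.
  rewrite -(@ler_pM2l _ (b k - b k.+1)) ?subr_gt0 ?b_decr//.
  have : \sum_(k < m) (b k - b k.+1) * clamp01 ((y - a k.+1) / (a k - a k.+1)) <=
      \sum_(k < m) (b k - b k.+1) * clamp01 ((x - a k.+1) / (a k - a k.+1)) by lra.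
  rewrite (bigD1 k)//= [X in _ <= X](bigD1 k)//=.
  have : \sum_(i < m | i != k) (b i - b i.+1) * clamp01 ((x - a i.+1) / (a i - a i.+1)) <=
    \sum_(i < m | i != k) (b i - b i.+1) * clamp01 ((y - a i.+1) / (a i - a i.+1)).
    by apply: ler_sum => i _; exact: term.
  lra.
suff H : forall j, (j <= m)%N -> y <= a j by have := H m (leqnn _); lra.
elim=> // j IH jm; have {IH} yj := IH (ltnW jm).
rewrite leNgt; apply/negP => ay.
have d0 : 0 < a j - a j.+1 by rewrite subr_gt0 a_decr.
have := all_eq (Ordinal jm) => /=.
have -> : clamp01 ((y - a j.+1) / (a j - a j.+1)) = (y - a j.+1) / (a j - a j.+1).
  apply: clamp01_id; apply/andP; split.
    by rewrite divr_ge0 ?(ltW d0)// subr_ge0 ltW.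
  by rewrite ler_pdivrMr// mul1r lerD2r.
have [x_le|x_gt] := leP x (a j.+1).
  rewrite clamp01_le0; last by rewrite pmulr_lle0 ?invr_gt0// subr_le0.
  by move=> /esym/eqP; rewrite mulf_eq0 invr_eq0 (gt_eqF d0) subr_eq0 (gt_eqF ay).
have -> : clamp01 ((x - a j.+1) / (a j - a j.+1)) = (x - a j.+1) / (a j - a j.+1).
  apply: clamp01_id; apply/andP; split.
    by rewrite divr_ge0 ?(ltW d0)// subr_ge0 ltW.
  by rewrite ler_pdivrMr// mul1r lerD2r (le_trans (ltW xy)).
by move/(mulIf (invr_neq0 (lt0r_neq0 d0))); lra.
Qed.

(** A displacement bounded independently of the point of the disk keeps the vertical isotopy
    proper. *)
Lemma interp_bound (M : R) z : (forall k, (k <= m)%N -> `|a k| <= M) ->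
  (forall k, (k <= m)%N -> `|b k| <= M) -> `|interp z - z| <= 4 * M.
Proof.
move=> aM bM.
have S0 : 0 <= \sum_(k < m) (b k - b k.+1) * clamp01 ((z - a k.+1) / (a k - a k.+1)).
  apply: sumr_ge0 => k _; apply: mulr_ge0; first by rewrite subr_ge0 ltW// b_decr.
  by have /andP[] := clamp01_itv ((z - a k.+1) / (a k - a k.+1)).
have S1 : \sum_(k < m) (b k - b k.+1) * clamp01 ((z - a k.+1) / (a k - a k.+1)) <= b 0%N - b m.
  rewrite (_ : b 0%N - b m = \sum_(k < m) (b k - b k.+1)).
    apply: ler_sum => k _; apply: ler_piMr; first by rewrite subr_ge0 ltW// b_decr.
    by have /andP[] := clamp01_itv ((z - a k.+1) / (a k - a k.+1)).
  rewrite -(big_mkord xpredT (fun k => b k - b k.+1)).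
  rewrite (eq_bigr (fun k => - (b k.+1 - b k))); last by move=> i _; rewrite opprB.
  by rewrite sumrN telescope_sumr// opprB.
have := aM 0%N (leq0n _); have := aM m (leqnn _).
have := bM 0%N (leq0n _); have := bM m (leqnn _).
rewrite /interp !ler_norml => /andP[? ?] /andP[? ?] /andP[? ?] /andP[? ?].
have := decr_le a_decr (_ : (0 <= m <= m)%N); rewrite leq0n leqnn => /(_ isT) ?.
by case: (lerP (z - a m) 0) => ?; case: (lerP (z - a 0%N) 0) => ?; apply/andP; split; lra.
Qed.

End Strict.

(** The degenerate case on and outside the circle, where all sheets have height 0: the sum vanishes,
    whatever its 0 / 0 quotients are, and min (z, 0) + max (z, 0) = z. *)
Lemma interp_trivial z : (forall k, (k <= m)%N -> a k = 0) ->
  (forall k, (k <= m)%N -> b k = 0) -> interp z = z.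
Proof.
move=> a0 b0; rewrite /interp a0// b0// a0// big1 ?addr0 ?add0r.
  by rewrite !subr0; case: (lerP z 0) => ?; rewrite ?addr0 ?add0r.
by move=> k _; rewrite b0 ?(ltnW (ltn_ord k))// b0// subrr mul0r.
Qed.

End Interpolation.

Lemma cont_at_squeeze (R : realType) (T : topologicalType) (f g : T -> R) (x : T) :
  cont_at g x -> g x = 0 -> (forall y, `|f y| <= `|g y|) -> cont_at f x.
Proof.
move=> cg g0 fg.
have f0 : f x = 0 by apply/eqP; rewrite -normr_le0 (le_trans (fg x))// g0 normr0.
apply/(@cvgrPdist_lt R R) => e e0; rewrite f0.
have : nbhs (g x) [set u | `|u| < e].
  rewrite g0; exists e => //= u /=; by rewrite sub0r normrN.
move=> /(cont_at_nbhs cg) N; near=> y.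
rewrite sub0r normrN; apply: le_lt_trans (fg y) _.
by near: y.
Unshelve. all: by end_near. Qed.

(** Where two neighbouring sheets come together at the circle the ratio has no limit, but it is
    clamped to [0, 1] and multiplied by a gap that tends to 0. *)
Lemma cont_at_clamp_ratio (R : realType) (T : topologicalType) (g u d : T -> R) (x : T) :
  cont_at g x -> cont_at u x -> cont_at d x -> (d x = 0 -> g x = 0) ->
  cont_at (fun y => g y * clamp01 (u y / d y)) x.
Proof.
move=> cg cu cd gd; have [d0|d0] := eqVneq (d x) 0; last by rewrite /clamp01; cont.
apply: (@cont_at_squeeze _ _ _ g) => // [|y]; first exact: gd.
have /andP[c0 c1] := clamp01_itv (u y / d y).
by rewrite normrM (ger0_norm c0) ler_piMr.
Qed.

Section VerticalIsotopy.
Variables (R : realType).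
Local Notation V := (R * R * R)%type.

Lemma good_stack_bounded s (h : 'I_s -> R * R -> R) : good_stack h ->
  exists M, forall k p, `|h k p| <= M.
Proof.
move=> [ch h0 _].
have bk k : exists M, forall p, `|h k p| <= M.
  have cS : compact (`[-1, 1 : R] `*` `[-1, 1 : R]).
    by apply: compact_setX; exact: segment_compact.
  have /compact_bounded[M [_ MC]] : compact (h k @` (`[-1, 1] `*` `[-1, 1])).
    by apply: continuous_compact => //; exact/continuous_subspaceT/ch.
  have M0 : 0 <= Num.max 0 M + 1 by rewrite addr_ge0 ?le_max ?lexx.
  exists (Num.max 0 M + 1) => p; have [p1|p1] := leP 1 (norm2 p).
    by rewrite h0// normr0.
  apply: MC; first by rewrite ltr_pwDr// le_max lexx orbT.
  exists p => //; have p1' := ltW p1.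
  have sq (u v : R) : u ^+ 2 + v ^+ 2 <= 1 -> -1 <= u <= 1.
    move=> uv; rewrite -ler_norml -(@ler_sqr _ _ 1) ?nnegrE// real_normK ?num_real//.
    by rewrite expr1n (le_trans _ uv)// lerDl sqr_ge0.
  split; rewrite /= in_itv /=; first exact: (sq _ p.2).
  by apply: (sq _ p.1); rewrite addrC.
have hM k := boolp.cid (bk k).
exists (\sum_k `|projT1 (hM k)|) => k p.
apply: (le_trans (projT2 (hM k) p)); rewrite (bigD1 k)//=.
by apply: (le_trans (ler_norm _)); rewrite lerDl sumr_ge0.
Qed.

Lemma vertical_isotopy s (h h' : 'I_s -> R * R -> R) :
  good_stack h -> good_stack h' ->
  exists H, sphere_isotopy H /\
    forall k p, H 1 (Some (p, h k p) : S3 R) = Some (p, h' k p).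
Proof.
case: s h h' => [|m] h h' gh gh'.
  exists (fun _ => id); split; last by case.
  split=> //; first by move=> p; exact: cvg_snd.
  by move=> t _; exists id.
have [ch h0 hlt] := gh; have [ch' h0' hlt'] := gh'.
have [M hM] := good_stack_bounded gh; have [M' hM'] := good_stack_bounded gh'.
pose f p := interp m (fun k => h (inord k) p) (fun k => h' (inord k) p).
have inordS k : (k < m)%N -> ((inord k : 'I_m.+1) < (inord k.+1 : 'I_m.+1))%N.
  by move=> km; rewrite !inordK// ltnS ltnW.
have out p z : 1 <= norm2 p -> f p z = z.
  by move=> p1; apply: interp_trivial => k _; [exact: h0|exact: h0'].
have f_node k p : f p (h k p) = h' k p.
  have [p1|p1] := leP 1 (norm2 p); first by rewrite out// h0// h0'.
  have := @interp_node R m (fun k => h (inord k) p) (fun k => h' (inord k) p).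
  move=> /(_ _ k (leq_ord k)); rewrite inord_val; apply.
  by move=> j jm; apply: hlt => //; exact: inordS.
have f_lt p x y : x < y -> f p x < f p y.
  have [p1|p1] := leP 1 (norm2 p); first by rewrite !out.
  by apply: interp_strict => j jm; [apply: hlt|apply: hlt'] => //; exact: inordS.
have f_bd p z : `|f p z - z| <= 4 * (`|M| + `|M'|).
  have [p1|p1] := leP 1 (norm2 p).
    by rewrite out// subrr normr0 mulr_ge0// addr_ge0.
  apply: interp_bound => j jm.
  - by apply: hlt => //; exact: inordS.
  - by apply: hlt' => //; exact: inordS.
  - by rewrite (le_trans (hM _ _))// (le_trans (ler_norm M))// lerDl.
  - by rewrite (le_trans (hM' _ _))// (le_trans (ler_norm M'))// lerDr.
have f_cont : continuous (fun X : V => f X.1 X.2).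
  move=> X; change (cont_at (fun X : V => f X.1 X.2) X); rewrite /f /interp.
  have cc (g : 'I_m.+1 -> R * R -> R) k : (forall k, continuous (g k)) -> cont_at (fun X : V => g k X.1) X.
    by move=> cg; apply: (@cont_comp _ _ _ (fun X : V => X.1)); [cont|exact: cg].
  apply: cont_add; last by apply: cont_max; [apply: cont_add; [cont|apply: cont_opp; exact: cc]|cont].
  apply: cont_add.
    apply: cont_add; first exact: cc.
    by apply: cont_min; [apply: cont_add; [cont|apply: cont_opp; exact: cc]|cont].
  apply: cont_sum => k; apply: cont_at_clamp_ratio.
  - by apply: cont_add; [exact: cc|apply: cont_opp; exact: cc].
  - by apply: cont_add; [cont|apply: cont_opp; exact: cc].
  - by apply: cont_add; [exact: cc|apply: cont_opp; exact: cc].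
  - have [p1|p1] := leP 1 (norm2 X.1); first by rewrite !h0' ?subrr.
    by move/eqP; rewrite subr_eq0 gt_eqF// hlt// inordS.
set C := 4 * (`|M| + `|M'|) in f_bd.
have C0 : 0 <= C by rewrite mulr_ge0// addr_ge0.
(* A convex combination of the identity with an increasing map is increasing, so every intermediate
   time is a bijection on each vertical line. *)
pose g t p z := (1 - t) * z + t * f p z.
have g_bd t p z : 0 <= t <= 1 -> `|g t p z - z| <= C.
  move=> /andP[t0 t1]; rewrite (_ : _ - z = t * (f p z - z)); last by rewrite /g; ring.
  by rewrite normrM ger0_norm// (le_trans _ (f_bd p z))// ler_piMl.
have g_lt t p x y : 0 <= t <= 1 -> x < y -> g t p x < g t p y.
  move=> /andP[t0 t1] xy; have fxy := f_lt p _ _ xy; rewrite /g.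
  have [tE|tn] := eqVneq t 0; first by rewrite tE subr0 !mul1r !mul0r !addr0.
  rewrite ler_ltD// ?ler_wpM2l ?subr_ge0 ?(ltW xy)// ltr_pM2l//.
  by rewrite lt_def tn.
pose F t (X : V) : V := (X.1, g t X.1 X.2).
have [H [iH HE]] : exists H, sphere_isotopy H /\ forall X, H 1 (Some X) = Some (F 1 X).
  apply: extend_isotopy.
  - move=> p; change (cont_at (fun p : R * V => F p.1 p.2) p); rewrite /F /g.
    have cf : cont_at (fun y : R * V => f y.2.1 y.2.2) p.
      apply: (@cont_comp _ _ _ (fun y : R * V => y.2) (fun X : V => f X.1 X.2)).
        by cont.
      exact: f_cont.
    by cont.
  - by apply/funext => -[p z]; rewrite /F /g /= subr0 mul1r mul0r addr0.
  - move=> t t01; apply: inj_surj_bijective.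
      move=> [p z] [q w] [/= -> E]; congr (_, _).
      apply/eqP; move: E; rewrite /F /=; case: (ltgtP z w) => // /(g_lt t q _ _ t01);
        by move=> + E; rewrite E ltxx.
    (* Points are displaced by at most [C], so the intermediate value theorem on [y - C, y + C]
       finds a preimage of [y]. *)
    move=> [p y]; have yC : y - C <= y + C by lra.
    have cg : {within `[y - C, y + C], continuous (g t p)}.
      apply: continuous_subspaceT => z; change (cont_at (fun z => (1 - t) * z + t * f p z) z).
      have cf : cont_at (f p) z.
        apply: (@cont_comp _ _ _ (fun z => (p, z)) (fun X : V => f X.1 X.2)).
          by cont.
        exact: f_cont.
      by cont.
    have [|z _ zy] := IVT yC cg (_ : _ <= y <= _).
      have := g_bd t p (y - C) t01; have := g_bd t p (y + C) t01.
      rewrite !ler_norml => /andP[? ?] /andP[? ?].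
      by rewrite ge_min le_max; apply/andP; split; apply/orP; [left|right]; lra.
    by exists (p, z); rewrite /F /= zy.
  - move=> r; exists (`|r| + C) => t X t01; rewrite !norm3_le => /and3P[/= e1 e2 e3].
    have rr := ler_norm r.
    have := g_bd t X.1 X.2 t01; rewrite ler_norml => /andP[? ?].
    move: e3; rewrite ler_norml => /andP[? ?].
    by apply/and3P; split; rewrite ?(le_trans e1) ?(le_trans e2) ?ler_norml; lra.
exists H; split=> // k p; rewrite HE /F /g /= f_node.
by rewrite subrr mul0r add0r mul1r.
Qed.

End VerticalIsotopy.

(** * Sheet insertion and edge moves *)

Section BookIsotopies.
Variables (R : realType) (n : nat).
Hypothesis n2 : (2 <= n)%N.
Local Notation cv := (@circle_vertex R n).
Local Notation V := (R * R * R)%type.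

Definition book_isotopic s s' (B : assignment n s) (B' : assignment n s') : Prop :=
  forall G G' : spatial_graph R n,
    book_representation B G -> book_representation B' G' -> sphere_isotopic G G'.

(** A paraboloid cap, cut off outside the disk: over a chord it is a parabola in the chord
    parameter, which is the form of the edges in the vertex exchange. *)
Definition dome (p : R * R) : R := Num.max 0 (1 - norm2 p).

Lemma cont_dome p : cont_at dome p.
Proof. by change (cont_at (fun p => dome p) p); rewrite /dome /norm2; cont. Qed.

Lemma dome_gt0 p : norm2 p < 1 -> 0 < dome p.
Proof. by move=> p1; rewrite /dome lt_max subr_gt0 p1 orbT. Qed.

Lemma dome_eq0 p : 1 <= norm2 p -> dome p = 0.
Proof. by move=> p1; rewrite /dome (max_idPl _)// subr_le0. Qed.

Lemma dome_stack s (c : 'I_s -> R) (w : R * R -> R) :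
  (forall p, cont_at w p) -> (forall p, norm2 p < 1 -> 0 < w p) ->
  (forall p, 1 <= norm2 p -> w p = 0) ->
  (forall k l : 'I_s, (k < l)%N -> c l < c k) ->
  good_stack (fun k p => c k * w p).
Proof.
move=> cw w0 w1 cc; split=> [k p|k p p1|k l p kl p1]; last by rewrite ltr_pM2r ?w0 ?cc.
  by change (cont_at (fun p => c k * w p) p); apply: cont_mul; [cont|exact: cw].
by rewrite w1// mulr0.
Qed.

Definition std_stack s : 'I_s -> R * R -> R := fun k p => - (k : nat)%:R * dome p.

Lemma std_stack_good s : good_stack (@std_stack s).
Proof.
apply: dome_stack => [||p|k l kl]; [exact: cont_dome|exact: dome_gt0|exact: dome_eq0|].
by rewrite ltrN2 ltr_nat.
Qed.

Lemma book_representation_exists s (B : assignment n s) : sheets_noncrossing B ->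
  exists G : spatial_graph R n, book_representation B G.
Proof.
move=> ncB; exists (book_graph B (@std_stack s)).
exact: drawn_book_representation ncB (@std_stack_good s) (book_graph_drawn _ _).
Qed.

Lemma book_isotopic_refl s (B : assignment n s) : book_isotopic B B.
Proof.
move=> G G' /book_representation_drawn[_ [h [gh dG]]].
move=> /book_representation_drawn[_ [h' [gh' dG']]].
have [H [iH HE]] := vertical_isotopy gh gh'.
apply: (@isotopic_of_points R n s s B B h h' G G' H 1%g) => // i j t ij t01.
by rewrite !perm1 /arc_point HE.
Qed.

Lemma book_isotopic_trans s1 s2 s3 (B1 : assignment n s1) (B2 : assignment n s2)
    (B3 : assignment n s3) : sheets_noncrossing B2 ->
  book_isotopic B1 B2 -> book_isotopic B2 B3 -> book_isotopic B1 B3.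
Proof.
move=> nc2 H12 H23 G1 G3 r1 r3; have [G2 r2] := book_representation_exists nc2.
exact: sphere_isotopic_trans (H12 _ _ r1 r2) (H23 _ _ r2 r3).
Qed.

Lemma book_isotopic_shared s s' (B : assignment n s) (B' : assignment n s')
    (G : spatial_graph R n) :
  book_representation B G -> book_representation B' G -> book_isotopic B B'.
Proof.
move=> rB rB' G1 G2 r1 r2.
exact: sphere_isotopic_trans (book_isotopic_refl r1 rB) (book_isotopic_refl rB' r2).
Qed.

Lemma book_isotopic_points s s' (B : assignment n s) (B' : assignment n s')
    h h' (H : R -> S3 R -> S3 R) (sg : {perm 'I_n}) :
  sheets_noncrossing B -> sheets_noncrossing B' ->
  good_stack h -> good_stack h' -> sphere_isotopy H ->
  (forall i j t, i != j -> 0 <= t <= 1 ->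
     H 1 (Some (arc_point B h i j t)) = Some (arc_point B' h' (sg i) (sg j) t)) ->
  book_isotopic B B'.
Proof.
move=> ncB ncB' gh gh' iH HP G1 G2 r1 r2.
have rB := drawn_book_representation ncB gh (book_graph_drawn B h).
have rB' := drawn_book_representation ncB' gh' (book_graph_drawn B' h').
apply: sphere_isotopic_trans (book_isotopic_refl r1 rB) _.
apply: (@sphere_isotopic_trans _ _ _ _ _ _ (book_isotopic_refl rB' r2)).
exact: isotopic_of_points n2 gh gh' (book_graph_drawn _ _) (book_graph_drawn _ _) iH HP.
Qed.

Lemma edge_set2 (i j : 'I_n) : i != j -> is_edge [set i; j]%SET.
Proof. by move=> ij; rewrite /is_edge cards2 ij. Qed.

Section SheetInsertion.
Variables (s : nat) (B : assignment n s) (B' : assignment n s.+1).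
Hypothesis ins : sheet_insertion B B'.

Lemma sheet_insertion_noncrossing : sheets_noncrossing B <-> sheets_noncrossing B'.
Proof.
have [k kE] := ins; split=> nc e f ie jf.
  by rewrite !kE// => /lift_inj; exact: nc.
by move=> E; apply: nc => //; rewrite !kE// E.
Qed.

(** The standard stack with the sheet [k] omitted is again a good stack, and the same graph is drawn
    on it. *)
Lemma sheet_insertion_shared : sheets_noncrossing B ->
  exists G : spatial_graph R n, book_representation B G /\ book_representation B' G.
Proof.
move=> ncB; have ncB' := (proj1 sheet_insertion_noncrossing) ncB.
have [k kE] := ins; have [c0 c1 c2] := @std_stack_good s.+1.
exists (book_graph B' (@std_stack s.+1)); split; last first.
  exact: drawn_book_representation ncB' (@std_stack_good _) (book_graph_drawn _ _).
apply: (@drawn_book_representation _ _ _ _ (fun j => @std_stack s.+1 (lift k j))) => //.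
  split=> [m|m p p1|i j p ij p1]; [exact: c0|exact: c1|].
  by apply: c2 => //=; rewrite ltnNge leq_bump2 -ltnNge.
have [vG aG] := book_graph_drawn B' (@std_stack s.+1); split=> // i j ij.
rewrite aG//; apply/seteqP; split=> _ [t t01 <-]; exists t => //;
  by rewrite /arc_point kE ?edge_set2.
Qed.

End SheetInsertion.

Lemma line_in_disk (p q x : R * R) : norm2 p = 1 -> norm2 q = 1 -> p != q ->
  norm2 x <= 1 -> orient p q x = 0 -> exists2 t, 0 <= t <= 1 & x = seg p q t.
Proof.
move=> p1 q1 pq x1 o0; pose d := norm2 (p.1 - q.1, p.2 - q.2).
have d0 : 0 < d by exact: norm2_dist_gt0.
(* The parameter of the orthogonal projection of [x] to the line; it lies in [0, 1] because by
   [norm2_seg] the point leaves the disk otherwise. *)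
pose t := ((x.1 - p.1) * (q.1 - p.1) + (x.2 - p.2) * (q.2 - p.2)) / d.
have xE : x = seg p q t.
  have dn : d != 0 by rewrite gt_eqF.
  case: (x) o0 @t => a b; rewrite /orient /seg /= => o0.
  congr (_, _); apply: (mulfI dn).
    rewrite (_ : _ * ((1 - _) * _ + _) = d * p.1 + ((a - p.1) * (q.1 - p.1) + (b - p.2) * (q.2 - p.2)) * (q.1 - p.1)); last by field.
    have : (q.2 - p.2) * ((q.1 - p.1) * (b - p.2) - (q.2 - p.2) * (a - p.1)) = 0 by rewrite o0 mulr0.
    rewrite /d /norm2 /=; lra.
  rewrite (_ : _ * ((1 - _) * _ + _) = d * p.2 + ((a - p.1) * (q.1 - p.1) + (b - p.2) * (q.2 - p.2)) * (q.2 - p.2)); last by field.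
  have : (q.1 - p.1) * ((q.1 - p.1) * (b - p.2) - (q.2 - p.2) * (a - p.1)) = 0 by rewrite o0 mulr0.
  rewrite /d /norm2 /=; lra.
exists t => //; move: x1; rewrite xE norm2_seg p1 q1 -/d => h.
have : 0 <= t * (1 - t) by rewrite -(pmulr_lge0 _ d0); lra.
have [t0|t0] := leP 0 t.
  have [t1|t1] := leP t 1 => // h'.
  have : t * (1 - t) < 0 by rewrite nmulr_llt0 ?subr_lt0//; exact: lt_trans t1.
  lra.
have : t * (1 - t) < 0 by rewrite nmulr_rlt0// subr_gt0; lra.
lra.
Qed.

Section EdgeMove.
Variables (s : nat) (Bu Bl : assignment n s) (e : {set 'I_n}) (k l : 'I_s).
Hypothesis kl : l = k.+1 :> nat.
Hypothesis eE : is_edge e.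
Hypothesis Bue : Bu e = k.
Hypothesis Ble : Bl e = l.
Hypothesis Bul : forall f, is_edge f -> f != e -> Bl f = Bu f.
Hypothesis ncu : sheets_noncrossing Bu.
Hypothesis ncl : sheets_noncrossing Bl.

Let near_edge (x : 'I_n * 'I_n) : bool := [&& x.1 != x.2, [set x.1; x.2]%SET != e
  & (Bu [set x.1; x.2]%SET == k) || (Bu [set x.1; x.2]%SET == l)].

(** Zero on the lines through the other edges of the two sheets. Only its zeros matter, so it is
    harmless that each edge occurs once for each order of its ends. *)
Let oth (p : R * R) : R := \prod_(x | near_edge x) `|orient (cv x.1) (cv x.2) p|.

Let cont_orient (a b p : R * R) : cont_at (orient a b) p.
Proof. by change (cont_at (fun p => orient a b p) p); rewrite /orient; cont. Qed.

Let oth_ge0 p : 0 <= oth p.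
Proof. by apply: prodr_ge0. Qed.

Let cont_oth p : cont_at oth p.
Proof.
rewrite /oth /index_enum; elim: (Finite.enum _) => [|x r IH].
  rewrite (_ : (fun _ => _) = fun=> 1); first exact: cont_cst.
  by apply/funext => q; rewrite big_nil.
have [xn|xn] := boolP (near_edge x).
  rewrite (_ : (fun _ => _) = fun q => `|orient (cv x.1) (cv x.2) q| *
    \prod_(j <- r | near_edge j) `|orient (cv j.1) (cv j.2) q|).
    by apply: cont_mul => //; apply: cont_norm; exact: cont_orient.
  by apply/funext => q; rewrite big_cons xn.
rewrite (_ : (fun _ => _) = fun q =>
    \prod_(j <- r | near_edge j) `|orient (cv j.1) (cv j.2) q|)//.
by apply/funext => q; rewrite big_cons (negPf xn).
Qed.

(* A single graph is drawn on both stacks of sheets: on the lower one the sheet l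
   is pushed up onto the edge e where it runs in the sheet k, by a bump
   function equal to 1 on e and to 0 on the other edges of both sheets. *)
Lemma edge_move_shared :
  exists G : spatial_graph R n, book_representation Bu G /\ book_representation Bl G.
Proof.
have /cards2P[i [j [ij eij]]] := eE.
pose d p : R := `|orient (cv i) (cv j) p|.
(* Urysohn's quotient: 1 where d = 0, and 0 where oth = 0 but d does not vanish. Inside the disk the
   two never vanish together on e, because e crosses no edge of sheet [k] in [Bu] and none of sheet
   [l] in [Bl]. *)
pose phi p := oth p / (oth p + d p).
have d0 p : 0 <= d p by exact: normr_ge0.
have cd p : cont_at d p.
  by change (cont_at (fun p => d p) p); apply: cont_norm; exact: cont_orient.
have phi01 p : 0 <= phi p <= 1.
  rewrite /phi divr_ge0 ?addr_ge0//=; have := addr_ge0 (oth_ge0 p) (d0 p).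
  rewrite le_eqVlt => /orP[/eqP<-|h]; first by rewrite invr0 mulr0.
  by rewrite ler_pdivrMr// mul1r lerDl.
have cvij : cv i != cv j by rewrite (inj_eq (@cv_inj R n)).
have oth_gt0 p : norm2 p < 1 -> d p = 0 -> 0 < oth p.
  move=> p1 /eqP; rewrite normr_eq0 => /eqP o0.
  apply: prodr_gt0 => -[a b] /and3P[/= ab abe abk].
  rewrite normr_gt0; apply/eqP => oab.
  have cvab : cv a != cv b by rewrite (inj_eq (@cv_inj R n)).
  have [t t01 tE] := line_in_disk (cv_norm2 _ _) (cv_norm2 _ _) cvij (ltW p1) o0.
  have [u u01 uE] := line_in_disk (cv_norm2 _ _) (cv_norm2 _ _) cvab (ltW p1) oab.
  have := @chords_meet R n i j a b t u ij ab; rewrite -eij eq_sym abe -tE -uE.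
  move=> /(_ isT t01 u01 erefl)[cr|[m _ pm]]; last by move: p1; rewrite pm cv_norm2 ltxx.
  case/orP: abk => /eqP abk; move: cr.
    by apply: ncu; rewrite ?edge_set2// Bue.
  by apply: ncl; rewrite ?edge_set2// Ble Bul ?edge_set2.
have cphi p : norm2 p < 1 -> cont_at phi p.
  move=> p1; change (cont_at (fun p => phi p) p); rewrite /phi.
  have co := @cont_oth p; have cdp := cd p.
  have [dp|dp] := eqVneq (d p) 0.
    by have dn : oth p + d p != 0 by [rewrite dp addr0 lt0r_neq0 ?oth_gt0]; cont.
  have : 0 < oth p + d p by rewrite ltr_wpDl// lt_def dp d0.
  by move=> h; have dn := lt0r_neq0 h; cont.
(* At a vertex where e meets another edge, phi is 0 / 0 and may jump; the factor [dome], which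
   vanishes there, restores continuity. *)
pose w p := phi p * dome p.
have cw p : cont_at w p.
  have [p1|p1] := ltP (norm2 p) 1.
    by apply: cont_mul; [exact: cphi|exact: cont_dome].
  apply: (@cont_at_squeeze _ _ _ dome); [exact: cont_dome|exact: dome_eq0|].
  move=> q; have /andP[f0 f1] := phi01 q.
  by rewrite normrM ler_piMl// ger0_norm.
(* Consecutive standard sheets differ by [dome]. The weight 1 thus lifts the sheet [l] exactly to
   the old sheet [k] where phi = 1; the weight 1/2 moves [k] out of its way and still keeps it below
   the next sheet. *)
pose b (m : 'I_s) : R := if m == l then 1 else if m == k then 2^-1 else 0.
pose h (m : 'I_s) p := @std_stack s m p + b m * w p.
have gh : good_stack h.
  have [c0 c1 c2] := @std_stack_good s; split=> [m p|m p p1|m m' p mm' p1].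
  - change (cont_at (fun p => std_stack m p + b m * w p) p).
    apply: cont_add; first exact: c0.
    by apply: cont_mul; [cont|exact: cw].
  - by rewrite /h c1// /w dome_eq0// !mulr0 addr0.
  - rewrite /h /std_stack /w (mulrA (b m)) (mulrA (b m')) -!mulrDl.
    rewrite ltr_pM2r ?dome_gt0//; have := phi01 p; move: (phi p) => f /andP[f0 f1].
    have mm1 : 1 <= (m' : nat)%:R - (m : nat)%:R :> R by rewrite -natrB ?ler1n ?subn_gt0// ltnW.
    have b0 x : 0 <= b x <= 1 by rewrite /b; case: ifP => _; [lra|case: ifP => _; lra].
    have [bm|bm] := eqVneq (b m') 1; last first.
      have b2 : b m' <= 2^-1.
        by move: bm; rewrite /b; case: ifP; rewrite ?eqxx// => _ _; case: ifP => _; lra.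
      have := b0 m'; have := b0 m => /andP[bm0 bm1] /andP[bm0' bm1'].
      have : b m' * f <= 2^-1.
        by rewrite (le_trans (ler_piMr _ f1))//.
      have : 0 <= b m * f by rewrite mulr_ge0.
      lra.
    have m'l : m' = l.
      apply/eqP; move: bm; rewrite /b; case: ifP => // _; case: ifP => _; lra.
    rewrite bm mul1r; subst m'.
    have [mk|mk] := eqVneq m k.
      rewrite /b mk eqxx; have -> : (k == l) = false.
        by apply/negbTE; rewrite -val_eqE /= kl neq_ltn leqnn.
      have -> : l%:R = k%:R + 1 :> R by rewrite kl -natr1.
      lra.
    have : (m < k)%N.
      by move: mm'; rewrite kl ltnS leq_eqVlt => /orP[/eqP/val_inj mk'|//]; rewrite mk' eqxx in mk.
    move=> mk'; have : 1 <= k%:R - (m : nat)%:R :> R by rewrite -natrB ?ler1n ?subn_gt0// ltnW.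
    have -> : l%:R = k%:R + 1 :> R by rewrite kl -natr1.
    have : 0 <= b m * f by rewrite mulr_ge0//; have /andP[] := b0 m.
    lra.
exists (book_graph Bu (@std_stack s)); split.
  exact: drawn_book_representation ncu (@std_stack_good _) (book_graph_drawn _ _).
apply: (drawn_book_representation ncl gh).
have [vG aG] := book_graph_drawn Bu (@std_stack s); split=> // a c ac.
suff E t : 0 <= t <= 1 -> arc_point Bu (@std_stack s) a c t = arc_point Bl h a c t.
  by rewrite aG//; apply/seteqP; split=> _ [t t01 <-]; exists t => //; rewrite E.
move=> t01; rewrite /arc_point; congr (_, _); set p := seg _ _ t.
have [p1|p1] := leP 1 (norm2 p).
  by rewrite /h /std_stack /w dome_eq0// !mulr0 addr0.
have [ace|ace] := eqVneq [set a; c]%SET e.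
  rewrite ace Bue Ble /h /b eqxx /w /std_stack.
  have dp : d p = 0.
    apply/eqP; rewrite normr_eq0; move: ace; rewrite eij => ace.
    have : a \in [set i; j]%SET by rewrite -ace !inE eqxx.
    have : c \in [set i; j]%SET by rewrite -ace !inE eqxx orbT.
    rewrite /p orient_seg; have [z1 z2] := orientpp (cv i) (cv j).
    by rewrite !inE => /orP[]/eqP-> /orP[]/eqP->; rewrite ?z1 ?z2 !mulr0 addr0.
  rewrite /phi dp addr0 divff ?(lt0r_neq0 (oth_gt0 _ p1 dp))//.
  have -> : l%:R = k%:R + 1 :> R by rewrite kl -natr1.
  ring.
rewrite Bul ?edge_set2// /h /b; set m := Bu _.
have [ml|ml] := boolP ((m == k) || (m == l)); last first.
  by move: ml; rewrite negb_or => /andP[/negbTE-> /negbTE->]; rewrite mul0r addr0.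
have -> : w p = 0; last by rewrite mulr0 addr0.
rewrite /w /phi /oth (bigD1 (a, c))/=; last by rewrite /near_edge /= ac ace.
rewrite /p orient_seg; have [-> ->] := orientpp (cv a) (cv c).
by rewrite !mulr0 addr0 normr0 !mul0r.
Qed.

End EdgeMove.

End BookIsotopies.

(** * Rotations and double reflections *)

Section RigidMotions.
Variable (R : realType).
Local Notation V := (R * R * R)%type.

Lemma extend_motion (F G : R -> V -> V) (c : R) :
  continuous (fun p : R * V => F p.1 p.2) -> F 0 = id ->
  (forall t, cancel (F t) (G t)) -> (forall t, cancel (G t) (F t)) ->
  0 <= c -> (forall t X, `|G t X| <= c * `|X|) ->
  exists H, sphere_isotopy H /\ forall X, H 1 (Some X) = Some (F 1 X).
Proof.
move=> cF F0 FG GF c0 Gc; apply: extend_isotopy => //.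
  by move=> t _; exists (G t).
move=> r; exists (c * r) => t X _ Fr; rewrite -(FG t X).
by apply: (le_trans (Gc t _)); exact: ler_wpM2l.
Qed.

Definition rot (a : R) (p : R * R) : R * R :=
  (cos a * p.1 - sin a * p.2, sin a * p.1 + cos a * p.2).

Definition rotz (a : R) (X : V) : V := (rot a X.1, X.2).

Definition rotx (a : R) (X : V) : V :=
  (X.1.1, cos a * X.1.2 - sin a * X.2, sin a * X.1.2 + cos a * X.2).

Lemma rotNK a : cancel (rot a) (rot (- a)).
Proof.
move=> [x y]; rewrite /rot /= cosN sinN; have := cos2Dsin2 a.
move: (cos a) (sin a) => c s cs; congr (_, _).
  by rewrite -[RHS]mul1r -cs; ring.
by rewrite -[RHS]mul1r -cs; ring.
Qed.

Lemma rotzNK a : cancel (rotz a) (rotz (- a)).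
Proof. by move=> [p z]; rewrite /rotz /= rotNK. Qed.

Lemma rotxNK a : cancel (rotx a) (rotx (- a)).
Proof.
move=> [[x y] z]; rewrite /rotx /= cosN sinN; have := cos2Dsin2 a.
move: (cos a) (sin a) => c s cs; congr (_, _, _).
  by rewrite -[RHS]mul1r -cs; ring.
by rewrite -[RHS]mul1r -cs; ring.
Qed.

Lemma rot0 p : rot 0 p = p.
Proof. by case: p => x y; rewrite /rot cos0 sin0 !mul1r !mul0r subr0 add0r. Qed.

Lemma combination_le (c s u v r : R) : `|c| <= 1 -> `|s| <= 1 -> `|u| <= r -> `|v| <= r ->
  `|c * u + s * v| <= 2 * r.
Proof.
move=> c1 s1 ur vr; apply: (le_trans (ler_normD _ _)); rewrite !normrM.
have := ler_pM (normr_ge0 _) (normr_ge0 _) c1 ur.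
have := ler_pM (normr_ge0 _) (normr_ge0 _) s1 vr.
lra.
Qed.

Let cos1 (a : R) : `|cos a| <= 1.
Proof. by rewrite ler_norml cos_geN1 cos_le1. Qed.

Let sin1 (a : R) : `|sin a| <= 1.
Proof. by rewrite ler_norml sin_geN1 sin_le1. Qed.

Lemma rotz_le a X : `|rotz a X| <= 2 * `|X|.
Proof.
have [x y z] := norm3_coord X; rewrite norm3_le /rotz /rot /=; apply/and3P; split.
- by rewrite -mulNr; apply: combination_le; rewrite ?normrN.
- exact: combination_le.
- by apply: (le_trans z); rewrite ler_peMl// ler1n.
Qed.

Lemma rotx_le a X : `|rotx a X| <= 2 * `|X|.
Proof.
have [x y z] := norm3_coord X; rewrite norm3_le /rotx /=; apply/and3P; split.
- by apply: (le_trans x); rewrite ler_peMl// ler1n.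
- by rewrite -mulNr; apply: combination_le; rewrite ?normrN.
- exact: combination_le.
Qed.

Lemma rotation_isotopy (a : R) : exists H, sphere_isotopy H /\
  forall X, H 1 (Some X : S3 R) = Some (rotz a X).
Proof.
have [||||||H [iH HE]] := @extend_motion (fun t => rotz (t * a)) (fun t => rotz (- (t * a))) 2.
- move=> p; change (cont_at (fun p : R * V => rotz (p.1 * a) p.2) p).
  by rewrite /rotz /rot; cont.
- by apply/funext => -[p z]; rewrite mul0r /rotz rot0.
- by move=> t; exact: rotzNK.
- by move=> t X; rewrite -{1}(opprK (t * a)); exact: rotzNK.
- by [].
- by move=> t X; exact: rotz_le.
by exists H; split=> // X; rewrite HE mul1r.
Qed.

Lemma diameter_reflectionE (th : R) p :
  rot th ((rot (- th) p).1, - (rot (- th) p).2) = diameter_reflection th p.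
Proof.
case: p => x y; rewrite /rot /diameter_reflection /= cosN sinN.
rewrite (_ : 2 * th = th + th); last by ring.
by rewrite cosD sinD; congr (_, _); ring.
Qed.

(** Reflecting in a diameter and reversing the vertical axis is together the half turn of R^3 about
    that diameter: the axis is turned to the first coordinate axis, and back after the turn. *)
Lemma half_turn_isotopy (th : R) : exists H, sphere_isotopy H /\
  forall X : V, H 1 (Some X : S3 R) = Some (diameter_reflection th X.1, - X.2).
Proof.
(* The bound 8 is 2 * 2 * 2: each of the three rotations at most doubles the sup norm. *)
have [||||||H [iH HE]] := @extend_motion
  (fun t X => rotz th (rotx (t * pi) (rotz (- th) X)))
  (fun t X => rotz th (rotx (- (t * pi)) (rotz (- th) X))) 8.
- move=> p; change (cont_at (fun p : R * V => rotz th (rotx (p.1 * pi) (rotz (- th) p.2))) p).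
  by rewrite /rotz /rot /rotx /=; cont.
- apply/funext => X; rewrite mul0r (_ : rotx 0 _ = rotz (- th) X); last first.
    rewrite /rotx cos0 sin0 !mul1r !mul0r subr0 add0r.
    by case: (rotz _ _) => -[].
  by rewrite -{1}(opprK th) rotzNK.
- by move=> t X; rewrite rotzNK rotxNK -{1}(opprK th) rotzNK.
- move=> t X; rewrite rotzNK -{1}(opprK (t * pi)) rotxNK.
  by rewrite -{1}(opprK th) rotzNK.
- by [].
- move=> t X; apply: (le_trans (rotz_le _ _)).
  have := rotx_le (- (t * pi)) (rotz (- th) X); have := rotz_le (- th) X; lra.
exists H; split=> // X; rewrite HE mul1r -diameter_reflectionE /rotz /rotx /=.
by rewrite cospi sinpi !mul0r subr0 add0r !mulN1r.
Qed.

End RigidMotions.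

Section MotionMoves.
Variables (R : realType) (n : nat).
Hypothesis n2 : (2 <= n)%N.
Local Notation cv := (@circle_vertex R n).
Local Notation V := (R * R * R)%type.

(** A map that multiplies all orientations by one nonzero factor keeps the sign of a product of two
    of them, hence preserves crossings. *)
Lemma noncrossing_image s s' (B : assignment n s) (B' : assignment n s')
    (rho : 'I_n -> 'I_n) (g : 'I_s -> 'I_s') (A : R * R -> R * R) (eps : R) :
  injective rho -> injective g ->
  (forall i, cv (rho i) = A (cv i)) -> eps != 0 ->
  (forall p q r, orient (A p) (A q) (A r) = eps * orient p q r) ->
  (forall e, is_edge e -> B' (rho @: e)%SET = g (B e)) ->
  sheets_noncrossing B -> sheets_noncrossing B'.
Proof.
move=> ri gi rA e0 oA BE nc e f ie jf; pose sg := perm ri.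
have pre (x : {set 'I_n}) : is_edge x -> exists y, is_edge y /\ x = (rho @: y)%SET.
  move=> /cards2P[i [j [ij ->]]]; exists [set sg^-1%g i; sg^-1%g j]%SET.
  rewrite edge_set2 ?(inj_eq perm_inj)//; split=> //.
  rewrite imsetU1 imset_set1 -!(permE ri) -/sg -!permM.
  by rewrite mulVg !perm1.
have [y [iy ->]] := pre e ie; have [z [iz ->]] := pre f jf.
rewrite !BE// => /gi E /(@crossing_orient R)[i [j [k [l [yE zE]]]]].
have sgK i0 : rho (sg^-1%g i0) = i0 by rewrite -(permE ri) -/sg -permM mulVg perm1.
have back (w : {set 'I_n}) i0 j0 : (rho @: w)%SET = [set i0; j0]%SET ->
    w = [set sg^-1%g i0; sg^-1%g j0]%SET.
  move=> wE; apply: (imset_inj ri); rewrite wE imsetU1 imset_set1.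
  by rewrite !sgK.
rewrite -(sgK i) -(sgK j) -(sgK k) -(sgK l) !rA !oA mulrACA -expr2.
rewrite pmulr_rlt0; last by rewrite exprn_even_gt0.
move=> pr; apply: (nc y z) => //; apply/(@crossing_orient R).
by exists (sg^-1%g i), (sg^-1%g j), (sg^-1%g k), (sg^-1%g l); split=> //; exact: back.
Qed.

Lemma rot_seg (a : R) p q t : rot a (seg p q t) = seg (rot a p) (rot a q) t.
Proof. by rewrite /rot /seg /=; congr (_, _); ring. Qed.

Lemma rot_norm2 (a : R) p : norm2 (rot a p) = norm2 p.
Proof.
rewrite /norm2 /rot /= -[RHS]mul1r -(cos2Dsin2 a); ring.
Qed.

Lemma rot_orient (a : R) p q r : orient (rot a p) (rot a q) (rot a r) = 1 * orient p q r.
Proof.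
transitivity ((cos a ^+ 2 + sin a ^+ 2) * orient p q r); last by rewrite cos2Dsin2.
by rewrite /orient /rot /=; ring.
Qed.

Lemma reflection_seg (a : R) p q t : diameter_reflection a (seg p q t) =
  seg (diameter_reflection a p) (diameter_reflection a q) t.
Proof. by rewrite /diameter_reflection /seg /=; congr (_, _); ring. Qed.

Lemma reflection_norm2 (a : R) p : norm2 (diameter_reflection a p) = norm2 p.
Proof.
transitivity ((cos (2 * a) ^+ 2 + sin (2 * a) ^+ 2) * norm2 p).
  by rewrite /norm2 /diameter_reflection /=; ring.
by rewrite cos2Dsin2 mul1r.
Qed.

Lemma reflection_orient (a : R) p q r : orient (diameter_reflection a p)
  (diameter_reflection a q) (diameter_reflection a r) = -1 * orient p q r.
Proof.
transitivity (- (cos (2 * a) ^+ 2 + sin (2 * a) ^+ 2) * orient p q r); last by rewrite cos2Dsin2.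
by rewrite /orient /diameter_reflection /=; ring.
Qed.

Lemma norm2_dome (A : R * R -> R * R) p : (forall p, norm2 (A p) = norm2 p) ->
  dome (A p) = dome p.
Proof. by rewrite /dome => ->. Qed.

Lemma rot_move s (B B' : assignment n s) (rho : 'I_n -> 'I_n) (a : R) :
  injective rho -> (forall i, cv (rho i) = rot a (cv i)) ->
  (forall e, is_edge e -> B' (rho @: e)%SET = B e) ->
  sheets_noncrossing B -> sheets_noncrossing B' /\ book_isotopic R B B'.
Proof.
move=> ri rA BE ncB.
have ncB' : sheets_noncrossing B'.
  exact: (noncrossing_image ri (@inj_id _) rA (oner_neq0 _) (rot_orient a) BE ncB).
split=> //; have [H [iH HE]] := rotation_isotopy a.
apply: (@book_isotopic_points R n n2 s s B B' (@std_stack R s) (@std_stack R s) H (perm ri)) => //.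
- exact: std_stack_good.
- exact: std_stack_good.
- move=> i j t ij t01; rewrite HE /rotz /arc_point /= !permE !rA -rot_seg.
  rewrite (_ : B' _ = B [set i; j]%SET) ?/std_stack.
    by rewrite /std_stack norm2_dome//; exact: rot_norm2.
  by rewrite -BE ?edge_set2// imsetU1 imset_set1.
Qed.

(** These heights change sign under [rev_ord], so a half turn carries each sheet exactly onto its
    mirror sheet. *)
Definition sym_stack s : 'I_s -> R * R -> R :=
  fun k p => ((rev_ord k : nat)%:R - (k : nat)%:R) * dome p.

Lemma sym_stack_good s : good_stack (@sym_stack s).
Proof.
apply: dome_stack => [||p|k l kl]; [exact: cont_dome|exact: dome_gt0|exact: dome_eq0|].
have := kl; rewrite -(ltr_nat R) => kl'.
have : (s - l.+1 <= s - k.+1)%N by rewrite leq_sub2l// ltnS ltnW.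
by rewrite -(ler_nat R) /=; lra.
Qed.

Lemma half_turn_move s (B B' : assignment n s) (rho : 'I_n -> 'I_n) (th : R) :
  injective rho -> (forall i, cv (rho i) = diameter_reflection th (cv i)) ->
  (forall e, is_edge e -> B' (rho @: e)%SET = rev_ord (B e)) ->
  sheets_noncrossing B -> sheets_noncrossing B' /\ book_isotopic R B B'.
Proof.
move=> ri rA BE ncB.
have m1 : -1 != 0 :> R by rewrite oppr_eq0 oner_neq0.
have ncB' : sheets_noncrossing B'.
  exact: (noncrossing_image ri (@rev_ord_inj _) rA m1 (reflection_orient th) BE ncB).
split=> //; have [H [iH HE]] := half_turn_isotopy th.
apply: (@book_isotopic_points R n n2 s s B B' (@sym_stack s) (@sym_stack s) H (perm ri)) => //.
- exact: sym_stack_good.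
- exact: sym_stack_good.
- move=> i j t ij t01; rewrite HE /arc_point /= !permE !rA -reflection_seg.
  rewrite (_ : B' _ = rev_ord (B [set i; j]%SET)).
    rewrite /sym_stack rev_ordK norm2_dome; last exact: reflection_norm2.
    by rewrite -mulNr opprB.
  by rewrite -BE ?edge_set2// imsetU1 imset_set1.
Qed.

Lemma cv_ordS (i : 'I_n) : cv (ordS i) = rot (- (2 * pi / n%:R)) (cv i).
Proof.
have n0 : n%:R != 0 :> R by rewrite pnatr_eq0 -lt0n (leq_trans _ n2).
have -> : cv (ordS i) = (cos (2 * pi * (i.+1)%:R / n%:R), - sin (2 * pi * (i.+1)%:R / n%:R)).
  rewrite /circle_vertex /=; have [lt|] := ltnP i.+1 n; first by rewrite modn_small.
  move=> le; have E : i.+1 = n by apply/eqP; rewrite eqn_leq le ltn_ord.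
  rewrite E modnn mulr0 mul0r cos0 sin0 mulfK// (_ : 2 * pi = pi + pi); last by ring.
  by rewrite cosD sinD cospi sinpi; congr (_, _); ring.
have -> : 2 * pi * (i.+1)%:R / n%:R = 2 * pi * i%:R / n%:R + 2 * pi / n%:R :> R.
  by rewrite -natr1; field.
rewrite /circle_vertex /rot /= cosN sinN cosD sinD.
by congr (_, _); ring.
Qed.

Lemma rotating_vertices_isotopic s (B B' : assignment n s) :
  rotating_vertices B B' -> sheets_noncrossing B ->
  sheets_noncrossing B' /\ book_isotopic R B B'.
Proof.
case=> BE; first exact: rot_move (@ordS_inj n) cv_ordS BE.
apply: (@rot_move s B B' (@ord_pred n) (2 * pi / n%:R)) => //.
  exact: (can_inj (@ord_predK n)).
move=> i; have := cv_ordS (ord_pred i); rewrite ord_predK => ->.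
by rewrite -{1}(opprK (2 * pi / n%:R)) rotNK.
Qed.

Lemma diameter_reflectionK (th : R) : involutive (diameter_reflection th).
Proof.
move=> [x y]; rewrite /diameter_reflection /=; have := cos2Dsin2 (2 * th).
move: (cos _) (sin _) => c s cs; congr (_, _).
  by rewrite -[RHS]mul1r -cs; ring.
by rewrite -[RHS]mul1r -cs; ring.
Qed.

Lemma reflection_vertices_inj (th : R) (rho : 'I_n -> 'I_n) :
  (forall i, cv (rho i) = diameter_reflection th (cv i)) -> injective rho.
Proof.
move=> rA i j E; apply: (@cv_inj R n); apply: (can_inj (diameter_reflectionK th)).
by rewrite -!rA E.
Qed.

(** Two diameters give the rotation by twice the angle between them, a diameter and the plane give a
    half turn, and the plane twice gives the identity. *)
Lemma double_reflection_isotopic s (B B' : assignment n s) :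
  double_reflection R B B' -> sheets_noncrossing B ->
  sheets_noncrossing B' /\ book_isotopic R B B'.
Proof.
have im_edge (rho : 'I_n -> 'I_n) (e : {set 'I_n}) : injective rho -> is_edge e -> is_edge (rho @: e).
  by move=> ri; rewrite /is_edge card_imset.
move=> [B1 [[[th [rho [rA BE]]]|BE] [[th' [rho' [rA' BE']]]|BE']]] ncB.
- have ri := reflection_vertices_inj rA; have ri' := reflection_vertices_inj rA'.
  apply: (@rot_move s B B' (rho' \o rho) (2 * th' - 2 * th)) => //.
  + exact: inj_comp.
  + move=> i; rewrite /= rA' rA /diameter_reflection /rot /= cosB sinB.
    by congr (_, _); ring.
  + by move=> e ie; rewrite imset_comp BE' ?BE//; exact: im_edge.
- have ri := reflection_vertices_inj rA.
  apply: (half_turn_move ri rA) => // e ie.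
  by rewrite BE' ?BE//; exact: im_edge.
- have ri := reflection_vertices_inj rA'.
  by apply: (half_turn_move ri rA') => // e ie; rewrite BE' ?BE.
- apply: (@rot_move s B B' id 0) => // [i|e ie]; first by rewrite rot0.
  by rewrite imset_id BE'// BE// rev_ordK.
Qed.

End MotionMoves.

(** * Cyclic shifts of the sheets *)

Section SphereMotions.
Variable (R : realType).
Local Notation W := (R * R * R * R)%type.

Lemma on_sphereE (Q : W) : on_sphere Q <-> norm2 Q.1.1 + norm2 (Q.1.2, Q.2) = 1.
Proof. by rewrite /on_sphere /bulk /norm2 /= -!addrA. Qed.

(** The rotation fixes the great circle where the last two coordinates vanish, which is the boundary
    circle of the book, and turns the pages around it. *)
Definition rot_page (a : R) (Q : W) : W :=
  (Q.1.1, (rot a (Q.1.2, Q.2)).1, (rot a (Q.1.2, Q.2)).2).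

Lemma rot_page_on_sphere b (Q : W) : on_sphere Q -> on_sphere (rot_page b Q).
Proof. by rewrite !on_sphereE => <-; congr (_ + _); exact: rot_norm2. Qed.

Lemma rot_page_isotopy (a : R) : exists H, sphere_isotopy H /\
  forall P : S3 R, H 1 P = of_sphere (rot_page a (to_sphere P)).
Proof.
have sph := rot_page_on_sphere.
have K b (Q : W) : rot_page (- b) (rot_page b Q) = Q.
  case: Q => [[p z] u].
  have E : rot (- b) ((rot b (z, u)).1, (rot b (z, u)).2) = (z, u).
    by rewrite -surjective_pairing rotNK.
  change ((p, (rot (- b) ((rot b (z, u)).1, (rot b (z, u)).2)).1,
    (rot (- b) ((rot b (z, u)).1, (rot b (z, u)).2)).2) = (p, z, u)).
  by rewrite E.
have [||||||H [iH HE]] := @sphere_isotopy_R4 R (fun t => rot_page (t * a)) (fun t => rot_page (- (t * a))).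
- move=> p; change (cont_at (fun p : R * W => rot_page (p.1 * a) p.2) p).
  by rewrite /rot_page /rot /=; cont.
- by move=> Q; rewrite mul0r /rot_page rot0; case: Q => [[[]]].
- by move=> t Q; exact: sph.
- by move=> t Q; exact: sph.
- by move=> t Q _; exact: K.
- by move=> t Q _; rewrite -{1}(opprK (t * a)); exact: K.
by exists H; split=> // P; rewrite HE mul1r.
Qed.

(* A Lorentz boost of the light cone z^2 + u^2 = rho^2, rescaled so as to fix
   rho; S and sqrt (1 + S^2) are the hyperbolic sine and cosine. *)
Definition boost (S : R) (v : R * R) : R * R :=
  let rho := Num.sqrt (norm2 v) in let C := Num.sqrt (1 + S ^+ 2) in
  let D := rho * C + v.2 * S in
  (rho * (v.1 / D), rho * ((v.2 * C + rho * S) / D)).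

(** The denominator of [boost] is positive because |S| < C and |v.2| <= rho. *)
Lemma boost_facts (S : R) (v : R * R) :
  let rho := Num.sqrt (norm2 v) in let C := Num.sqrt (1 + S ^+ 2) in
  [/\ rho ^+ 2 = norm2 v, C ^+ 2 = 1 + S ^+ 2, 0 <= rho &
      0 < rho -> 0 < rho * C + v.2 * S].
Proof.
move=> rho C.
have C2 : C ^+ 2 = 1 + S ^+ 2 by rewrite sqr_sqrtr// addr_ge0 ?sqr_ge0.
have r2 : rho ^+ 2 = norm2 v by rewrite sqr_sqrtr ?norm2_ge0.
have C0 : 0 <= C by exact: sqrtr_ge0.
split=> //; first exact: sqrtr_ge0.
move=> rp; have CS : `|S| < C.
  by rewrite -(@ltr_sqr _ _ C) ?nnegrE// real_normK ?num_real// C2 ltrDr ltr01.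
have vr : `|v.2| <= rho.
  by rewrite -(@ler_sqr _ _ rho) ?nnegrE ?sqrtr_ge0// real_normK ?num_real// r2 /norm2 lerDr sqr_ge0.
have : `|v.2 * S| < rho * C.
  rewrite normrM; apply: (@le_lt_trans _ _ (rho * `|S|)).
    by apply: ler_wpM2r.
  by rewrite ltr_pM2l.
by rewrite ltr_norml => /andP[? ?]; lra.
Qed.

Lemma boost_norm2 S v : norm2 (boost S v) = norm2 v.
Proof.
have /= := boost_facts S v; rewrite /boost /=.
set rho := Num.sqrt (norm2 v); set C := Num.sqrt _ => -[r2 C2 r0 rD].
have [rE|rn] := eqVneq rho 0.
  by rewrite rE !mul0r -r2 rE /norm2 /= expr0n /= addr0.
have Dn := lt0r_neq0 (rD (_ : 0 < rho)); rewrite lt_def rn r0 in Dn; have {}Dn := Dn isT.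
set D := _ + _ in Dn *.
(* The Lorentz boost preserves the light cone; this identity is why dividing by [D] yields a unit
   vector. *)
have E : v.1 ^+ 2 + (v.2 * C + rho * S) ^+ 2 = D ^+ 2.
  have -> : v.1 ^+ 2 = rho ^+ 2 - v.2 ^+ 2 by rewrite r2 /norm2 addrK.
  have -> : (v.2 * C + rho * S) ^+ 2 = v.2 ^+ 2 * C ^+ 2 + 2 * v.2 * C * rho * S + rho ^+ 2 * S ^+ 2 by ring.
  have -> : D ^+ 2 = rho ^+ 2 * C ^+ 2 + 2 * v.2 * C * rho * S + v.2 ^+ 2 * S ^+ 2 by rewrite /D; ring.
  by rewrite C2; ring.
rewrite /norm2 /= !exprMn !exprVn -mulrDr -mulrDl E divff ?expf_neq0// mulr1.
exact: r2.
Qed.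

Lemma boostNK S : cancel (boost S) (boost (- S)).
Proof.
move=> v; have := boost_norm2 S v; have /= := boost_facts S v.
rewrite [in X in _ -> _ -> X]/boost => + ->; rewrite sqrrN /boost /=.
set rho := Num.sqrt (norm2 v); set C := Num.sqrt _ => -[r2 C2 r0 rD].
have [rE|rn] := eqVneq rho 0.
  have := r2; rewrite rE expr0n /= => /esym/eqP.
  rewrite paddr_eq0 ?sqr_ge0// !sqrf_eq0 => /andP[/eqP v1 /eqP v2].
  by case: (v) v1 v2 => a b /= -> ->; rewrite !mul0r.
have Dn := lt0r_neq0 (rD (_ : 0 < rho)); rewrite lt_def rn r0 in Dn; have {}Dn := Dn isT.
set D := rho * C + v.2 * S in Dn *.
have DE : rho * C + rho * ((v.2 * C + rho * S) / D) * - S = rho ^+ 2 / D.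
  apply: (mulIf Dn); rewrite mulfVK//.
  have -> : (rho * C + rho * ((v.2 * C + rho * S) / D) * - S) * D =
    rho * C * D - rho * S * (v.2 * C + rho * S) by field.
  rewrite (_ : rho ^+ 2 = rho ^+ 2 * (C ^+ 2 - S ^+ 2)); first by rewrite /D; ring.
  by rewrite C2; ring.
rewrite DE; case: (v) @D Dn {rD DE r2} => a b /= Dn; congr (_, _); first by field; apply/andP.
have -> : rho * ((rho * ((b * C + rho * S) / (rho * C + b * S)) * C + rho * - S) /
   (rho ^+ 2 / (rho * C + b * S))) = (b * C + rho * S) * C - S * (rho * C + b * S).
  by field; apply/andP.
by rewrite (_ : _ - _ = b * (C ^+ 2 - S ^+ 2)); [rewrite C2; ring|ring].
Qed.

Lemma cont_boost (x : R * (R * R)) : cont_at (fun x : R * (R * R) => boost x.1 x.2) x.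
Proof.
have cr : cont_at (fun x : R * (R * R) => Num.sqrt (norm2 x.2)) x by rewrite /norm2; cont.
have bd (y : R * (R * R)) : `|(boost y.1 y.2).1| <= `|Num.sqrt (norm2 y.2)| /\
    `|(boost y.1 y.2).2| <= `|Num.sqrt (norm2 y.2)|.
  rewrite -(boost_norm2 y.1) (ger0_norm (sqrtr_ge0 _)) -!sqrtr_sqr.
  by rewrite !ler_sqrt ?norm2_ge0// /norm2 lerDl lerDr !sqr_ge0.
(* At the tip of the cone the formula is 0 / 0; there continuity follows from [boost_norm2], the
   image being as short as the vector. *)
have [r0|rn] := eqVneq (Num.sqrt (norm2 x.2)) 0.
  rewrite (_ : (fun _ => _) = fun y : R * (R * R) => ((boost y.1 y.2).1, (boost y.1 y.2).2)); last first.
    by apply/funext => y; rewrite -surjective_pairing.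
  by apply: cont_pair; apply: (cont_at_squeeze cr r0) => y; have [] := bd y.
have [_ _ r0 rD] := boost_facts x.1 x.2.
have Dn := lt0r_neq0 (rD (_ : 0 < _)); rewrite lt_def rn r0 in Dn; have {}Dn := Dn isT.
by rewrite /boost /norm2; cont.
Qed.

Definition boost_page (S : R) (Q : W) : W :=
  (Q.1.1, (boost S (Q.1.2, Q.2)).1, (boost S (Q.1.2, Q.2)).2).

Lemma boost0 v : boost 0 v = v.
Proof.
have [_ _ r0 _] := boost_facts 0 v; have r2 := norm2_ge0 v.
rewrite /boost expr0n /= addr0 sqrtr1 !mulr1 !mulr0 !addr0.
have [rE|rn] := eqVneq (Num.sqrt (norm2 v)) 0; last first.
  by rewrite !mulrA ![_ * v.1]mulrC ![_ * v.2]mulrC !mulfK//; case: v {r0 r2 rn}.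
move: rE => /eqP; rewrite sqrtr_eq0 => r2'.
have : norm2 v = 0 by apply/eqP; rewrite eq_le r2' r2.
move/eqP; rewrite paddr_eq0 ?sqr_ge0// !sqrf_eq0 => /andP[/eqP v1 /eqP v2].
by case: v v1 v2 {r0 r2 r2'} => a b /= -> ->; rewrite !mul0r !mulr0.
Qed.

Lemma boost_page_isotopy (S : R) : exists H, sphere_isotopy H /\
  forall P : S3 R, H 1 P = of_sphere (boost_page S (to_sphere P)).
Proof.
have sph b (Q : W) : on_sphere Q -> on_sphere (boost_page b Q).
  by rewrite !on_sphereE => <-; congr (_ + _); exact: boost_norm2.
have K b (Q : W) : boost_page (- b) (boost_page b Q) = Q.
  case: Q => [[p z] u].
  have E : boost (- b) ((boost b (z, u)).1, (boost b (z, u)).2) = (z, u).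
    by rewrite -surjective_pairing boostNK.
  change ((p, (boost (- b) ((boost b (z, u)).1, (boost b (z, u)).2)).1,
    (boost (- b) ((boost b (z, u)).1, (boost b (z, u)).2)).2) = (p, z, u)).
  by rewrite E.
have [||||||H [iH HE]] := @sphere_isotopy_R4 R (fun t => boost_page (t * S)) (fun t => boost_page (- (t * S))).
- move=> p; change (cont_at (fun p : R * W => boost_page (p.1 * S) p.2) p).
  have cb : cont_at (fun p : R * W => boost (p.1 * S) (p.2.1.2, p.2.2)) p.
    apply: (@cont_comp _ _ _ (fun p : R * W => (p.1 * S, (p.2.1.2, p.2.2)))
      (fun x : R * (R * R) => boost x.1 x.2)); first by cont.
    exact: cont_boost.
  by rewrite /boost_page; apply: cont_pair; [apply: cont_pair; [cont|exact: cont_fst]|exact: cont_snd].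
- by move=> Q; rewrite mul0r /boost_page boost0; case: Q => [[[]]].
- by move=> t Q; exact: sph.
- by move=> t Q; exact: sph.
- by move=> t Q _; exact: K.
- by move=> t Q _; rewrite -{1}(opprK (t * S)); exact: K.
by exists H; split=> // P; rewrite HE mul1r.
Qed.

End SphereMotions.

Section ShiftingSheets.
Variables (R : realType).
Local Notation V := (R * R * R)%type.

(** On the sphere in R^4 this is the radius of the circle of last two coordinates over [p]. A sheet
    of height c times it, with |c| <= 1, is the page of direction (c, - sqrt (1 - c^2)). *)
Definition page_radius (p : R * R) : R := Num.sqrt (dome p).

Lemma page_radius_stack s (c : 'I_s -> R) :
  (forall k l : 'I_s, (k < l)%N -> c l < c k) ->
  good_stack (fun k p => c k * page_radius p).
Proof.
apply: dome_stack => p.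
- by change (cont_at (fun p => page_radius p) p); apply: cont_sqrt; exact: cont_dome.
- by move=> p1; rewrite sqrtr_gt0 dome_gt0.
- by move=> p1; rewrite /page_radius dome_eq0// sqrtr0.
Qed.

(* With hyperbolic cosine 5/4 and sine -3/4, a half turn followed by the boost
   sends the unit vector (z, -w), 0 < w < 3/5, to one with z-coordinate
   -4z/(5-3w) and again with negative second coordinate. *)
Lemma page_motion (c w : R) (p : R * R) : norm2 p <= 1 -> 0 < w <= 3 / 10 -> c ^+ 2 + w ^+ 2 = 1 ->
  of_sphere (boost_page (- (3 / 4)) (rot_page pi (to_sphere (Some (p, c * page_radius p))))) =
    Some (p, - (4 * c / (5 - 3 * w)) * page_radius p).
Proof.
move=> p1 /andP[w0 w1] cw; set r := page_radius p.
have r2 : r ^+ 2 = 1 - norm2 p.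
  by rewrite /r /page_radius /dome (max_idPr _) ?subr_ge0// sqr_sqrtr// subr_ge0.
have r0 : 0 <= r by exact: sqrtr_ge0.
have q1 : bulk (p, c * r) = 1 - w ^+ 2 * r ^+ 2.
  rewrite /bulk /= exprMn -/(norm2 p) (_ : c ^+ 2 = 1 - w ^+ 2); last by rewrite -cw addrK.
  by rewrite r2; ring.
have q_le : bulk (p, c * r) <= 1 by rewrite q1 gerBl mulr_ge0 ?sqr_ge0.
have -> : to_sphere (Some (p, c * r)) = (p, c * r, - (w * r)).
  rewrite /to_sphere (max_idPl q_le) invr1 subrr sqrtr0 sub0r !mulr1 q1.
  rewrite opprB addrC subrK -exprMn sqrtr_sqr ger0_norm ?mulr_ge0// ?(ltW w0)//.
  by case: (p).
have -> : rot_page pi (p, c * r, - (w * r)) = (p, - (c * r), w * r).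
  by rewrite /rot_page /rot /= cospi sinpi; congr (_, _, _); ring.
have n2 : norm2 (- (c * r), w * r) = r ^+ 2.
  by rewrite /norm2 /= sqrrN !exprMn -mulrDl cw mul1r.
have sq : Num.sqrt (1 + (- (3 / 4)) ^+ 2) = 5 / 4 :> R.
  rewrite (_ : 1 + _ = (5 / 4) ^+ 2); last by field.
  by rewrite sqrtr_sqr ger0_norm// divr_ge0.
have d0 : 5 - 3 * w != 0 by apply: lt0r_neq0; lra.
have -> : boost_page (- (3 / 4)) (p, - (c * r), w * r) =
    (p, - (4 * c / (5 - 3 * w)) * r, r * ((5 * w - 3) / (5 - 3 * w))).
  rewrite /boost_page /boost /= n2 sq sqrtr_sqr ger0_norm//.
  have [->|rn] := eqVneq r 0; first by rewrite !mul0r mulr0.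
  have dn : r * (5 / 4) + w * r * - (3 / 4) != 0.
    rewrite (_ : _ + _ = r * (5 - 3 * w) / 4); last by field.
    by rewrite !mulf_neq0// invr_eq0 pnatr_eq0.
  congr (_, _, _).
    field; apply/andP; split=> //; apply: contra dn => /eqP h.
    by apply/eqP; move: h; lra.
  field; apply/andP; split=> //; apply: contra dn => /eqP h.
  by apply/eqP; move: h; lra.
rewrite /of_sphere /= (_ : _ <= 0)//.
by rewrite mulr_ge0_le0// pmulr_lle0 ?invr_gt0; lra.
Qed.

(** For w <= 3/10 one has c >= 9/10, so as w grows c falls at a rate of at most 1/3. The denominator
    5 - 3w falls at the rate 3, which outweighs this, and the quotient grows. *)
Lemma page_height_mono (c1 w1 c2 w2 : R) : 0 < w1 -> w1 < w2 -> w2 <= 3 / 10 ->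
  0 <= c1 -> 0 <= c2 -> c1 ^+ 2 + w1 ^+ 2 = 1 -> c2 ^+ 2 + w2 ^+ 2 = 1 ->
  c2 < c1 /\ 4 * c1 / (5 - 3 * w1) < 4 * c2 / (5 - 3 * w2).
Proof.
move=> w10 w12 w2l c10 c20 e1 e2.
have lb c w : 0 < w -> w <= 3 / 10 -> 0 <= c -> c ^+ 2 + w ^+ 2 = 1 -> 9 / 10 <= c :> R.
  move=> w0 wl c0 e; rewrite -(@ler_sqr _ (9 / 10)) ?nnegrE ?divr_ge0//.
  have : w ^+ 2 <= (3 / 10) ^+ 2 by rewrite ler_sqr ?nnegrE// ltW.
  have -> : (3 / 10) ^+ 2 = 9 / 100 :> R by field.
  have -> : (9 / 10) ^+ 2 = 81 / 100 :> R by field.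
  lra.
have l1 := lb c1 w1 w10 (ltW (lt_le_trans w12 w2l)) c10 e1.
have l2 := lb c2 w2 (lt_trans w10 w12) w2l c20 e2.
have E : (c1 - c2) * (c1 + c2) = (w2 - w1) * (w1 + w2).
  have -> : (c1 - c2) * (c1 + c2) = c1 ^+ 2 - c2 ^+ 2 by ring.
  have -> : (w2 - w1) * (w1 + w2) = w2 ^+ 2 - w1 ^+ 2 by ring.
  lra.
have wd : 0 < w2 - w1 by rewrite subr_gt0.
have cd0 : 0 < c1 - c2.
  rewrite -(pmulr_lgt0 _ (_ : 0 < c1 + c2)); last by lra.
  by rewrite E mulr_gt0//; lra.
split; first lra.
have cd : c1 - c2 <= (w2 - w1) / 3.
  have h95 : 0 < 9 / 5 :> R by lra.
  rewrite -(@ler_pM2r _ (9 / 5))//.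
  apply: (@le_trans _ _ ((c1 - c2) * (c1 + c2))); first by apply: ler_wpM2l; lra.
  rewrite E; have : (w2 - w1) * (w1 + w2) <= (w2 - w1) * (3 / 5) by apply: ler_wpM2l; lra.
  lra.
rewrite ltr_pdivrMr; last by lra.
rewrite mulrAC ltr_pdivlMr; last by lra.
have h1 : 0 <= w1 * (c1 - c2) by rewrite mulr_ge0// ltW.
have h2 : 9 / 10 * (w2 - w1) <= c1 * (w2 - w1) by rewrite ler_wpM2r// ltW.
lra.
Qed.

Variable n : nat.
Hypothesis n2 : (2 <= n)%N.

(** [sh] moves the first [j] sheets below the others. The former get slopes near 1, the latter near
    -1, and the half turn interchanges the two groups. It leaves the pages in the upper hemisphere,
    outside the unit ball, where they are not drawn over the disk; the boost brings them back. *)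
Lemma shift_move s (B B' : assignment n s) (sh shV : 'I_s -> 'I_s) (j : nat) :
  cancel sh shV -> cancel shV sh ->
  (forall k l, (sh k < sh l)%N ->
     ((k < l)%N /\ (k < j)%N = (l < j)%N) \/ ((j <= k)%N /\ (l < j)%N)) ->
  (forall e, is_edge e -> B' e = sh (B e)) ->
  sheets_noncrossing B -> sheets_noncrossing B' /\ book_isotopic R B B'.
Proof.
move=> shK shVK sh_lt BE ncB.
have ncB' : sheets_noncrossing B'.
  by move=> e f ie jf; rewrite !BE// => /(can_inj shK); exact: ncB.
split=> //.
(* The unit 3/10/(s+1) keeps every w in (0, 3/10]. The values increase before [j] and decrease from
   [j] on, so that the slopes +-sqrt (1 - w^2) decrease throughout. *)
pose w (k : 'I_s) : R := (if (k < j)%N then (k : nat).+1%:R else (s - k)%:R) * (3 / 10 / s.+1%:R).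
have w01 k : 0 < w k <= 3 / 10.
  have s0 : 0 < s.+1%:R :> R by rewrite ltr0n.
  have m (i : nat) : (0 < i <= s)%N -> 0 < (i%:R : R) * (3 / 10 / s.+1%:R) <= 3 / 10.
    move=> /andP[m0 ms]; rewrite mulr_gt0 ?ltr0n ?divr_gt0//=.
    rewrite mulrCA ler_piMr// ler_pdivrMr// mul1r ler_nat; exact: leqW.
  rewrite /w; case: ifP => _; apply: m; first by rewrite ltn_ord.
  by rewrite subn_gt0 ltn_ord leq_subr.
have w_lt (k l : 'I_s) : (k < l)%N -> (k < j)%N = (l < j)%N ->
    if (k < j)%N then w k < w l else w l < w k.
  have e0 : 0 < 3 / 10 / s.+1%:R :> R by rewrite !divr_gt0.
  move=> kl kj; rewrite /w -kj; case: (k < j)%N; rewrite (ltr_pM2r e0) ltr_nat//.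
  by apply: ltn_sub2l.
pose a (k : 'I_s) : R := Num.sqrt (1 - w k ^+ 2).
have aE k : a k ^+ 2 + w k ^+ 2 = 1.
  have /andP[w0 w1] := w01 k; rewrite sqr_sqrtr ?subrK// subr_ge0.
  by rewrite expr_le1 ?(ltW w0)// (le_trans w1)//; lra.
have a0 k : 0 <= a k by exact: sqrtr_ge0.
have ap k : 0 < a k.
  rewrite lt_def a0 andbT; apply/eqP => ak; have := aE k; rewrite ak expr0n /= add0r.
  have /andP[w0 w1] := w01 k; move/eqP; rewrite sqrf_eq1 => /orP[]/eqP; lra.
pose c (k : 'I_s) : R := if (k < j)%N then a k else - a k.
have cE k : c k ^+ 2 + w k ^+ 2 = 1 by rewrite /c; case: ifP => _; rewrite ?sqrrN.
pose c' (k : 'I_s) : R := - (4 * c k / (5 - 3 * w k)).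
have g0 k : 0 < 4 * a k / (5 - 3 * w k).
  by have /andP[w0 w1] := w01 k; rewrite divr_gt0 ?mulr_gt0//; lra.
have c'E k : c' k = if (k < j)%N then - (4 * a k / (5 - 3 * w k)) else 4 * a k / (5 - 3 * w k).
  by rewrite /c' /c; case: ifP => // _; rewrite mulrN mulNr opprK.
have mono (k l : 'I_s) : (k < l)%N -> c l < c k.
  move=> kl; rewrite /c; have := w_lt k l kl; case: ltnP => kj; case: ltnP => lj.
  - move=> /(_ erefl) h; have /andP[w0 _] := w01 k; have /andP[_ w1] := w01 l.
    by have [] := page_height_mono w0 h w1 (a0 k) (a0 l) (aE k) (aE l).
  - by move=> _; have := ap k; have := ap l; lra.
  - by move: (leq_ltn_trans kj (ltn_trans kl lj)); rewrite ltnn.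
  - move=> /(_ erefl) h; have /andP[w0 _] := w01 l; have /andP[_ w1] := w01 k.
    have [] := page_height_mono w0 h w1 (a0 l) (a0 k) (aE l) (aE k); lra.
have mono' (k l : 'I_s) : (k < l)%N -> c' (shV l) < c' (shV k).
  rewrite -{1}(shVK k) -{1}(shVK l) => /sh_lt.
  move: (shV k) (shV l) => {}k {}l [[kl kj]|[kj lj]]; last first.
    by rewrite !c'E lj ltnNge kj /=; have := g0 k; have := g0 l; lra.
  have := w_lt k l kl kj; rewrite !c'E -kj; case: (k < j)%N => h.
    have /andP[w0 _] := w01 k; have /andP[_ w1] := w01 l.
    by have [] := page_height_mono w0 h w1 (a0 k) (a0 l) (aE k) (aE l); lra.
  have /andP[w0 _] := w01 l; have /andP[_ w1] := w01 k.
  by have [] := page_height_mono w0 h w1 (a0 l) (a0 k) (aE l) (aE k).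
have gh := page_radius_stack mono; have gh' := page_radius_stack mono'.
have [H [iH HE]] := rot_page_isotopy (@pi R).
have [K [iK KE]] := boost_page_isotopy (- (3 / 4) : R).
apply: (@book_isotopic_points R n n2 s s B B' _ _ (fun t => K t \o H t) 1%g ncB ncB' gh gh').
  exact: sphere_isotopy_comp.
move=> i i' t ii' t01; have pd := @seg_cv_disk R n i i' t t01.
rewrite !perm1 /= KE HE of_sphereK; last exact/rot_page_on_sphere/on_sphere_to.
rewrite /arc_point (page_motion pd (w01 _) (cE _)).
by rewrite BE ?edge_set2// shK.
Qed.

Lemma shifting_sheets_isotopic s (B B' : assignment n s) :
  shifting_sheets B B' -> sheets_noncrossing B ->
  sheets_noncrossing B' /\ book_isotopic R B B'.
Proof.
case=> BE.
  (* Only the last sheet comes to the top, so the cut is before it. *)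
  apply: (shift_move (@ordSK s) (@ord_predK s) (j := s.-1)) BE => k l.
  have := ltn_ord k; have := ltn_ord l; case: s k l {B B'} => // s k l ls ks /=.
  have top m : (m < s.+1)%N -> (s <= m)%N -> m = s by rewrite ltnS => ? ?; apply/anti_leq/andP.
  have [kl|sk] := ltnP k s; last first.
    rewrite (top k ks sk) modnn; have [ll|sl] := ltnP l s; first by move=> _; right.
    by rewrite (top l ls sl) modnn.
  rewrite (@modn_small k.+1)//; have [ll|sl] := ltnP l s.
    by rewrite (@modn_small l.+1)// ltnS => ?; left.
  by rewrite (top l ls sl) modnn.
(* Only the first sheet goes to the bottom, so the cut is after it. *)
apply: (shift_move (@ord_predK s) (@ordSK s) (j := 1)) BE => k l.
have := ltn_ord k; have := ltn_ord l; case: s k l {B B'} => // s k l ls ks /=.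
have val m : (m < s.+1)%N -> ((m + s.+1).-1 %% s.+1 = if m == 0 then s else m.-1)%N.
  case: m => [|m] ms /=; first by rewrite modn_small.
  by rewrite modnDr modn_small// ltnW.
rewrite !val//; case: (k : nat) ks => [|k'] ks; case: (l : nat) ls => [|l'] ls //=.
- by rewrite ltnn.
- by rewrite ltnNge -ltnS ltnW.
- by move=> _; right.
- by move=> h; left.
Qed.

End ShiftingSheets.

(** * Extension of Lipschitz motions *)

Section LipschitzExtension.
Variable (R : realType).
Local Notation V := (R * R * R)%type.

Lemma cont_at_dist (X0 X : V) : cont_at (fun Y : V => `|Y - X0|) X.
Proof.
rewrite (_ : (fun _ => _) = fun Y : V =>
  Num.max (Num.max `|Y.1.1 - X0.1.1| `|Y.1.2 - X0.1.2|) `|Y.2 - X0.2|); last first.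
  by apply/funext => -[[a b] c]; case: X0 => [[a' b'] c'].
by cont.
Qed.

Lemma lipschitz_cont_at (f : V -> R) (L : R) X : (forall Y, `|f Y - f X| <= L * `|Y - X|) ->
  cont_at f X.
Proof.
move=> fL; rewrite (_ : f = fun Y => (f Y - f X) + f X); last first.
  by apply/funext => Y; rewrite subrK.
apply: cont_add; last by cont.
apply: (@cont_at_squeeze R V (fun Y => f Y - f X) (fun Y : V => L * `|Y - X| : R)).
- by apply: cont_mul; [cont|exact: cont_at_dist].
- by rewrite subrr normr0 mulr0.
- by move=> Y; apply: le_trans (fL Y) (ler_norm _).
Qed.

Lemma norm3B (X Y : V) : [/\ `|X.1.1 - Y.1.1| <= `|X - Y|,
  `|X.1.2 - Y.1.2| <= `|X - Y| & `|X.2 - Y.2| <= `|X - Y|].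
Proof. by case: X Y => [[a b] c] [[a' b'] c']; exact: (norm3_coord (_, _, _)). Qed.

Definition lipschitz3 (L : R) (D : V -> V) : Prop :=
  forall X Y, `|D X - D Y| <= L * `|X - Y|.

(* The residual cannot be minimal at X unless it vanishes: adding it to X
   shrinks it by the factor L. *)
Lemma lipschitz_surj (L : R) (D : V -> V) : 0 <= L -> L < 1 -> lipschitz3 L D ->
  forall Y, exists X, X + D X = Y.
Proof.
move=> L0 L1 DL Y; pose f X := `|X + D X - Y|.
have fX X : cont_at f X.
  apply: (@lipschitz_cont_at f (1 + L)) => Z; rewrite /f.
  apply: (le_trans (ler_dist_dist _ _)).
  rewrite (_ : _ - _ - _ = (Z - X) + (D Z - D X)); last by rewrite !opprD opprK addrACA !addrA subrK -!addrA; congr (_ + _); rewrite addrCA.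
  by apply: (le_trans (ler_normD _ _)); rewrite mulrDl mul1r lerD2l.
(* Outside the ball of this radius f exceeds f 0, so a minimum on the compact ball is a global
   one. *)
pose r := (f 0 + `|D 0| + `|Y|) / (1 - L).
have L1' : 0 < 1 - L by rewrite subr_gt0.
have f0 : 0 <= f 0 by exact: normr_ge0.
have r0 : 0 <= r by rewrite divr_ge0 ?(ltW L1')// !addr_ge0.
have [|||X Xr Xmin] := @compact_EVT_min _ R f [set X : V | `|X| <= r].
- by exists 0; rewrite /= normr0.
- exact: ball3_compact.
- by apply: continuous_subspaceT => X; exact: fX.
have Xmin' Z : f X <= f Z.
  have [Zr|Zr] := leP `|Z| r; first by apply: Xmin; rewrite inE.
  apply: (le_trans (Xmin 0 _)); first by rewrite inE /= normr0.
  have DZ : `|D Z| <= L * `|Z| + `|D 0|.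
    have := DL Z 0; rewrite subr0 => h.
    by rewrite -{1}(subrK (D 0) (D Z)); apply: (le_trans (ler_normD _ _)); rewrite lerD2r.
  have ZE : `|Z| <= f Z + `|D Z| + `|Y|.
    rewrite -{1}(_ : (Z + D Z - Y) - D Z + Y = Z); last by rewrite addrAC subrK addrK.
    apply: (le_trans (ler_normD _ _)); rewrite lerD2r.
    by apply: (le_trans (ler_normD _ _)); rewrite normrN.
  move: Zr; rewrite /r ltr_pdivrMr//; lra.
exists X; apply/eqP; rewrite -subr_eq0 -normr_le0.
pose X' := X - (X + D X - Y).
have : f X' <= L * f X.
  have X'E : X' = Y - D X by rewrite /X' opprB addrCA opprD addNKr.
  have -> : f X' = `|D X' - D X|.
    by rewrite /f {1}X'E addrAC (addrAC Y) subrr add0r addrC.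
  by apply: (le_trans (DL _ _)); rewrite /X' addrC addKr normrN.
have := Xmin' X'; rewrite -/(f X) => h1 h2.
have : (1 - L) * f X <= 0 by lra.
by rewrite pmulr_rle0.
Qed.

(** At every time t the map id + t D is a Lipschitz perturbation of the identity with constant below
    1: it is bijective, and |X| is bounded by a multiple of |F t X| + |D 0|. *)
Lemma displacement_isotopy (L : R) (D : V -> V) : 0 <= L -> L < 1 -> lipschitz3 L D ->
  exists H, sphere_isotopy H /\ forall X, H 1 (Some X : S3 R) = Some (X + D X).
Proof.
move=> L0 L1 DL; pose F (t : R) (X : V) : V :=
  (X.1.1 + t * (D X).1.1, X.1.2 + t * (D X).1.2, X.2 + t * (D X).2).
have FE t X : F t X = X + t *: D X.
  by rewrite /F; case: X (D X) => [[a b] c] [[a' b'] c'].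
have [H [iH HE]] : exists H, sphere_isotopy H /\ forall X, H 1 (Some X : S3 R) = Some (F 1 X).
  apply: extend_isotopy.
  - move=> p; change (cont_at (fun p : R * V => F p.1 p.2) p).
    have c1 : cont_at (fun p : R * V => (D p.2).1.1) p.
      apply: (@cont_comp _ _ _ (fun p : R * V => p.2) (fun X => (D X).1.1)); first by cont.
      apply: (@lipschitz_cont_at _ L) => Y; apply: le_trans (DL _ _).
      by have [] := norm3B (D Y) (D p.2).
    have c2 : cont_at (fun p : R * V => (D p.2).1.2) p.
      apply: (@cont_comp _ _ _ (fun p : R * V => p.2) (fun X => (D X).1.2)); first by cont.
      apply: (@lipschitz_cont_at _ L) => Y; apply: le_trans (DL _ _).
      by have [] := norm3B (D Y) (D p.2).
    have c3 : cont_at (fun p : R * V => (D p.2).2) p.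
      apply: (@cont_comp _ _ _ (fun p : R * V => p.2) (fun X => (D X).2)); first by cont.
      apply: (@lipschitz_cont_at _ L) => Y; apply: le_trans (DL _ _).
      by have [] := norm3B (D Y) (D p.2).
    by rewrite /F; cont.
  - by apply/funext => X; rewrite FE scale0r addr0.
  - move=> t /andP[t0 t1].
    have tL : lipschitz3 L (fun X => t *: D X).
      move=> X Y; rewrite -scalerBr normrZ ger0_norm//.
      by apply: le_trans (DL X Y); rewrite ler_piMl.
    apply: inj_surj_bijective => [X Y|Y]; last first.
      by have [X XE] := lipschitz_surj L0 L1 tL Y; exists X; rewrite FE.
    rewrite !FE => E; apply/eqP; rewrite -subr_eq0 -normr_le0.
    have : `|X - Y| <= L * `|X - Y|.
      rewrite -{1}normrN (_ : - (X - Y) = t *: D X - t *: D Y); first exact: tL.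
      by apply/eqP; rewrite opprB subr_eq addrAC eq_sym subr_eq addrC E addrC.
    have L1' : 0 < 1 - L by rewrite subr_gt0.
    by move=> h; rewrite -(pmulr_rle0 _ L1'); lra.
  - move=> r; exists ((`|r| + `|D 0|) / (1 - L)) => t X /andP[t0 t1]; rewrite FE => h.
    have L1' : 0 < 1 - L by rewrite subr_gt0.
    have DX : `|D X| <= L * `|X| + `|D 0|.
      have := DL X 0; rewrite subr0 => h'.
      by rewrite -{1}(subrK (D 0) (D X)); apply: (le_trans (ler_normD _ _)); rewrite lerD2r.
    have tDX : `|t *: D X| <= `|D X| by rewrite normrZ ger0_norm// ler_piMl.
    have : `|X| <= `|X + t *: D X| + `|t *: D X|.
      rewrite -{1}(addrK (t *: D X) X); apply: (le_trans (ler_normD _ _)).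
      by rewrite normrN.
    have := ler_norm r; rewrite ler_pdivlMr//; lra.
exists H; split=> // X; by rewrite HE FE scale1r.
Qed.

Section McShane.
Variables (A : Type) (g : A -> V) (L : R) (P0 : A).
Hypothesis L0 : 0 <= L.

(** McShane's extension of a real Lipschitz function, given on the points [g P], to all of space
    with the same constant. *)
Definition mcshane (d : A -> R) (X : V) : R :=
  inf [set d P + L * `|X - g P| | P in [set: A]].

Section Scalar.
Variable d : A -> R.
Hypothesis dL : forall P Q, `|d P - d Q| <= L * `|g P - g Q|.

Let tri (X Y Z : V) : L * `|X - Z| <= L * `|X - Y| + L * `|Y - Z|.
Proof. by rewrite -mulrDr ler_wpM2l// ler_distD. Qed.

Let lb X P Q : d Q - L * `|X - g Q| <= d P + L * `|X - g P|.
Proof.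
have := dL Q P; rewrite ler_norml => /andP[_ h].
by have := tri (g Q) X (g P); rewrite (distrC (g Q) X); lra.
Qed.

Let hlb X : has_lbound [set d P + L * `|X - g P| | P in [set: A]].
Proof. by exists (d P0 - L * `|X - g P0|) => _ [P _ <-]. Qed.

Lemma mcshane_extends P : mcshane d (g P) = d P.
Proof.
apply/eqP; rewrite eq_le; apply/andP; split.
  apply: ge_inf; first exact: hlb.
  by exists P => //; rewrite subrr normr0 mulr0 addr0.
apply: lb_le_inf; first by exists (d P + L * `|g P - g P|), P.
by move=> _ [Q _ <-]; have := lb (g P) Q P; rewrite subrr normr0 mulr0 subr0.
Qed.

Lemma mcshane_lipschitz X Y : `|mcshane d X - mcshane d Y| <= L * `|X - Y|.
Proof.
have H Z W : mcshane d Z - mcshane d W <= L * `|Z - W|.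
  rewrite lerBlDl -lerBlDr; apply: lb_le_inf.
    by exists (d P0 + L * `|W - g P0|), P0.
  move=> _ [P _ <-]; rewrite lerBlDr.
  apply: (@le_trans _ _ (d P + L * `|Z - g P|)).
    by apply: ge_inf; [exact: hlb|exists P].
  by have := tri Z W (g P); lra.
by rewrite ler_norml lerNl opprB (distrC X Y) H distrC H.
Qed.

End Scalar.

(** As the norm of [V] is the sup norm, the three coordinates can be extended separately without
    loss in the constant. *)
Lemma mcshane_isotopy (D : A -> V) : L < 1 ->
  (forall P Q, `|D P - D Q| <= L * `|g P - g Q|) ->
  exists H, sphere_isotopy H /\ forall P, H 1 (Some (g P) : S3 R) = Some (g P + D P).
Proof.
move=> L1 DL.
have D1 P Q : `|(D P).1.1 - (D Q).1.1| <= L * `|g P - g Q|.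
  by apply: le_trans (DL P Q); have [] := norm3B (D P) (D Q).
have D2 P Q : `|(D P).1.2 - (D Q).1.2| <= L * `|g P - g Q|.
  by apply: le_trans (DL P Q); have [] := norm3B (D P) (D Q).
have D3 P Q : `|(D P).2 - (D Q).2| <= L * `|g P - g Q|.
  by apply: le_trans (DL P Q); have [] := norm3B (D P) (D Q).
pose E X : V := (mcshane (fun P => (D P).1.1) X, mcshane (fun P => (D P).1.2) X,
  mcshane (fun P => (D P).2) X).
have EL : lipschitz3 L E.
  move=> X Y; rewrite norm3_le; apply/and3P; split; exact: mcshane_lipschitz.
have [H [iH HE]] := displacement_isotopy L0 L1 EL.
exists H; split=> // P; rewrite HE /E !mcshane_extends//.
Qed.

End McShane.

(* Isotopy extension: the motion is cut into steps so short that each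
   displacement is Lipschitz with constant less than 1. *)
Lemma lipschitz_motion_isotopy (A : Type) (P0 : A) (G : R -> A -> V) (M : R) :
  (forall t u P Q, 0 <= t <= 1 -> 0 <= u <= 1 ->
    `|(G u P - G t P) - (G u Q - G t Q)| <= M * `|u - t| * `|G t P - G t Q|) ->
  exists H, sphere_isotopy H /\ forall P, H 1 (Some (G 0 P) : S3 R) = Some (G 1 P).
Proof.
move=> GM; pose N := (Num.truncn (Num.max 0 M)).+1.
have N0 : 0 < N%:R :> R by rewrite ltr0n.
have MN : Num.max 0 M < N%:R by apply: truncnS_gt; rewrite le_max lexx.
have step k : (k < N)%N -> exists H, sphere_isotopy H /\
    forall P, H 1 (Some (G (k%:R / N%:R) P) : S3 R) = Some (G (k.+1%:R / N%:R) P).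
  move=> kN; pose L := Num.max 0 M / N%:R.
  have L0 : 0 <= L by rewrite divr_ge0 ?le_max ?lexx ?(ltW N0).
  have L1 : L < 1 by rewrite ltr_pdivrMr// mul1r.
  have t01 j : (j <= N)%N -> 0 <= (j%:R / N%:R : R) <= 1.
    by move=> jN; rewrite divr_ge0//= ler_pdivrMr// mul1r ler_nat.
  have [P Q|H [iH HE]] := @mcshane_isotopy A (G (k%:R / N%:R)) L P0 L0
    (fun P => G (k.+1%:R / N%:R) P - G (k%:R / N%:R) P) L1.
    apply: (le_trans (GM _ _ P Q (t01 k (ltnW kN)) (t01 _ kN))).
    rewrite -mulrBl -natrB// subSnn mul1r gtr0_norm ?invr_gt0//.
    apply: ler_wpM2r => //; rewrite /L; apply: ler_wpM2r; first by rewrite invr_ge0 ltW.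
    by rewrite le_max lexx orbT.
  by exists H; split=> // P; rewrite HE addrC subrK.
have H k : (k <= N)%N -> exists H, sphere_isotopy H /\
    forall P, H 1 (Some (G 0 P) : S3 R) = Some (G (k%:R / N%:R) P).
  elim: k => [|k IH] kN.
    exists (fun _ => id); split; last by move=> P; rewrite mul0r.
    split=> //; first by move=> p; exact: cvg_snd.
    by move=> t _; exists id.
  have [H1 [iH1 E1]] := IH (ltnW kN); have [H2 [iH2 E2]] := step k kN.
  exists (fun t => H2 t \o H1 t); split; first exact: sphere_isotopy_comp.
  by move=> P; rewrite /= E1 E2.
have [K [iK KE]] := H N (leqnn _).
by exists K; split=> // P; rewrite KE divff// lt0r_neq0.
Qed.

End LipschitzExtension.

(** * Vertex exchange *)

Section Interp.
Variable (R : realType).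
Local Notation V := (R * R * R)%type.
Implicit Types (p q c s r e C : R).

(** The parabola with end values [p] and [q] and second derivative -2c. *)
Definition itp p q c s : R := (1 - s) * p + s * q + s * (1 - s) * c.

Lemma itpC p q c s : itp q p c (1 - s) = itp p q c s.
Proof. by rewrite /itp; ring. Qed.

Lemma itpB p q c p' q' c' s : itp p q c s - itp p' q' c' s = itp (p - p') (q - q') (c - c') s.
Proof. by rewrite /itp; ring. Qed.

Lemma itp_same p q c s r : itp p q c s - itp p q c r = (s - r) * (q - p + (1 - s - r) * c).
Proof. by rewrite /itp; ring. Qed.

(** Two arcs issuing from one point, with parameters in polar form: [rho] is their sum and [al] the
    share of the first. Dividing by [rho] removes the zero at the common end. *)
Lemma itp_share p q q' c c' rho al :
  itp p q c (rho * al) - itp p q' c' (rho * (1 - al)) =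
  rho * (al * (q - p) - (1 - al) * (q' - p)
    + (al * (1 - rho * al) * c - (1 - al) * (1 - rho * (1 - al)) * c')).
Proof. by rewrite /itp; ring. Qed.

Lemma prod_le1 (x y z : R) : 0 <= x <= 1 -> `|y| <= z -> `|x * y| <= z.
Proof.
move=> /andP[x0 x1] yz; rewrite normrM (ger0_norm x0); apply: le_trans yz.
by rewrite ler_piMl.
Qed.

Lemma itp_le p q c s e C : 0 <= s <= 1 -> `|p| <= e -> `|q| <= e -> `|c| <= C ->
  `|itp p q c s| <= 2 * e + C.
Proof.
move=> /andP[s0 s1] pe qe cC; rewrite /itp.
have h1 : `|(1 - s) * p| <= e by apply: prod_le1 => //; lra.
have h2 : `|s * q| <= e by apply: prod_le1 => //; lra.
have h3 : `|s * (1 - s) * c| <= C.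
  by rewrite -mulrA; apply: prod_le1; [lra|apply: prod_le1 => //; lra].
by move: h1 h2 h3; rewrite !ler_norml => /andP[? ?] /andP[? ?] /andP[? ?]; apply/andP; split; lra.
Qed.

Lemma itp_same_le p q c s r e C : 0 <= s <= 1 -> 0 <= r <= 1 ->
  `|p| <= e -> `|q| <= e -> `|c| <= C ->
  `|itp p q c s - itp p q c r| <= `|s - r| * (2 * e + C).
Proof.
move=> s01 r01 pe qe cC; rewrite itp_same normrM; apply: ler_wpM2l => //.
have h : `|(1 - s - r) * c| <= C.
  rewrite normrM -[C]mul1r; apply: ler_pM => //; rewrite ler_norml.
  by case/andP: s01; case/andP: r01 => *; apply/andP; split; lra.
by move: h pe qe; rewrite !ler_norml => /andP[? ?] /andP[? ?] /andP[? ?]; apply/andP; split; lra.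
Qed.

Lemma itp_share_le p q q' c c' s r e C C' : 0 <= s <= 1 -> 0 <= r <= 1 ->
  `|p| <= e -> `|q| <= e -> `|q'| <= e -> `|c| <= C -> `|c'| <= C' ->
  `|itp p q c s - itp p q' c' r| <= (s + r) * (2 * e + C + C').
Proof.
move=> s01 r01 pe qe qe' cC cC'.
have -> : itp p q c s - itp p q' c' r =
   s * (q - p + (1 - s) * c) - r * (q' - p + (1 - r) * c') by rewrite /itp; ring.
have E0 : 0 <= e by exact: le_trans (normr_ge0 _) pe.
have C0 : 0 <= C by exact: le_trans (normr_ge0 _) cC.
have C0' : 0 <= C' by exact: le_trans (normr_ge0 _) cC'.
case/andP: (s01) => s0 s1; case/andP: (r01) => r0 r1.
have h1 : `|(1 - s) * c| <= C by apply: prod_le1 => //; lra.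
have h2 : `|(1 - r) * c'| <= C' by apply: prod_le1 => //; lra.
have k1 : `|s * (q - p + (1 - s) * c)| <= s * (2 * e + C + C').
  rewrite normrM (ger0_norm s0); apply: ler_wpM2l => //.
  by move: h1 pe qe; rewrite !ler_norml => /andP[? ?] /andP[? ?] /andP[? ?]; apply/andP; split; lra.
have k2 : `|r * (q' - p + (1 - r) * c')| <= r * (2 * e + C + C').
  rewrite normrM (ger0_norm r0); apply: ler_wpM2l => //.
  by move: h2 pe qe'; rewrite !ler_norml => /andP[? ?] /andP[? ?] /andP[? ?]; apply/andP; split; lra.
by rewrite [leRHS]mulrDl; apply: (le_trans (ler_normB _ _)); exact: lerD.
Qed.

(** The box holds a time and two parameters; [T] is 1 for an arc parameter and 2 for a sum of two.
    The minimum is taken of the sum of the absolute coordinates, at most 3 times the norm. *)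
Lemma nonvanishing_lower (f : V -> V) (T : R) :
  (forall X, cont_at (fun X => (f X).1.1) X) -> (forall X, cont_at (fun X => (f X).1.2) X) ->
  (forall X, cont_at (fun X => (f X).2) X) ->
  (forall X, 0 <= X.1.1 <= 1 -> 0 <= X.1.2 <= T -> 0 <= X.2 <= 1 -> f X <> 0) ->
  0 <= T ->
  exists2 m, 0 < m &
    forall X, 0 <= X.1.1 <= 1 -> 0 <= X.1.2 <= T -> 0 <= X.2 <= 1 -> m <= `|f X|.
Proof.
move=> c1 c2 c3 nz T0.
pose K : set V := (`[0, 1 : R] `*` `[0, T]) `*` `[0, 1].
pose g X := `|(f X).1.1| + `|(f X).1.2| + `|(f X).2|.
have KP X : K X <-> [/\ 0 <= X.1.1 <= 1, 0 <= X.1.2 <= T & 0 <= X.2 <= 1].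
  by rewrite /K /= !in_itv /=; split=> [[[-> ->] ->]|[-> -> ->]].
have [|||X0 X0K gmin] := @compact_EVT_min V R g K.
- by exists (0, 0, 0); apply/KP; rewrite /= !lexx ler01 T0.
- by do 2?apply: compact_setX; exact: segment_compact.
- apply: continuous_subspaceT => X; change (cont_at (fun X => g X) X).
  have e1 := c1 X; have e2 := c2 X; have e3 := c3 X.
  by rewrite /g; apply: cont_add; [apply: cont_add|]; apply: cont_norm.
have [x1 x2 x3] := proj1 (KP X0) (set_mem X0K).
have g0 : 0 < g X0.
  rewrite lt_def !addr_ge0// andbT; apply/eqP => g0; apply: (nz X0 x1 x2 x3).
  move: g0 => /eqP; rewrite !paddr_eq0 ?addr_ge0// !normr_eq0.
  by case: (f X0) => -[x y] z /= /andP[/andP[/eqP-> /eqP->] /eqP->].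
exists (g X0 / 3); first by rewrite divr_gt0.
move=> X y1 y2 y3; rewrite ler_pdivrMr//.
apply: (@le_trans _ _ (g X)); first by apply: gmin; apply/mem_set/KP.
have [h1 h2 h3] := norm3_coord (f X); rewrite /g; lra.
Qed.

End Interp.

Section Signs.
Variable (R : realType).
Implicit Types (A B mu M s t : R).

Lemma conv_same_sign A B mu t : 0 < A * B -> mu <= `|A| -> mu <= `|B| -> 0 <= t <= 1 ->
  0 < A * ((1 - t) * A + t * B) /\ mu <= `|(1 - t) * A + t * B|.
Proof.
wlog A0 : A B / 0 < A.
  move=> H AB; have [A0|A0|A0] := ltgtP A 0; last by move: AB; rewrite A0 mul0r ltxx.
    move=> mA mB t01; have [| | | | | h1 h2] := H (- A) (- B) => //; rewrite ?normrN ?oppr_gt0 ?mulrNN//.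
    split; last by rewrite -normrN (_ : - _ = (1 - t) * - A + t * - B)//; ring.
    by rewrite (_ : A * ((1 - t) * A + t * B) = - A * ((1 - t) * - A + t * - B))//; ring.
  by move=> mA mB t01; exact: H.
rewrite pmulr_rgt0// => B0; rewrite (gtr0_norm A0) (gtr0_norm B0) => mA mB /andP[t0 t1].
have h : Num.min A B <= (1 - t) * A + t * B.
  have h1 : (1 - t) * Num.min A B <= (1 - t) * A by rewrite ler_wpM2l ?subr_ge0// ge_min lexx.
  have h2 : t * Num.min A B <= t * B by rewrite ler_wpM2l// ge_min lexx orbT.
  lra.
have p : 0 < (1 - t) * A + t * B by apply: lt_le_trans h; rewrite lt_min A0.
split; first exact: mulr_gt0.
by rewrite gtr0_norm//; apply: le_trans h; rewrite le_min mA.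
Qed.

(** At the zero (1 - s)|A| = s|B|, so neither s nor 1 - s can be small. For a crossing this keeps
    the meeting point away from the ends of the edge. *)
Lemma affine_zero_bounds A B mu M s : 0 < mu -> mu <= `|A| <= M -> mu <= `|B| <= M ->
  0 <= s <= 1 -> (1 - s) * A + s * B = 0 ->
  [/\ A * B < 0, mu / (2 * M) <= s & mu / (2 * M) <= 1 - s].
Proof.
move=> mu0 /andP[mA AM] /andP[mB BM] /andP[s0 s1] E.
have M0 : 0 < M by apply: lt_le_trans AM; exact: lt_le_trans mA.
have muM : mu <= M by exact: le_trans AM.
have EA : (1 - s) * `|A| = s * `|B|.
  have : `|(1 - s) * A| = `|s * B|.
    by rewrite (_ : (1 - s) * A = - (s * B)) ?normrN//; apply/eqP; rewrite -addr_eq0 E.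
  by rewrite !normrM ger0_norm ?subr_ge0// (ger0_norm s0).
have k1 : (1 - s) * mu <= (1 - s) * `|A| by rewrite ler_wpM2l ?subr_ge0.
have k2 : s * `|B| <= s * M by rewrite ler_wpM2l.
have k3 : s * mu <= s * `|B| by rewrite ler_wpM2l.
have k4 : (1 - s) * `|A| <= (1 - s) * M by rewrite ler_wpM2l ?subr_ge0.
have k5 : s * mu <= s * M by rewrite ler_wpM2l.
have k6 : (1 - s) * mu <= (1 - s) * M by rewrite ler_wpM2l ?subr_ge0.
have M2 : 0 < 2 * M by rewrite mulr_gt0.
split; [|rewrite ler_pdivrMr//; lra|rewrite ler_pdivrMr//; lra].
have A0 : 0 < `|A| by exact: lt_le_trans mA.
have B0 : 0 < `|B| by exact: lt_le_trans mB.
rewrite ltNge; apply/negP => AB0.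
have s_gt0 : 0 < s.
  rewrite lt_def s0 andbT; apply/eqP => s_0; move: EA; rewrite s_0 subr0 mul1r mul0r; lra.
have h : s * (B * B) = - ((1 - s) * (A * B)).
  by apply/eqP; rewrite -addr_eq0 -[X in _ == X](mulr0 B) -E; apply/eqP; ring.
have h1 : 0 < s * (B * B) by rewrite mulr_gt0// -expr2 exprn_even_gt0//= -normr_gt0.
have h2 : 0 <= (1 - s) * (A * B) by rewrite mulr_ge0// subr_ge0.
lra.
Qed.

End Signs.

Lemma finite_lower_bound (R : realType) (T : finType) (P : pred T) (f : T -> R) :
  (forall x, P x -> 0 < f x) -> exists2 m, 0 < m & forall x, P x -> m <= f x.
Proof.
move=> f0; have S0 : 0 <= \sum_(x | P x) (f x)^-1.
  by apply: sumr_ge0 => x /f0 fx; rewrite invr_ge0 ltW.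
have S1 : 0 < 1 + \sum_(x | P x) (f x)^-1 by lra.
exists (1 + \sum_(x | P x) (f x)^-1)^-1; first by rewrite invr_gt0.
move=> x Px; rewrite invf_ple ?posrE ?f0//.
rewrite (bigD1 x)//= addrCA lerDl addr_ge0//.
by apply: sumr_ge0 => y /andP[/f0 fy _]; rewrite invr_ge0 ltW.
Qed.

Lemma sign_chain (R : realType) (x A y : R) : 0 < x * A -> A * y < 0 -> x * y < 0.
Proof.
move=> xA Ay; have A0 : A != 0 by apply: contraTneq xA => ->; rewrite mulr0 ltxx.
have : (x * A) * (A * y) < 0 by rewrite pmulr_rlt0.
rewrite (_ : _ * _ = A ^+ 2 * (x * y)); last by ring.
by rewrite pmulr_rlt0// exprn_even_gt0.
Qed.

Lemma disk_coord (R : realType) (p : R * R) : norm2 p <= 1 -> `|p.1| <= 1 /\ `|p.2| <= 1.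
Proof.
rewrite /norm2 => p1; split; rewrite -(@ler_sqr _ _ 1) ?nnegrE// real_normK ?num_real// expr1n.
  by apply: le_trans p1; rewrite lerDl sqr_ge0.
by apply: le_trans p1; rewrite lerDr sqr_ge0.
Qed.

Lemma orient_le (R : realType) (p q r : R * R) : norm2 p <= 1 -> norm2 q <= 1 ->
  norm2 r <= 1 -> `|orient p q r| <= 8.
Proof.
move=> /disk_coord[p1 p2] /disk_coord[q1 q2] /disk_coord[r1 r2].
have d (x y : R) : `|x| <= 1 -> `|y| <= 1 -> `|x - y| <= 2.
  by move=> x1 y1; apply: (le_trans (ler_normB _ _)); lra.
rewrite /orient; apply: (le_trans (ler_normB _ _)); rewrite !normrM.
have h1 : `|q.1 - p.1| * `|r.2 - p.2| <= 2 * 2 by apply: ler_pM => //; exact: d.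
have h2 : `|q.2 - p.2| * `|r.1 - p.1| <= 2 * 2 by apply: ler_pM => //; exact: d.
lra.
Qed.

Lemma orient_rays (R : realType) (p q x y z : R * R) (al be : R) :
  al * (y.1 - x.1) = be * (z.1 - x.1) -> al * (y.2 - x.2) = be * (z.2 - x.2) ->
  al * (orient p q y - orient p q x) = be * (orient p q z - orient p q x).
Proof.
move=> e1 e2; have E u : orient p q u - orient p q x =
    (q.1 - p.1) * (u.2 - x.2) - (q.2 - p.2) * (u.1 - x.1) by rewrite /orient; ring.
rewrite !E; transitivity ((q.1 - p.1) * (al * (y.2 - x.2)) - (q.2 - p.2) * (al * (y.1 - x.1))).
  by ring.
by rewrite e1 e2; ring.
Qed.

(** * The motion that exchanges two consecutive vertices *)

Section ExchangeMotion.
Variables (R : realType) (n s : nat) (B B' : assignment n s) (v w : 'I_n).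
Local Notation cv := (@circle_vertex R n).
Local Notation V := (R * R * R)%type.
Local Notation a := (cv v).
Local Notation b := (cv w).
Implicit Types (i j k l : 'I_n) (t u sg rg : R).

Definition moving i : bool := (i == v) || (i == w).

Hypothesis vw : v != w.
Hypothesis same_side : forall x y, ~~ moving x -> ~~ moving y ->
  0 < orient a b (cv x) * orient a b (cv y).
Hypothesis not_separated : forall y z, y != z -> ~~ moving y -> ~~ moving z ->
  0 < orient (cv y) (cv z) a * orient (cv y) (cv z) b.
Hypothesis w_above_v : forall x y, ~~ moving x -> ~~ moving y ->
  (B [set w; y]%SET < B [set v; x]%SET)%N.
Hypothesis ncB : sheets_noncrossing B.

Let tau : {perm 'I_n} := tperm v w.
Let d2 i j : R := norm2 ((cv i).1 - (cv j).1, (cv i).2 - (cv j).2).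

Lemma orient_lower : exists2 mu, 0 < mu &
  forall i j k, i != j -> j != k -> i != k -> mu <= `|orient (cv i) (cv j) (cv k)|.
Proof.
have [|m m0 mP] := @finite_lower_bound R ('I_n * 'I_n * 'I_n)%type
  (fun x => [&& x.1.1 != x.1.2, x.1.2 != x.2 & x.1.1 != x.2])
  (fun x => `|orient (cv x.1.1) (cv x.1.2) (cv x.2)|).
  by move=> x /and3P[? ? ?]; rewrite normr_gt0 orient_cv_neq0.
by exists m => // i j k ij jk ik; apply: (mP (i, j, k)); apply/and3P.
Qed.

Lemma dist_lower : exists2 m, 0 < m & forall i j, i != j -> m <= d2 i j.
Proof.
have [|m m0 mP] := @finite_lower_bound R ('I_n * 'I_n)%type
  (fun x => x.1 != x.2) (fun x => d2 x.1 x.2).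
  by move=> x h; apply: norm2_dist_gt0; rewrite (inj_eq (@cv_inj R n)).
by exists m => // i j ij; apply: (mP (i, j)).
Qed.

Lemma d2_ge0 i j : 0 <= d2 i j.
Proof. exact: norm2_ge0. Qed.

Lemma d2_le i j : d2 i j <= 4.
Proof.
have H (p q : R * R) : norm2 (p.1 - q.1, p.2 - q.2) <= 2 * norm2 p + 2 * norm2 q.
  rewrite -subr_ge0 /norm2 /=.
  rewrite [X in 0 <= X](_ : _ = (p.1 + q.1) ^+ 2 + (p.2 + q.2) ^+ 2); last by ring.
  by rewrite addr_ge0 ?sqr_ge0.
have := H (cv i) (cv j); rewrite !cv_norm2 -/(d2 i j); lra.
Qed.

Lemma d2C i j : d2 i j = d2 j i.
Proof. by rewrite /d2 /norm2 /=; ring. Qed.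

Definition pos t i : R * R :=
  if i == v then seg a b t else if i == w then seg b a t else cv i.

(** The lifts reach 1 and -1 at t = 1/2, when v and w have the same projection. *)
Definition lft t i : R :=
  if i == v then - (4 * t * (1 - t)) else if i == w then 4 * t * (1 - t) else 0.

Let isvw i j : bool := (i == v) && (j == w) || (i == w) && (j == v).

Variable K : R.
Hypothesis K1 : 1 <= K.

Let c (k : 'I_s) : R := K ^+ (s - k).
(** Over a chord, [dome] is s(1 - s) times its squared length. Interpolating between the squared
    lengths of the old and the new chord makes the motion start and end on sheets of the stack. *)
Let kap t i j : R := (1 - t) * d2 i j + t * d2 (tau i) (tau j).

(* The factor (1 - 2t)^2 keeps the edge vw straight when v and w pass over each other. *)
Definition amp t i j : R := if isvw i j
  then (1 - 2 * t) ^+ 2 * ((1 - t) * c (B [set v; w]%SET) + t * c (B' [set v; w]%SET)) * d2 v w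
  else c (B [set i; j]%SET) * kap t i j.

Definition gpos t i j sg : V :=
  (itp (pos t i).1 (pos t j).1 0 sg, itp (pos t i).2 (pos t j).2 0 sg,
   itp (lft t i) (lft t j) (amp t i j) sg).

Lemma c_ge1 (k : 'I_s) : 1 <= c k.
Proof. by rewrite exprn_ege1. Qed.

Lemma c_gap (k l : 'I_s) : (k < l)%N -> K * c l <= c k.
Proof.
move=> kl; rewrite /c -exprS; apply: ler_weXn2l => //.
by rewrite ltn_sub2l// (ltn_trans kl).
Qed.

Lemma c_decr (k l : 'I_s) : 1 < K -> (k < l)%N -> c l < c k.
Proof.
move=> K1' kl; apply: lt_le_trans (c_gap kl); rewrite ltr_pMl//.
by apply: lt_le_trans (c_ge1 l).
Qed.

Lemma pos_seg t i : moving i -> 0 <= t <= 1 ->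
  exists2 th, 0 <= th <= 1 & pos t i = seg a b th.
Proof.
rewrite /moving /pos => /orP[/eqP->|/eqP->] t01; first by rewrite eqxx; exists t.
rewrite eq_sym (negPf vw) eqxx -segC; exists (1 - t) => //; lra.
Qed.

Lemma pos_fixed t i : ~~ moving i -> pos t i = cv i.
Proof. by rewrite negb_or /pos => /andP[/negPf-> /negPf->]. Qed.

Lemma lft_fixed t i : ~~ moving i -> lft t i = 0.
Proof. by rewrite negb_or /lft => /andP[/negPf-> /negPf->]. Qed.

Lemma pos_disk t i : 0 <= t <= 1 -> norm2 (pos t i) <= 1.
Proof.
move=> t01; have [mi|mi] := boolP (moving i); last by rewrite pos_fixed// cv_norm2.
by have [th th01 ->] := pos_seg mi t01; exact: seg_cv_disk.
Qed.

Lemma orient_ab_moving t i : moving i -> 0 <= t <= 1 -> orient a b (pos t i) = 0.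
Proof.
move=> mi t01; have [th th01 ->] := pos_seg mi t01.
by rewrite orient_seg; have [-> ->] := orientpp a b; rewrite !mulr0 addr0.
Qed.

Lemma orient_ab_neq0 i : ~~ moving i -> orient a b (cv i) != 0.
Proof.
move=> mi; have := same_side mi mi; rewrite -expr2.
by rewrite exprn_even_gt0.
Qed.

Lemma moving_neq i j : moving i -> ~~ moving j -> i != j.
Proof. by move=> mi mj; apply: contraNneq mj => <-. Qed.

(** The line through [y] and [z] has v and w on the same side, at orientations of size at least mu;
    hence also every point of the segment along which they move. *)
Lemma orient_moving mu t i y z :
  (forall i j k, i != j -> j != k -> i != k -> mu <= `|orient (cv i) (cv j) (cv k)|) ->
  moving i -> 0 <= t <= 1 -> y != z -> ~~ moving y -> ~~ moving z ->
  0 < orient (cv y) (cv z) (cv i) * orient (cv y) (cv z) (pos t i) /\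
  mu <= `|orient (cv y) (cv z) (pos t i)|.
Proof.
move=> muP mi t01 yz my mz; have [th th01 E] := pos_seg mi t01.
have mv : moving v by rewrite /moving eqxx.
have mw : moving w by rewrite /moving eqxx orbT.
have neq (x y' : 'I_n) : moving x -> ~~ moving y' -> y' != x.
  by move=> mx my'; rewrite eq_sym moving_neq.
have la : mu <= `|orient (cv y) (cv z) a| by apply: muP => //; exact: neq.
have lb : mu <= `|orient (cv y) (cv z) b| by apply: muP => //; exact: neq.
have [p1 p2] := conv_same_sign (not_separated yz my mz) la lb th01.
rewrite E orient_seg; split=> //.
case/orP: mi => /eqP->//; move: p1 (not_separated yz my mz).
set X := orient _ _ a; set Y := orient _ _ b; set Z := _ + _ => XZ XY.
have : 0 < (X * Z) * (X * Y) by exact: mulr_gt0.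
by rewrite mulrACA -expr2 pmulr_rgt0 1?mulrC// exprn_even_gt0//=; apply: contraTneq XY => ->; rewrite mul0r ltxx.
Qed.

Lemma pos_meet t : pos t v = pos t w -> t = 1 / 2.
Proof.
rewrite /pos eqxx eq_sym (negPf vw) eqxx -[RHS]segC => /seg_inj E.
have : t = 1 - t by apply: E; rewrite (inj_eq (@cv_inj R n)).
by move=> h; lra.
Qed.

Lemma moving_meet t i j : moving i -> moving j -> i != j -> pos t i = pos t j ->
  [/\ t = 1 / 2, isvw i j & (lft t i = -1 /\ lft t j = 1) \/ (lft t i = 1 /\ lft t j = -1)].
Proof.
move=> /orP[]/eqP-> /orP[]/eqP->; rewrite ?eqxx// => ij E.
  have tE := pos_meet E; split=> //; first by rewrite /isvw !eqxx.
  by left; rewrite /lft eqxx eq_sym (negPf vw) eqxx tE; split; field.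
have tE := pos_meet (esym E); split=> //; first by rewrite /isvw !eqxx orbT.
by right; rewrite /lft eqxx eq_sym (negPf vw) eqxx tE; split; field.
Qed.

Lemma amp_half i j : isvw i j -> amp (1 / 2) i j = 0.
Proof.
by move=> ij; rewrite /amp ij (_ : 1 - 2 * (1 / 2) = 0) ?expr0n ?mul0r//; field.
Qed.

Lemma eq_pair (p q : R * R) : p.1 = q.1 -> p.2 = q.2 -> p = q.
Proof. by case: p q => [x y] [x' y'] /= -> ->. Qed.

(* The difference quotients of gpos along one edge, along two edges with a common
   vertex i, and between two disjoint edges never vanish. *)
Lemma same_edge_neq0 t i j sg rg : i != j -> 0 <= t <= 1 ->
  (pos t j).1 - (pos t i).1 = 0 -> (pos t j).2 - (pos t i).2 = 0 ->
  lft t j - lft t i + (1 - sg - rg) * amp t i j = 0 -> False.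
Proof.
move=> ij t01 /subr0_eq e1 /subr0_eq e2; have /esym E := eq_pair e1 e2.
have [mi|mi] := boolP (moving i); have [mj|mj] := boolP (moving j).
(* Only v and w can share a projection, at t = 1/2; the lifts then differ by 2, while the amplitude
   of the edge vw vanishes. *)
- have [tE iv h] := moving_meet mi mj ij E.
  by rewrite tE (amp_half iv) mulr0 addr0 -tE; case: h => -[-> ->]; lra.
- have := orient_ab_moving mi t01; rewrite E pos_fixed// => /eqP.
  by rewrite (negPf (orient_ab_neq0 mj)).
- have := orient_ab_moving mj t01; rewrite -E pos_fixed// => /eqP.
  by rewrite (negPf (orient_ab_neq0 mi)).
- by move: E; rewrite !pos_fixed// => /(@cv_inj R n)/eqP; rewrite (negPf ij).
Qed.

(** Vanishing of the quotient from [itp_share]. For rho = 0 it compares the initial directions of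
    the two arcs, scaled by al and 1 - al. *)
Definition rays_eq t rho al i j l : Prop :=
  [/\ al * ((pos t j).1 - (pos t i).1) = (1 - al) * ((pos t l).1 - (pos t i).1),
      al * ((pos t j).2 - (pos t i).2) = (1 - al) * ((pos t l).2 - (pos t i).2) &
      al * (lft t j - lft t i) - (1 - al) * (lft t l - lft t i) +
      (al * (1 - rho * al) * amp t i j - (1 - al) * (1 - rho * (1 - al)) * amp t i l) = 0].

Lemma rays_eqC t rho al i j l : rays_eq t rho al i j l -> rays_eq t rho (1 - al) i l j.
Proof.
rewrite /rays_eq (_ : 1 - (1 - al) = al); last by ring.
move=> [e1 e2 e3]; split; [exact: esym|exact: esym|].
by rewrite -[RHS]oppr0 -e3; ring.
Qed.

Lemma kap_gt0 t i j : i != j -> 0 <= t <= 1 -> 0 < kap t i j.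
Proof.
move=> ij /andP[t0 t1]; have [m m0 mP] := dist_lower.
have h1 := mP _ _ ij; have h2 : m <= d2 (tau i) (tau j) by apply: mP; rewrite (inj_eq perm_inj).
have k1 : (1 - t) * m <= (1 - t) * d2 i j by rewrite ler_wpM2l ?subr_ge0.
have k2 : t * m <= t * d2 (tau i) (tau j) by rewrite ler_wpM2l.
rewrite /kap; lra.
Qed.

Lemma isvwC i j : isvw i j = isvw j i.
Proof. by rewrite /isvw orbC (andbC (i == w)) (andbC (i == v)). Qed.

Lemma isvw_fixed i j : ~~ moving i -> isvw i j = false.
Proof. by rewrite negb_or /isvw => /andP[/negPf-> /negPf->]. Qed.

(** If [j] or [l] is fixed, the projected edges are independent, except that v, w and a fixed vertex
    reduce to a single edge. If [j], [l] are w, v, the projections coincide only at t = 1/2, and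
    then the edge of w is above in both lift and amplitude. *)
Lemma share_neq0 t rho al i j l : i != j -> i != l -> j != l ->
  0 <= t <= 1 -> 0 <= rho <= 2 -> 0 <= al <= 1 -> ~ rays_eq t rho al i j l.
Proof.
wlog mjl : j l al / moving j || ~~ moving l.
  move=> H ij il jl t01 r01 a01; have [mjl|] := boolP (moving j || ~~ moving l).
    exact: H mjl ij il jl t01 r01 a01.
  rewrite negb_or negbK => /andP[mj ml] /rays_eqC.
  by apply: H; rewrite ?ml// 1?eq_sym//; lra.
move=> ij il jl t01 /andP[r0 r1] /andP[a0 a1] E; have [e1 e2 e3] := E.
have [mu mu0 muP] := orient_lower.
have cvneq x y : x != y -> cv x = cv y -> False.
  by move=> xy /(@cv_inj R n)/eqP; rewrite (negPf xy).
have [ml|ml] := boolP (moving l); last first.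
  have [mj|mj] := boolP (moving j); last first.
    have o0 : orient (cv j) (cv l) (pos t i) != 0.
      have [mi|mi] := boolP (moving i).
        have [_ h] := orient_moving muP mi t01 jl mj ml.
        by rewrite -normr_gt0; exact: lt_le_trans h.
      by rewrite pos_fixed// orient_cv_neq0// eq_sym.
    have := orient_rays (cv j) (cv l) e1 e2; rewrite (pos_fixed t mj) (pos_fixed t ml).
    have [-> ->] := orientpp (cv j) (cv l); rewrite sub0r => /mulIf; rewrite oppr_eq0 => /(_ o0) h.
    have aE : al = 1 / 2 by lra.
    move: e1 e2; rewrite aE (pos_fixed t mj) (pos_fixed t ml) => e1 e2.
    by apply: (cvneq j l jl); apply: eq_pair; lra.
  have [mi|mi] := boolP (moving i).
    have := orient_rays a b e1 e2; rewrite (orient_ab_moving mi t01) (orient_ab_moving mj t01) (pos_fixed t ml).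
    rewrite !subr0 mulr0 => /esym/eqP; rewrite mulf_eq0 (negPf (orient_ab_neq0 ml)) orbF.
    rewrite subr_eq0 => /eqP/esym aE.
    apply: (@same_edge_neq0 t i j rho 0 ij t01).
    - by move: e1; rewrite aE; lra.
    - by move: e2; rewrite aE; lra.
    - by move: e3; rewrite aE; lra.
  have o0 : orient (cv i) (cv l) (pos t j) != 0.
    have [_ h] := orient_moving muP mj t01 il mi ml.
    by rewrite -normr_gt0; exact: lt_le_trans h.
  have := orient_rays (cv i) (cv l) e1 e2; rewrite (pos_fixed t mi) (pos_fixed t ml).
  have [-> ->] := orientpp (cv i) (cv l); rewrite !subr0 mulr0 => /eqP.
  rewrite mulf_eq0 (negPf o0) orbF => /eqP aE.
  move: e1 e2; rewrite aE (pos_fixed t mi) (pos_fixed t ml) => e1 e2.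
  by apply: (cvneq i l il); apply: eq_pair; lra.
have mj : moving j by move: mjl; rewrite ml orbF.
wlog jw : j l al ij il jl a0 a1 E e1 e2 e3 ml mj mjl / j = w.
  move=> H; have [jw|jw] := eqVneq j w; first exact: (H j l al).
  have lw : l = w.
    move: mj ml jl; rewrite /moving (negPf jw) orbF => /eqP->.
    by move=> /orP[]/eqP->//; rewrite eqxx.
  have E' := rays_eqC E; have [e1' e2' e3'] := E'.
  have lj : l != j by rewrite eq_sym.
  have b0 : 0 <= 1 - al by lra.
  have b1 : 1 - al <= 1 by lra.
  have mlj : moving l || ~~ moving j by rewrite ml.
  exact: (H l j (1 - al) il ij lj b0 b1 E' e1' e2' e3' mj ml mlj lw).
have lv : l = v.
  by move: ml jl; rewrite jw => /orP[]/eqP->//; rewrite eqxx.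
have mi : ~~ moving i.
  by rewrite negb_or -jw -lv il ij.
have := orient_rays a b e1 e2; rewrite (orient_ab_moving mj t01) (orient_ab_moving ml t01) (pos_fixed t mi) !sub0r.
move/mulIf; rewrite oppr_eq0 => /(_ (orient_ab_neq0 mi)) h.
have aE : al = 1 / 2 by lra.
have E1 : pos t j = pos t l by move: e1 e2; rewrite aE => e1 e2; apply: eq_pair; lra.
have tE : t = 1 / 2 by apply: pos_meet; rewrite -lv -jw E1.
have li : lft t i = 0 by exact: lft_fixed.
have lj : lft t j = 1 by rewrite /lft jw eq_sym (negPf vw) eqxx tE; field.
have ll : lft t l = -1 by rewrite /lft lv eqxx tE; field.
have kE : kap t i j = kap t i l.
  rewrite /kap jw lv /tau tpermL tpermR (tpermD (z := i)).
    by rewrite tE; field.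
    by rewrite eq_sym; move: mi; rewrite negb_or => /andP[].
  by rewrite eq_sym; move: mi; rewrite negb_or => /andP[].
have cjl : c (B [set i; l]%SET) <= c (B [set i; j]%SET).
  have h1 := w_above_v mi mi; have h2 := c_gap h1.
  rewrite jw lv finset.setUC [[set i; w]%SET]finset.setUC; apply: le_trans h2.
  by rewrite ler_peMl// (le_trans ler01)// c_ge1.
have k0 := kap_gt0 il t01.
(* The lifts contribute 1 and the amplitudes a nonnegative amount, so the sum is not 0. *)
move: e3; rewrite li lj ll aE /amp !isvw_fixed// kE.
set X := kap t i l in k0 *; set Y := c (B [set i; j]%SET) in cjl *; set Z := c (B [set i; l]%SET) in cjl *.
have h1 : 0 <= (1 - rho / 2) * ((Y - Z) * X).
  by rewrite mulr_ge0 ?mulr_ge0 ?subr_ge0 ?(ltW k0)//; lra.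
lra.
Qed.

Lemma gpos_eq t i j k l sg rg : gpos t i j sg = gpos t k l rg ->
  seg (pos t i) (pos t j) sg = seg (pos t k) (pos t l) rg /\
  itp (lft t i) (lft t j) (amp t i j) sg = itp (lft t k) (lft t l) (amp t k l) rg.
Proof.
move=> E; have e1 := congr1 (fun X : V => X.1.1) E; have e2 := congr1 (fun X : V => X.1.2) E.
have e3 := congr1 (fun X : V => X.2) E; move: e1 e2; rewrite /gpos /itp /= !mulr0 !addr0 => e1 e2.
by split=> //; rewrite /seg e1 e2.
Qed.

Lemma kap_le t i j : 0 <= t <= 1 -> kap t i j <= 4.
Proof.
move=> /andP[t0 t1]; rewrite /kap.
have h1 : (1 - t) * d2 i j <= (1 - t) * 4 by rewrite ler_wpM2l ?subr_ge0// d2_le.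
have h2 : t * d2 (tau i) (tau j) <= t * 4 by rewrite ler_wpM2l// d2_le.
lra.
Qed.

Lemma kap_ge m t i j : (forall i j, i != j -> m <= d2 i j) -> i != j -> 0 <= t <= 1 ->
  m <= kap t i j.
Proof.
move=> mP ij /andP[t0 t1]; rewrite /kap.
have h1 : (1 - t) * m <= (1 - t) * d2 i j by rewrite ler_wpM2l ?subr_ge0// mP.
have h2 : t * m <= t * d2 (tau i) (tau j) by rewrite ler_wpM2l// mP// (inj_eq perm_inj).
lra.
Qed.

Lemma lft_le t i : 0 <= t <= 1 -> `|lft t i| <= 1.
Proof.
move=> /andP[t0 t1]; have h : `|4 * t * (1 - t)| <= 1.
  rewrite ger0_norm ?mulr_ge0 ?subr_ge0// -subr_ge0.
  by rewrite (_ : _ - _ = (1 - 2 * t) ^+ 2) ?sqr_ge0//; ring.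
by rewrite /lft; case: ifP => _; [rewrite normrN|case: ifP => _; rewrite ?normr0].
Qed.

Lemma quarter_le (x : R) : 0 <= x <= 1 -> 0 <= x * (1 - x) <= 1 / 4.
Proof.
move=> /andP[x0 x1]; rewrite mulr_ge0 ?subr_ge0//= -subr_ge0.
by rewrite (_ : _ - _ = (1 / 2 - x) ^+ 2) ?sqr_ge0//; field.
Qed.

(** With both parameters at least mu/16, the higher edge rises by at least c2 K m mu^2 / 256. The
    lower edge rises at most c2 and the lift costs at most 1 <= c2, so anything above 2 * 256
    suffices for K m mu^2; hence 513. The 8 is the bound of [orient_le]. *)
Lemma height_gap (mu m c1 c2 k1 k2 l1 sg rg : R) : 0 < mu -> 0 < m -> 513 <= K * m * mu ^+ 2 ->
  1 <= c2 -> K * c2 <= c1 -> m <= k1 -> k2 <= 4 -> 0 <= k2 -> `|l1| <= 1 -> 0 <= rg <= 1 ->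
  mu / (2 * 8) <= sg -> mu / (2 * 8) <= 1 - sg ->
  l1 + sg * (1 - sg) * (c1 * k1) != rg * (1 - rg) * (c2 * k2).
Proof.
move=> mu0 m0 KL c21 cc k1m k24 k20 l11 rg01 sg1 sg2; apply/eqP => E.
have D0 : 0 < mu / (2 * 8) by rewrite divr_gt0.
have c20 : 0 <= c2 by exact: le_trans c21.
have K0 : 0 <= K by exact: le_trans K1.
have h1 : mu / (2 * 8) * (mu / (2 * 8)) <= sg * (1 - sg) by apply: ler_pM => //; exact: ltW.
have h2 : K * c2 * m <= c1 * k1 by apply: ler_pM => //; [rewrite mulr_ge0|exact: ltW].
have h3 : mu / (2 * 8) * (mu / (2 * 8)) * (K * c2 * m) <= sg * (1 - sg) * (c1 * k1).
  by apply: ler_pM => //; rewrite !mulr_ge0// ltW.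
have h4 : mu / (2 * 8) * (mu / (2 * 8)) * (K * c2 * m) = c2 * (K * m * mu ^+ 2) / 256 by field.
have h5 : c2 * 513 <= c2 * (K * m * mu ^+ 2) by rewrite ler_wpM2l.
have /andP[q0 q1] := quarter_le rg01.
have h6 : rg * (1 - rg) * (c2 * k2) <= 1 / 4 * (c2 * 4).
  by apply: ler_pM => //; [rewrite mulr_ge0|rewrite ler_wpM2l].
move: l11; rewrite ler_norml => /andP[? ?]; lra.
Qed.

Section Disjoint.
Variables (mu m : R).
Hypothesis mu0 : 0 < mu.
Hypothesis m0 : 0 < m.
Hypothesis muP : forall i j k, i != j -> j != k -> i != k ->
  mu <= `|orient (cv i) (cv j) (cv k)|.
Hypothesis mP : forall i j, i != j -> m <= d2 i j.
Hypothesis K_large : 513 <= K * m * mu ^+ 2.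

Lemma c_gap_or (k l : 'I_s) : k != l -> K * c l <= c k \/ K * c k <= c l.
Proof.
by rewrite -val_eqE /= neq_ltn => /orP[] /c_gap; [left|right].
Qed.

Lemma moving_orient_bounds t i y z : moving i -> 0 <= t <= 1 -> y != z ->
  ~~ moving y -> ~~ moving z -> mu <= `|orient (cv y) (cv z) (pos t i)| <= 8.
Proof.
move=> mi t01 yz my mz; have [_ ->] := orient_moving muP mi t01 yz my mz.
by rewrite orient_le ?cv_norm2 ?pos_disk.
Qed.

(** Orientations do not change sign during the motion, so edges whose projections meet at some time
    cross from the start. They then lie in different sheets, and the crossing is far from their
    ends, so [height_gap] applies to the higher one. *)
Lemma disjoint_one_neq t i j k l sg rg : moving i -> ~~ moving j -> ~~ moving k -> ~~ moving l ->
  j != k -> j != l -> k != l -> 0 <= t <= 1 -> 0 <= sg <= 1 -> 0 <= rg <= 1 ->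
  gpos t i j sg <> gpos t k l rg.
Proof.
move=> mi mj mk ml jk jl kl t01 sg01 rg01 /gpos_eq[E Ez].
have kj : k != j by rewrite eq_sym. have lj : l != j by rewrite eq_sym.
have [ij ik il] : [/\ i != j, i != k & i != l] by split; exact: moving_neq.
have bA := moving_orient_bounds mi t01 kl mk ml.
have bB : mu <= `|orient (cv k) (cv l) (cv j)| <= 8.
  by rewrite muP//= orient_le ?cv_norm2.
have E1 : (1 - sg) * orient (cv k) (cv l) (pos t i) + sg * orient (cv k) (cv l) (cv j) = 0.
  rewrite -(pos_fixed t mj) -orient_seg E !pos_fixed// orient_seg.
  by have [-> ->] := orientpp (cv k) (cv l); rewrite !mulr0 addr0.
have [AB s1 s2] := affine_zero_bounds mu0 bA bB sg01 E1.
have bC : mu <= `|orient (pos t i) (cv j) (cv k)| <= 8.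
  by rewrite -orient_rot; exact: moving_orient_bounds.
have bD : mu <= `|orient (pos t i) (cv j) (cv l)| <= 8.
  by rewrite -orient_rot; exact: moving_orient_bounds.
have E2 : (1 - rg) * orient (pos t i) (cv j) (cv k) + rg * orient (pos t i) (cv j) (cv l) = 0.
  rewrite -orient_seg -(pos_fixed t mk) -(pos_fixed t ml) -E (pos_fixed t mj) orient_seg.
  by have [-> ->] := orientpp (pos t i) (cv j); rewrite !mulr0 addr0.
have [_ r1 r2] := affine_zero_bounds mu0 bC bD rg01 E2.
have [oA _] := orient_moving muP mi t01 kl mk ml.
have cr : crossing [set k; l]%SET [set i; j]%SET.
  apply/(@crossing_orient R); exists k, l, i, j; split=> //.
  exact: sign_chain oA AB.
have nB : B [set i; j]%SET != B [set k; l]%SET.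
  by apply: contraPneq cr => Bij; apply: ncB => //; rewrite edge_set2.
move: Ez; rewrite (lft_fixed t mj) (lft_fixed t mk) (lft_fixed t ml) /itp !mulr0 !addr0 add0r.
rewrite /amp (isvw_fixed l mk) isvwC (isvw_fixed i mj).
have k1 := kap_ge mP ij t01; have k2 := kap_ge mP kl t01.
have k1' := kap_le i j t01; have k2' := kap_le k l t01.
have k10 : 0 <= kap t i j by apply: le_trans k1; exact: ltW.
have k20 : 0 <= kap t k l by apply: le_trans k2; exact: ltW.
have s01 : 0 <= 1 - sg <= 1 by lra.
have hl : `|(1 - sg) * lft t i| <= 1 by apply: prod_le1 => //; exact: lft_le.
have [gap|gap] := c_gap_or nB.
  apply/eqP; exact: (height_gap mu0 m0 K_large (c_ge1 _) gap k1 k2' k20 hl rg01 s1 s2).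
move=> Ez; have hl' : `|- ((1 - sg) * lft t i)| <= 1 by rewrite normrN.
have /eqP := height_gap mu0 m0 K_large (c_ge1 _) gap k2 k1' k10 hl' sg01 r1 r2.
by apply; rewrite -Ez addKr.
Qed.

Lemma disjoint_pair_neq t i j k l sg rg : moving i -> moving j -> ~~ moving k -> ~~ moving l ->
  0 <= t <= 1 -> 0 <= rg <= 1 -> gpos t i j sg <> gpos t k l rg.
Proof.
move=> mi mj mk ml t01 rg01 /gpos_eq[E _].
have := congr1 (orient a b) E; rewrite !orient_seg (orient_ab_moving mi t01).
rewrite (orient_ab_moving mj t01) !mulr0 addr0 (pos_fixed t mk) (pos_fixed t ml) => Z.
have := conv_same_sign (same_side mk ml) (normr_ge0 _) (normr_ge0 _) rg01.
by move=> [+ _]; rewrite -Z mulr0 ltxx.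
Qed.

(** The projected edges may meet at their ends, when v passes w, so the parameters have no positive
    lower bound. They are however comparable, rg mu <= 8 sg, and the heights are compared in
    multiples of rg. *)
Lemma disjoint_two_neq t x y sg rg : ~~ moving x -> ~~ moving y -> x != y ->
  0 <= t <= 1 -> 0 <= sg <= 1 -> 0 <= rg <= 1 -> gpos t w x sg <> gpos t v y rg.
Proof.
move=> mx my xy t01 sg01 rg01 /gpos_eq[E Ez].
have mv : moving v by rewrite /moving eqxx.
have mw : moving w by rewrite /moving eqxx orbT.
have yx : y != x by rewrite eq_sym.
have wx := moving_neq mw mx; have vy := moving_neq mv my.
case/andP: (sg01) => s0 s1; case/andP: (rg01) => r0 r1; case/andP: (t01) => t0 t1.
have E1 : sg * orient a b (cv x) = rg * orient a b (cv y).
  have := congr1 (orient a b) E; rewrite !orient_seg (orient_ab_moving mv t01).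
  by rewrite (orient_ab_moving mw t01) !mulr0 !add0r (pos_fixed t mx) (pos_fixed t my).
have sr : rg * mu <= sg * 8.
  have : sg * `|orient a b (cv x)| = rg * `|orient a b (cv y)|.
    by rewrite -{1}(ger0_norm s0) -normrM E1 normrM (ger0_norm r0).
  have h1 : sg * `|orient a b (cv x)| <= sg * 8.
    by rewrite ler_wpM2l// orient_le ?cv_norm2.
  have h2 : rg * mu <= rg * `|orient a b (cv y)|.
    by rewrite ler_wpM2l// muP// moving_neq.
  lra.
have bX : mu <= `|orient (pos t v) (cv y) (cv x)| <= 8.
  by rewrite -orient_rot; exact: moving_orient_bounds.
have s2 : mu / (2 * 8) <= 1 - sg.
  have : (1 - sg) * orient (pos t v) (cv y) (pos t w) + sg * orient (pos t v) (cv y) (cv x) = 0.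
    rewrite -(pos_fixed t mx) -orient_seg E (pos_fixed t my) orient_seg.
    by have [-> ->] := orientpp (pos t v) (cv y); rewrite !mulr0 addr0.
  move/eqP; rewrite addr_eq0 => /eqP/(congr1 Num.norm); rewrite normrN !normrM.
  rewrite (ger0_norm s0) ger0_norm ?subr_ge0// => EN.
  case/andP: bX => bX1 bX2.
  have h1 : (1 - sg) * `|orient (pos t v) (cv y) (pos t w)| <= (1 - sg) * 8.
    by rewrite ler_wpM2l ?subr_ge0// orient_le ?cv_norm2 ?pos_disk.
  have h2 : sg * mu <= sg * `|orient (pos t v) (cv y) (cv x)| by rewrite ler_wpM2l.
  have h3 : (1 - sg) * mu <= (1 - sg) * 8 by rewrite ler_wpM2l ?subr_ge0//; lra.
  rewrite ler_pdivrMr//; lra.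
have gap : K * c (B [set v; y]%SET) <= c (B [set w; x]%SET).
  exact: c_gap (w_above_v my mx).
move: Ez; rewrite (lft_fixed t mx) (lft_fixed t my) /itp !mulr0 !addr0.
rewrite /amp isvwC (isvw_fixed w mx) isvwC (isvw_fixed v my).
have k1 := kap_ge mP wx t01; have k2' := kap_le v y t01.
set c1 := c (B [set w; x]%SET) in gap *; set c2 := c (B [set v; y]%SET) in gap *.
set k1_ := kap t w x in k1 *; set k2_ := kap t v y in k2' *.
have lw : lft t w = 4 * t * (1 - t) by rewrite /lft eq_sym (negPf vw) eqxx.
have lv : lft t v = - (4 * t * (1 - t)) by rewrite /lft eqxx.
rewrite lw lv; set ell := 4 * t * (1 - t).
have ell0 : 0 <= ell by rewrite /ell !mulr_ge0// subr_ge0.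
move=> Ez; have K0 : 0 <= K by exact: le_trans K1.
have c2_1 : 1 <= c2 by exact: c_ge1.
have c2_0 : 0 <= c2 by exact: le_trans c2_1.
have D0 : 0 <= mu / (2 * 8) by rewrite divr_ge0 ?(ltW mu0).
have h1 : rg * mu / 8 * (mu / (2 * 8)) <= sg * (1 - sg).
  apply: ler_pM => //; first by rewrite divr_ge0// mulr_ge0// ltW.
  by rewrite ler_pdivrMr.
have h2 : K * c2 * m <= c1 * k1_ by apply: ler_pM => //; [rewrite mulr_ge0|exact: ltW].
have h3 : rg * mu / 8 * (mu / (2 * 8)) * (K * c2 * m) <= sg * (1 - sg) * (c1 * k1_).
  by apply: ler_pM => //; rewrite !mulr_ge0// ?invr_ge0// ltW.
have h4 : rg * mu / 8 * (mu / (2 * 8)) * (K * c2 * m) = rg * c2 * (K * m * mu ^+ 2) / 128 by field.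
have rc0 : 0 <= rg * c2 by rewrite mulr_ge0.
have h5 : rg * c2 * 513 <= rg * c2 * (K * m * mu ^+ 2) by rewrite ler_wpM2l.
have h6 : rg * (1 - rg) * (c2 * k2_) <= rg * c2 * 4.
  rewrite (_ : _ * (c2 * k2_) = (1 - rg) * (rg * c2 * k2_)); last by ring.
  have : rg * c2 * k2_ <= rg * c2 * 4 by rewrite ler_wpM2l.
  move=> h; apply: le_trans h; apply: ler_piMl; last by lra.
  by rewrite mulr_ge0//; apply: le_trans (kap_ge mP vy t01); exact: ltW.
have g1 : 0 <= (1 - sg) * ell by rewrite mulr_ge0// subr_ge0.
have g2 : 0 <= (1 - rg) * ell by rewrite mulr_ge0// subr_ge0.
(* The rise of the edge at w is at least 513/128 times rg c2, that of the edge at v at most 4 times.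
   Only the common end at t = 1/2 remains, where the lifts differ. *)
have rcz : rg * c2 = 0 by lra.
have rz : rg = 0.
  by move/eqP: rcz; rewrite mulf_eq0 => /orP[/eqP//|/eqP c2z]; move: c2_1; rewrite c2z; lra.
have sz : sg = 0.
  move: E1; rewrite rz mul0r => /eqP; rewrite mulf_eq0 (negPf (orient_ab_neq0 mx)) orbF.
  by move/eqP.
have tE : t = 1 / 2 by apply: pos_meet; move: E; rewrite rz sz !seg0.
move: Ez; rewrite rz sz /ell tE; lra.
Qed.

(** * Relative velocity of points on pairs of edges *)

Lemma seg_lip (p q : R * R) t u : norm2 p <= 1 -> norm2 q <= 1 ->
  `|(seg p q u).1 - (seg p q t).1| <= 4 * `|u - t| /\
  `|(seg p q u).2 - (seg p q t).2| <= 4 * `|u - t|.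
Proof.
move=> /disk_coord[p1 p2] /disk_coord[q1 q2].
have E (x y : R) : (1 - u) * x + u * y - ((1 - t) * x + t * y) = (y - x) * (u - t) by ring.
rewrite /seg /= !E !normrM; split; apply: ler_wpM2r => //; apply: (le_trans (ler_normB _ _)); lra.
Qed.

Lemma pos_lip t u i : `|(pos u i).1 - (pos t i).1| <= 4 * `|u - t| /\
  `|(pos u i).2 - (pos t i).2| <= 4 * `|u - t|.
Proof.
rewrite /pos; case: ifP => _; first by apply: seg_lip; rewrite cv_norm2.
case: ifP => _; first by apply: seg_lip; rewrite cv_norm2.
by rewrite !subrr normr0 mulr_ge0.
Qed.

Lemma lft_lip t u i : 0 <= t <= 1 -> 0 <= u <= 1 -> `|lft u i - lft t i| <= 4 * `|u - t|.
Proof.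
move=> /andP[t0 t1] /andP[u0 u1].
have h : `|4 * u * (1 - u) - 4 * t * (1 - t)| <= 4 * `|u - t|.
  rewrite (_ : _ - _ = 4 * ((1 - u - t) * (u - t))); last by ring.
  rewrite normrM ger0_norm// ler_wpM2l// normrM ler_piMl// ler_norml.
  by apply/andP; split; lra.
rewrite /lft; case: ifP => _; first by rewrite -opprD normrN.
by case: ifP => _; rewrite ?subrr ?normr0 ?mulr_ge0.
Qed.

Lemma amp_lip i j : exists2 C, 0 <= C & forall t u, 0 <= t <= 1 -> 0 <= u <= 1 ->
  `|amp u i j - amp t i j| <= C * `|u - t|.
Proof.
have [ij|/negPf ij] := boolP (isvw i j).
  pose al := c (B [set v; w]%SET); pose be := c (B' [set v; w]%SET);
  exists (5 * (`|al| + `|be|) * d2 v w).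
    by rewrite !mulr_ge0 ?d2_ge0// addr_ge0.
  move=> t u /andP[t0 t1] /andP[u0 u1]; rewrite /amp ij -/al -/be.
  rewrite -mulrBl normrM (ger0_norm (d2_ge0 v w)).
  rewrite [leRHS]mulrAC ler_wpM2r ?d2_ge0//.
  rewrite (_ : _ - _ = 4 * ((u + t - 1) * ((1 - u) * al + u * be)) * (u - t)
    + (1 - 2 * t) ^+ 2 * (be - al) * (u - t)); last by ring.
  apply: (le_trans (ler_normD _ _)); rewrite normrM.
  rewrite [X in _ + X]normrM -mulrDl; apply: ler_wpM2r => //.
  have h1 : `|(1 - u) * al + u * be| <= `|al| + `|be|.
    apply: (le_trans (ler_normD _ _)); apply: lerD; apply: prod_le1 => //; lra.
  have h2 : `|(1 - 2 * t) ^+ 2 * (be - al)| <= `|al| + `|be|.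
    apply: prod_le1; last by rewrite [leRHS]addrC; exact: ler_normB.
    rewrite sqr_ge0 /= -subr_ge0 [X in 0 <= X](_ : _ = 4 * (t * (1 - t))); last by ring.
    by rewrite !mulr_ge0// subr_ge0.
  have h3 : `|(u + t - 1) * ((1 - u) * al + u * be)| <= `|al| + `|be|.
    rewrite normrM -[leRHS]mul1r; apply: ler_pM => //; rewrite ler_norml.
    by apply/andP; split; lra.
  rewrite normrM ger0_norm//; lra.
exists (c (B [set i; j]%SET) * `|d2 (tau i) (tau j) - d2 i j|).
  by rewrite mulr_ge0// (le_trans ler01)// c_ge1.
move=> t u _ _; rewrite /amp ij /kap.
rewrite (_ : _ - _ = c (B [set i; j]%SET) * (d2 (tau i) (tau j) - d2 i j) * (u - t)); last by ring.
rewrite 2!normrM (@ger0_norm _ (c _))// (le_trans ler01)// c_ge1//.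
Qed.

Section Continuity.
Variables (T : topologicalType) (f : T -> R) (x : T).
Hypothesis cf : cont_at f x.

Lemma cont_itp (p q c0 sg : T -> R) : cont_at p x -> cont_at q x -> cont_at c0 x ->
  cont_at sg x -> cont_at (fun y => itp (p y) (q y) (c0 y) (sg y)) x.
Proof. by move=> cp cq cc cs; rewrite /itp; cont. Qed.

Lemma cont_pos i : cont_at (fun y => (pos (f y) i).1) x /\ cont_at (fun y => (pos (f y) i).2) x.
Proof. by rewrite /pos; case: (i == v); [|case: (i == w)]; rewrite /seg /=; split; cont. Qed.

Lemma cont_lft i : cont_at (fun y => lft (f y) i) x.
Proof. by rewrite /lft; case: (i == v); [|case: (i == w)]; cont. Qed.

Lemma cont_amp i j : cont_at (fun y => amp (f y) i j) x.
Proof. by rewrite /amp /kap; case: (isvw i j); cont. Qed.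

End Continuity.

(** The hypothesis of [lipschitz_motion_isotopy] for one pair of edges. *)
Definition lip_pair i j k l : Prop := exists2 M, 0 <= M &
  forall t u sg rg, 0 <= t <= 1 -> 0 <= u <= 1 -> 0 <= sg <= 1 -> 0 <= rg <= 1 ->
    `|(gpos u i j sg - gpos t i j sg) - (gpos u k l rg - gpos t k l rg)| <=
      M * `|u - t| * `|gpos t i j sg - gpos t k l rg|.

Lemma ampC t i j : amp t i j = amp t j i.
Proof.
have ij : [set i; j]%SET = [set j; i]%SET by rewrite finset.setUC.
by rewrite /amp isvwC ij /kap (d2C i) (d2C (tau i)).
Qed.

Lemma gposC t i j sg : gpos t j i (1 - sg) = gpos t i j sg.
Proof. by rewrite /gpos !itpC ampC. Qed.

Lemma lip_pair_swap i j k l : lip_pair i j k l -> lip_pair j i k l.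
Proof.
move=> [M M0 H]; exists M => // t u sg rg t01 u01 s01 r01.
rewrite -!(gposC _ j i); apply: H => //; lra.
Qed.

Lemma lip_pair_sym i j k l : lip_pair i j k l -> lip_pair k l i j.
Proof.
move=> [M M0 H]; exists M => // t u sg rg t01 u01 s01 r01.
by rewrite distrC (distrC (gpos t k l _)); exact: H.
Qed.

Lemma lip_pair_swapr i j k l : lip_pair i j k l -> lip_pair i j l k.
Proof. by move=> /lip_pair_sym/lip_pair_swap/lip_pair_sym. Qed.

Lemma itp_diff_coord (x y : V) : [/\ (x - y).1.1 = x.1.1 - y.1.1,
  (x - y).1.2 = x.1.2 - y.1.2 & (x - y).2 = x.2 - y.2].
Proof. by case: x y => [[? ?] ?] [[? ?] ?]. Qed.

Lemma motion_le i j k l t u sg rg (X : R) :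
  `|(itp ((pos u i).1 - (pos t i).1) ((pos u j).1 - (pos t j).1) 0 sg) -
    (itp ((pos u k).1 - (pos t k).1) ((pos u l).1 - (pos t l).1) 0 rg)| <= X ->
  `|(itp ((pos u i).2 - (pos t i).2) ((pos u j).2 - (pos t j).2) 0 sg) -
    (itp ((pos u k).2 - (pos t k).2) ((pos u l).2 - (pos t l).2) 0 rg)| <= X ->
  `|(itp (lft u i - lft t i) (lft u j - lft t j) (amp u i j - amp t i j) sg) -
    (itp (lft u k - lft t k) (lft u l - lft t l) (amp u k l - amp t k l) rg)| <= X ->
  `|(gpos u i j sg - gpos t i j sg) - (gpos u k l rg - gpos t k l rg)| <= X.
Proof.
move=> h1 h2 h3; rewrite norm3_le; have [-> -> ->] := itp_diff_coord
  (gpos u i j sg - gpos t i j sg) (gpos u k l rg - gpos t k l rg).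
have [-> -> ->] := itp_diff_coord (gpos u i j sg) (gpos t i j sg).
have [-> -> ->] := itp_diff_coord (gpos u k l rg) (gpos t k l rg).
by rewrite /gpos /= !itpB subr0; apply/and3P.
Qed.

(** Both the relative displacement and the distance contain the factor |sg - rg|; what remains of
    the distance is bounded below by compactness. *)
Lemma lip_same i j : i != j -> lip_pair i j i j.
Proof.
move=> ij; have [C C0 CP] := amp_lip i j.
pose f (X : V) : V := ((pos X.1.1 j).1 - (pos X.1.1 i).1, (pos X.1.1 j).2 - (pos X.1.1 i).2,
  lft X.1.1 j - lft X.1.1 i + (1 - X.1.2 - X.2) * amp X.1.1 i j).
have cX (X : V) : cont_at (fun X : V => X.1.1) X by cont.
have [|||||m' m'0 m'P] := @nonvanishing_lower R f 1; last 1 first.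
- exists ((8 + C) / m'); first by rewrite divr_ge0 ?ltW//; lra.
  move=> t u sg rg t01 u01 s01 r01.
  have E : gpos t i j sg - gpos t i j rg = (sg - rg) *: f (t, sg, rg).
    rewrite /f /=; have [e1 e2 e3] := itp_diff_coord (gpos t i j sg) (gpos t i j rg).
    rewrite [LHS]surjective_pairing [X in (X, _)]surjective_pairing e1 e2 e3 /gpos /= !itp_same.
    by rewrite !mulr0 !addr0.
  have lowf := m'P (t, sg, rg) t01 s01 r01.
  have [p1 p1'] := pos_lip t u i; have [p2 p2'] := pos_lip t u j.
  have l1 := lft_lip i t01 u01; have l2 := lft_lip j t01 u01.
  have a1 := CP t u t01 u01.
  have k1 : 0 <= C * `|u - t| by rewrite mulr_ge0.
  have kk : 0 <= `|sg - rg| * `|u - t| by rewrite mulr_ge0.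
  apply: (@le_trans _ _ (`|sg - rg| * (2 * (4 * `|u - t|) + C * `|u - t|))).
    apply: motion_le.
    + by apply: itp_same_le => //; rewrite normr0.
    + by apply: itp_same_le => //; rewrite normr0.
    + exact: itp_same_le.
  rewrite E normrZ (_ : _ * (_ + _) = (8 + C) * `|u - t| * `|sg - rg|); last by ring.
  rewrite -!mulrA; apply: ler_wpM2l; first lra.
  rewrite ler_pdivlMl// !mulrA (mulrC m') -!mulrA ler_wpM2l//.
  by rewrite (mulrC m') ler_wpM2l.
- move=> X; have [c1 _] := cont_pos (cX X) i; have [c2 _] := cont_pos (cX X) j.
  by rewrite /f /=; cont.
- move=> X; have [_ c1] := cont_pos (cX X) i; have [_ c2] := cont_pos (cX X) j.
  by rewrite /f /=; cont.
- move=> X; have c1 := @cont_lft _ _ _ (cX X) i; have c2 := @cont_lft _ _ _ (cX X) j.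
  by have c3 := @cont_amp _ _ _ (cX X) i j; rewrite /f /=; cont.
- move=> [[t sg] rg] /= t01 _ _ [e1 e2 e3]; exact: (same_edge_neq0 ij t01 e1 e2 e3).
- by [].
Qed.

(** The factor in common is now sg + rg, which measures the distance from the shared vertex. *)
Lemma lip_share i j l : i != j -> i != l -> j != l -> lip_pair i j i l.
Proof.
move=> ij il jl; have [C C0 CP] := amp_lip i j; have [C' C0' CP'] := amp_lip i l.
pose f (X : V) : V :=
  (X.2 * ((pos X.1.1 j).1 - (pos X.1.1 i).1) - (1 - X.2) * ((pos X.1.1 l).1 - (pos X.1.1 i).1),
   X.2 * ((pos X.1.1 j).2 - (pos X.1.1 i).2) - (1 - X.2) * ((pos X.1.1 l).2 - (pos X.1.1 i).2),
   X.2 * (lft X.1.1 j - lft X.1.1 i) - (1 - X.2) * (lft X.1.1 l - lft X.1.1 i) +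
   (X.2 * (1 - X.1.2 * X.2) * amp X.1.1 i j
    - (1 - X.2) * (1 - X.1.2 * (1 - X.2)) * amp X.1.1 i l)).
have cX (X : V) : cont_at (fun X : V => X.1.1) X by cont.
have [|||||m' m'0 m'P] := @nonvanishing_lower R f 2; last 1 first.
- exists ((8 + C + C') / m'); first by rewrite divr_ge0 ?(ltW m'0)//; lra.
  move=> t u sg rg t01 u01 s01 r01.
  have [p1 p1'] := pos_lip t u i; have [p2 p2'] := pos_lip t u j.
  have [p3 p3'] := pos_lip t u l.
  have l1 := lft_lip i t01 u01; have l2 := lft_lip j t01 u01; have l3 := lft_lip l t01 u01.
  have a1 := CP t u t01 u01; have a2 := CP' t u t01 u01.
  have k1 : 0 <= C * `|u - t| by rewrite mulr_ge0.
  have k2 : 0 <= C' * `|u - t| by rewrite mulr_ge0.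
  case/andP: (s01) => s0 s1; case/andP: (r01) => r0 r1.
  have sr0 : 0 <= sg + rg by rewrite addr_ge0.
  apply: (@le_trans _ _ ((sg + rg) * (2 * (4 * `|u - t|) + C * `|u - t| + C' * `|u - t|))).
    apply: motion_le.
    + by apply: itp_share_le => //; rewrite normr0.
    + by apply: itp_share_le => //; rewrite normr0.
    + exact: itp_share_le.
  rewrite (_ : _ * (_ + _) = (8 + C + C') * `|u - t| * (sg + rg)); last by ring.
  rewrite -[leRHS]mulrA -[leRHS]mulrA -mulrA; apply: ler_wpM2l; first lra.
  rewrite ler_pdivlMl// !mulrA (mulrC m') -!mulrA ler_wpM2l//.
  have [z|nz] := eqVneq (sg + rg) 0; first by rewrite z mulr0.
  have rp : 0 < sg + rg by rewrite lt_def nz.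
  pose al := sg / (sg + rg).
  have al01 : 0 <= al <= 1 by rewrite divr_ge0//= ler_pdivrMr// mul1r lerDl.
  have E : gpos t i j sg - gpos t i l rg = (sg + rg) *: f (t, sg + rg, al).
    have sE : sg = (sg + rg) * al by rewrite /al mulrC mulfVK.
    have rE : rg = (sg + rg) * (1 - al) by rewrite mulrBr -sE mulr1 addrC addKr.
    rewrite {1}sE {2}rE /f /=; set ro := sg + rg.
    have [e1 e2 e3] := itp_diff_coord (gpos t i j (ro * al)) (gpos t i l (ro * (1 - al))).
    rewrite [LHS]surjective_pairing [X in (X, _)]surjective_pairing e1 e2 e3 /gpos /= !itp_share.
    by rewrite !mulr0 !subrr !addr0.
  have r2 : 0 <= sg + rg <= 2 by lra.
  have lowf := m'P (t, sg + rg, al) t01 r2 al01.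
  by rewrite E normrZ (ger0_norm sr0) mulrC ler_wpM2l.
- move=> X; have [c1 _] := cont_pos (cX X) i; have [c2 _] := cont_pos (cX X) j.
  by have [c3 _] := cont_pos (cX X) l; rewrite /f /=; cont.
- move=> X; have [_ c1] := cont_pos (cX X) i; have [_ c2] := cont_pos (cX X) j.
  by have [_ c3] := cont_pos (cX X) l; rewrite /f /=; cont.
- move=> X; have c1 := @cont_lft _ _ _ (cX X) i; have c2 := @cont_lft _ _ _ (cX X) j.
  have c3 := @cont_lft _ _ _ (cX X) l; have c4 := @cont_amp _ _ _ (cX X) i j.
  by have c5 := @cont_amp _ _ _ (cX X) i l; rewrite /f /=; cont.
- move=> [[t ro] al] /= t01 ro2 al01 [e1 e2 e3]; apply: (share_neq0 ij il jl t01 ro2 al01).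
  by split; [apply/eqP; rewrite -subr_eq0 e1|apply/eqP; rewrite -subr_eq0 e2|exact: e3].
- by [].
Qed.

Lemma lip_disjoint_of i j k l :
  (forall t sg rg, 0 <= t <= 1 -> 0 <= sg <= 1 -> 0 <= rg <= 1 ->
     gpos t i j sg <> gpos t k l rg) -> lip_pair i j k l.
Proof.
move=> nz; have [C C0 CP] := amp_lip i j; have [C' C0' CP'] := amp_lip k l.
pose f (X : V) : V :=
  (itp (pos X.1.1 i).1 (pos X.1.1 j).1 0 X.1.2 - itp (pos X.1.1 k).1 (pos X.1.1 l).1 0 X.2,
   itp (pos X.1.1 i).2 (pos X.1.1 j).2 0 X.1.2 - itp (pos X.1.1 k).2 (pos X.1.1 l).2 0 X.2,
   itp (lft X.1.1 i) (lft X.1.1 j) (amp X.1.1 i j) X.1.2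
   - itp (lft X.1.1 k) (lft X.1.1 l) (amp X.1.1 k l) X.2).
have fE X : f X = gpos X.1.1 i j X.1.2 - gpos X.1.1 k l X.2 by [].
have cX2 (X : V) : cont_at (fun X : V => X.1.2) X by cont.
have cX3 (X : V) : cont_at (fun X : V => X.2) X by cont.
have cX (X : V) : cont_at (fun X : V => X.1.1) X by cont.
have [|||||m' m'0 m'P] := @nonvanishing_lower R f 1; last 1 first.
- exists ((16 + C + C') / m'); first by rewrite divr_ge0 ?(ltW m'0)//; lra.
  move=> t u sg rg t01 u01 s01 r01.
  have lowf := m'P (t, sg, rg) t01 s01 r01.
  have [p1 p1'] := pos_lip t u i; have [p2 p2'] := pos_lip t u j.
  have [p3 p3'] := pos_lip t u k; have [p4 p4'] := pos_lip t u l.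
  have l1 := lft_lip i t01 u01; have l2 := lft_lip j t01 u01.
  have l3 := lft_lip k t01 u01; have l4 := lft_lip l t01 u01.
  have a1 := CP t u t01 u01; have a2 := CP' t u t01 u01.
  have k1 : 0 <= C * `|u - t| by rewrite mulr_ge0.
  have k2 : 0 <= C' * `|u - t| by rewrite mulr_ge0.
  have tri (x y z z' : R) : `|x| <= z -> `|y| <= z' -> `|x - y| <= z + z'.
    by move=> xz yz; apply: (le_trans (ler_normB _ _)); exact: lerD.
  apply: (@le_trans _ _ ((2 * (4 * `|u - t|) + C * `|u - t|) + (2 * (4 * `|u - t|) + C' * `|u - t|))).
    apply: motion_le.
    + by apply: tri; apply: itp_le => //; rewrite normr0.
    + by apply: tri; apply: itp_le => //; rewrite normr0.
    + by apply: tri; apply: itp_le.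
  rewrite (_ : _ + _ = (16 + C + C') * `|u - t|); last by ring.
  rewrite -[leRHS]mulrA -[leRHS]mulrA; apply: ler_wpM2l; first lra.
  move: lowf; rewrite fE /= => lowf.
  by rewrite ler_pdivlMl// mulrC ler_wpM2l.
- move=> X; have [c1 _] := cont_pos (cX X) i; have [c2 _] := cont_pos (cX X) j.
  have [c3 _] := cont_pos (cX X) k; have [c4 _] := cont_pos (cX X) l.
  by apply: cont_add; [|apply: cont_opp]; apply: cont_itp => //; exact: cont_cst.
- move=> X; have [_ c1] := cont_pos (cX X) i; have [_ c2] := cont_pos (cX X) j.
  have [_ c3] := cont_pos (cX X) k; have [_ c4] := cont_pos (cX X) l.
  by apply: cont_add; [|apply: cont_opp]; apply: cont_itp => //; exact: cont_cst.
- move=> X; have c1 := @cont_lft _ _ _ (cX X) i; have c2 := @cont_lft _ _ _ (cX X) j.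
  have c3 := @cont_lft _ _ _ (cX X) k; have c4 := @cont_lft _ _ _ (cX X) l.
  have c5 := @cont_amp _ _ _ (cX X) i j; have c6 := @cont_amp _ _ _ (cX X) k l.
  by apply: cont_add; [|apply: cont_opp]; apply: cont_itp.
- by move=> [[t sg] rg] /= t01 s01 r01; rewrite fE => /subr0_eq; exact: nz.
- by [].
Qed.

(** The transposition fixes both ends, so the two lengths interpolated by [kap] are equal. *)
Lemma fixed_gpos t u i j sg : ~~ moving i -> ~~ moving j -> gpos u i j sg = gpos t i j sg.
Proof.
move=> mi mj; rewrite /gpos !lft_fixed// !pos_fixed// /amp isvw_fixed//.
have tf x : ~~ moving x -> tau x = x.
  by rewrite negb_or => /andP[xv xw]; rewrite tpermD// eq_sym.
by rewrite /kap !tf//; congr (_, _, itp _ _ _ _); ring.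
Qed.

Lemma lip_disjoint i j k l : i != j -> i != k -> i != l -> j != k -> j != l -> k != l ->
  lip_pair i j k l.
Proof.
have core i' j' k' l' : moving i' -> i' != j' -> i' != k' -> i' != l' -> j' != k' -> j' != l' ->
    k' != l' -> lip_pair i' j' k' l'.
  move: i' j' k' l' => {}i {}j {}k {}l mi ij ik il jk jl kl.
  have third x y z : moving x -> moving y -> moving z -> x != y -> x != z -> y != z -> False.
    by move=> /orP[]/eqP-> /orP[]/eqP-> /orP[]/eqP->; rewrite ?eqxx.
  have [mj|mj] := boolP (moving j).
    have mk : ~~ moving k by apply/negP => mk; exact: (third i j k).
    have ml : ~~ moving l by apply/negP => ml; exact: (third i j l).
    by apply: lip_disjoint_of => t sg rg t01 s01 r01; exact: disjoint_pair_neq.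
  have two p x q y : moving p -> moving q -> p != q -> ~~ moving x -> ~~ moving y -> x != y ->
      lip_pair p x q y.
    move=> /orP[]/eqP-> /orP[]/eqP->; rewrite ?eqxx// => _ mx my xy.
      apply: lip_pair_sym; apply: lip_disjoint_of => t sg rg t01 s01 r01.
      by apply: disjoint_two_neq; rewrite // eq_sym.
    by apply: lip_disjoint_of => t sg rg t01 s01 r01; exact: disjoint_two_neq.
  have [mk|mk] := boolP (moving k).
    have ml : ~~ moving l by apply/negP => ml; exact: (third i k l).
    exact: two.
  have [ml|ml] := boolP (moving l); first by apply: lip_pair_swapr; exact: two.
  by apply: lip_disjoint_of => t sg rg t01 s01 r01; exact: disjoint_one_neq.
move=> ij ik il jk jl kl.
have [mi|mi] := boolP (moving i); first exact: core.
have [mj|mj] := boolP (moving j); first by apply: lip_pair_swap; apply: core; rewrite // eq_sym.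
have [mk|mk] := boolP (moving k); first by apply: lip_pair_sym; apply: core; rewrite // eq_sym.
have [ml|ml] := boolP (moving l).
  by apply: lip_pair_sym; apply: lip_pair_swap; apply: core; rewrite // eq_sym.
exists 0 => // t u sg rg _ _ _ _.
by rewrite (fixed_gpos t u sg mi mj) (fixed_gpos t u rg mk ml) !subrr normr0 !mul0r.
Qed.

Lemma lip_all i j k l : i != j -> k != l -> lip_pair i j k l.
Proof.
move=> ij kl.
have share i' j' l' : i' != j' -> i' != l' -> lip_pair i' j' i' l'.
  move=> ij' il'; have [<-|jl'] := eqVneq j' l'; first exact: lip_same.
  exact: lip_share.
have [ik|ik] := eqVneq i k; first by subst k; exact: share.
have [il|il] := eqVneq i l.
  by subst l; apply: lip_pair_swapr; apply: share; rewrite // eq_sym.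
have [jk|jk] := eqVneq j k.
  by subst k; apply: lip_pair_swap; apply: share; rewrite // eq_sym.
have [jl|jl] := eqVneq j l.
  by subst l; apply: lip_pair_swap; apply: lip_pair_swapr; apply: share; rewrite // eq_sym.
exact: lip_disjoint.
Qed.

Lemma exchange_isotopy : exists H, sphere_isotopy H /\
  forall i j sg, i != j -> 0 <= sg <= 1 ->
    H 1 (Some (gpos 0 i j sg) : S3 R) = Some (gpos 1 i j sg).
Proof.
pose A := {x : 'I_n * 'I_n * R | [&& x.1.1 != x.1.2, 0 <= x.2 & x.2 <= 1]}.
have P0P : [&& (v, w, 0 : R).1.1 != (v, w, 0 : R).1.2, 0 <= (v, w, 0 : R).2 & (v, w, 0 : R).2 <= 1].
  by rewrite /= vw lexx ler01.
pose P0 : A := exist _ (v, w, 0) P0P.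
have hM (z : 'I_n * 'I_n * ('I_n * 'I_n)) : exists M, 0 <= M /\
    (z.1.1 != z.1.2 -> z.2.1 != z.2.2 -> forall t u sg rg,
      0 <= t <= 1 -> 0 <= u <= 1 -> 0 <= sg <= 1 -> 0 <= rg <= 1 ->
      `|(gpos u z.1.1 z.1.2 sg - gpos t z.1.1 z.1.2 sg) - (gpos u z.2.1 z.2.2 rg - gpos t z.2.1 z.2.2 rg)|
        <= M * `|u - t| * `|gpos t z.1.1 z.1.2 sg - gpos t z.2.1 z.2.2 rg|).
  have [h1|h1] := boolP (z.1.1 != z.1.2); last by exists 0.
  have [h2|h2] := boolP (z.2.1 != z.2.2); last by exists 0.
  by have [M M0 H] := lip_all h1 h2; exists M.
pose M z := projT1 (boolp.cid (hM z)).
have MP z := projT2 (boolp.cid (hM z)).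
pose G t (x : A) := gpos t (sval x).1.1 (sval x).1.2 (sval x).2.
(* There are finitely many pairs of edges; the sum of their constants serves for all of them. *)
have [|H [iH HE]] := @lipschitz_motion_isotopy R A P0 G (\sum_z M z).
  move=> t u [[[i j] sg] /= P] [[[k l] rg] /= Q] t01 u01; rewrite /G /=.
  case/and3P: (P) => /= ij s0 s1; case/and3P: (Q) => /= kl r0 r1.
  have s01 : 0 <= sg <= 1 by rewrite s0.
  have r01 : 0 <= rg <= 1 by rewrite r0.
  have [M0 MH] := MP ((i, j), (k, l)).
  apply: (le_trans (MH ij kl t u sg rg t01 u01 s01 r01)).
  rewrite -!mulrA; apply: ler_wpM2r; first by rewrite mulr_ge0.
  rewrite (bigD1 ((i, j), (k, l)))//= lerDl; apply: sumr_ge0 => z _.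
  by have [] := MP z.
exists H; split=> // i j sg ij /andP[s0 s1].
have P : [&& (i, j, sg).1.1 != (i, j, sg).1.2, 0 <= (i, j, sg).2 & (i, j, sg).2 <= 1].
  by rewrite /= ij s0 s1.
exact: (HE (exist _ (i, j, sg) P)).
Qed.

Definition exchange_stack : 'I_s -> R * R -> R :=
  fun (k : 'I_s) (p : R * R) => c k * dome p.

Lemma exchange_stack_good : 1 < K -> good_stack exchange_stack.
Proof.
move=> K1'; apply: dome_stack => [||p|k l]; [exact: cont_dome|exact: dome_gt0|exact: dome_eq0|].
exact: c_decr.
Qed.

(** The power of a point with respect to the circle. *)
Lemma dome_chord i j sg : 0 <= sg <= 1 -> dome (seg (cv i) (cv j) sg) = sg * (1 - sg) * d2 i j.
Proof.
move=> /andP[s0 s1]; rewrite /dome norm2_seg !cv_norm2 -/(d2 i j).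
rewrite (_ : 1 - _ = sg * (1 - sg) * d2 i j); last by ring.
by apply/max_idPr; rewrite !mulr_ge0 ?subr_ge0// d2_ge0.
Qed.

Lemma gpos0 i j sg : 0 <= sg <= 1 -> gpos 0 i j sg = arc_point B exchange_stack i j sg.
Proof.
move=> s01; have p0 x : pos 0 x = cv x.
  rewrite /pos; case: eqP => [->|_]; first by rewrite seg0.
  by case: eqP => [->|_]; rewrite ?seg0.
have l0 x : lft 0 x = 0 by rewrite /lft; case: ifP => _; [|case: ifP => _]; rewrite ?mulr0 ?mul0r ?oppr0.
have a0 : amp 0 i j = c (B [set i; j]%SET) * d2 i j.
  rewrite /amp /kap subr0 mul0r addr0 mul1r mulr0 subr0 expr1n !mul1r mul0r addr0.
  case: ifP => //; rewrite /isvw => /orP[]/andP[/eqP-> /eqP->] //.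
  by rewrite finset.setUC d2C.
rewrite /gpos /arc_point !p0 !l0 a0 /exchange_stack dome_chord//.
by congr (_, _, _); rewrite /itp /=; ring.
Qed.

Hypothesis B'v : forall x, ~~ moving x ->
  B' [set v; x]%SET = B [set w; x]%SET /\ B' [set w; x]%SET = B [set v; x]%SET.
Hypothesis B'o : forall e, is_edge e -> v \notin e -> w \notin e -> B' e = B e.

Lemma tau_fixed x : ~~ moving x -> tau x = x.
Proof. by rewrite negb_or => /andP[xv xw]; rewrite /tau tpermD// eq_sym. Qed.

Lemma exchange_sheet i j : i != j -> ~~ isvw i j ->
  B' [set tau i; tau j]%SET = B [set i; j]%SET.
Proof.
have one x y : moving x -> ~~ moving y -> B' [set tau x; tau y]%SET = B [set x; y]%SET.
  move=> mx my; rewrite (tau_fixed my); have [h1 h2] := B'v my.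
  by case/orP: mx => /eqP->; rewrite /tau ?tpermL ?tpermR.
move=> ij nvw; have [mi|mi] := boolP (moving i); have [mj|mj] := boolP (moving j).
- move: mi mj ij nvw => /orP[]/eqP-> /orP[]/eqP->; rewrite ?eqxx// /isvw !eqxx ?orbT//.
- exact: one.
- by rewrite finset.setUC one// finset.setUC.
- rewrite !tau_fixed//; apply: B'o; first exact: edge_set2.
    by move: mi mj; rewrite /moving !negb_or !inE => /andP[h1 _] /andP[h2 _]; rewrite !(eq_sym v) negb_or h1.
  by move: mi mj; rewrite /moving !negb_or !inE => /andP[_ h1] /andP[_ h2]; rewrite !(eq_sym w) negb_or h1.
Qed.

Lemma gpos1 i j sg : i != j -> 0 <= sg <= 1 ->
  gpos 1 i j sg = arc_point B' exchange_stack (tau i) (tau j) sg.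
Proof.
move=> ij s01; have p1 x : pos 1 x = cv (tau x).
  rewrite /pos; case: eqP => [->|/eqP xv]; first by rewrite seg1 /tau tpermL.
  case: eqP => [->|/eqP xw]; first by rewrite seg1 /tau tpermR.
  by rewrite tau_fixed// negb_or xv.
have l1 x : lft 1 x = 0.
  by rewrite /lft subrr !mulr0 oppr0; case: ifP => _; [|case: ifP => _].
have a1 : amp 1 i j = c (B' [set tau i; tau j]%SET) * d2 (tau i) (tau j).
  rewrite /amp /kap subrr mul0r add0r mul1r mul0r add0r mul1r.
  case: ifP => [|/negbT nvw]; last by rewrite exchange_sheet.
  rewrite (_ : (1 - 2 * 1) ^+ 2 = 1 :> R); last by ring.
  rewrite mul1r /isvw /tau => /orP[]/andP[/eqP-> /eqP->]; rewrite tpermL tpermR //.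
  by rewrite finset.setUC d2C.
rewrite /gpos /arc_point !p1 !l1 a1 /exchange_stack dome_chord//.
by congr (_, _, _); rewrite /itp /=; ring.
Qed.

End Disjoint.

End ExchangeMotion.

Lemma set2_eq (T : finType) (i j k l : T) : [set i; j]%SET = [set k; l]%SET ->
  i = k /\ j = l \/ i = l /\ j = k.
Proof.
move=> E; have := set21 i j; have := set22 i j; have := set21 k l; have := set22 k l.
rewrite -{1 2}E {3 4}E !inE => /orP[]/eqP-> /orP[]/eqP<- /orP[]/eqP? /orP[]/eqP?; subst; tauto.
Qed.

(** * The vertex exchange as a move of books *)

Section VertexExchange.
Variables (R : realType) (n : nat).
Hypothesis n2 : (2 <= n)%N.
Local Notation cv := (@circle_vertex R n).

Lemma crossing_pairs (i j k l : 'I_n) : crossing [set i; j]%SET [set k; l]%SET <->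
  orient (cv i) (cv j) (cv k) * orient (cv i) (cv j) (cv l) < 0.
Proof.
split=> [/(@crossing_orient R)|]; last by move=> ?; apply/(@crossing_orient R); exists i, j, k, l.
move=> [i' [j' [k' [l' [/set2_eq[][-> ->] /set2_eq[][-> ->]]]]]] //.
- by rewrite mulrC.
- by rewrite orientC [X in _ * X]orientC mulrNN.
- by rewrite orientC [X in _ * X]orientC mulrNN mulrC.
Qed.

Lemma orient_ordS_lt0 (i x : 'I_n) : x != i -> x != ordS i ->
  orient (cv i) (cv (ordS i)) (cv x) < 0.
Proof.
rewrite -!val_eqE /= => xi xS; have [lt|le] := ltnP i.+1 n.
  rewrite modn_small// in xS.
  have [xlt|] := ltnP x i; last rewrite leq_eqVlt eq_sym (negPf xi)/= => ix.
    by rewrite orient_rot orient_cv_lt0//= modn_small.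
  by apply: orient_cv_lt0 => /=; rewrite modn_small// ltn_neqAle eq_sym xS.
have E : i.+1 = n by apply/eqP; rewrite eqn_leq le ltn_ord.
rewrite E modnn in xS; rewrite -orient_rot orient_cv_lt0//=; first by rewrite E modnn lt0n.
by rewrite ltn_neqAle xi -ltnS E /=.
Qed.

Section Exchange.
Variables (s : nat) (B B' : assignment n s) (v w : 'I_n).
Hypothesis consecutive : w = ordS v \/ v = ordS w.
Hypothesis w_above_v : forall x y, ~~ moving v w x -> ~~ moving v w y ->
  (B [set w; y]%SET < B [set v; x]%SET)%N.
Hypothesis B'v : forall x, ~~ moving v w x ->
  B' [set v; x]%SET = B [set w; x]%SET /\ B' [set w; x]%SET = B [set v; x]%SET.
Hypothesis B'o : forall e, is_edge e -> v \notin e -> w \notin e -> B' e = B e.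
Hypothesis ncB : sheets_noncrossing B.

Lemma consecutive_neq : v != w.
Proof.
have S (i : 'I_n) : i != ordS i.
  rewrite -val_eqE /=; have [lt|le] := ltnP i.+1 n; first by rewrite modn_small// neq_ltn leqnn.
  have E : i.+1 = n by apply/eqP; rewrite eqn_leq le ltn_ord.
  by rewrite E modnn -lt0n -ltnS E.
by case: consecutive => ->; [|rewrite eq_sym]; exact: S.
Qed.

Lemma same_side x y : ~~ moving v w x -> ~~ moving v w y ->
  0 < orient (cv v) (cv w) (cv x) * orient (cv v) (cv w) (cv y).
Proof.
rewrite !negb_or => /andP[xv xw] /andP[yv yw].
case: consecutive => E; rewrite E in xv xw yv yw |- *.
  by rewrite nmulr_rgt0 orient_ordS_lt0.
by rewrite orientC [X in _ * X]orientC mulrNN nmulr_rgt0 orient_ordS_lt0.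
Qed.

(** Crossing is symmetric: if the chord yz separated v from w, the side vw of the polygon would
    separate y from z. *)
Lemma not_separated y z : y != z -> ~~ moving v w y -> ~~ moving v w z ->
  0 < orient (cv y) (cv z) (cv v) * orient (cv y) (cv z) (cv w).
Proof.
move=> yz fy fz; move: (fy) (fz); rewrite !negb_or => /andP[yv yw] /andP[zv zw].
have : orient (cv y) (cv z) (cv v) * orient (cv y) (cv z) (cv w) != 0.
  by rewrite mulf_neq0// orient_cv_neq0.
rewrite neq_lt => /orP[/crossing_pairs/crossing_sym/crossing_pairs|//].
by move/(lt_trans (same_side fy fz)); rewrite ltxx.
Qed.

Lemma moving_other i j : moving v w i -> moving v w j -> i != j ->
  (i = v /\ j = w) \/ (i = w /\ j = v).
Proof. by move=> /orP[]/eqP-> /orP[]/eqP->; rewrite ?eqxx//; [left|right]. Qed.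

(** Exchanging v and w changes no crossing with an edge between other vertices; the only new
    crossings are of an edge at v with an edge at w, and [w_above_v] puts these in different
    sheets. *)
Lemma exchange_noncrossing : sheets_noncrossing B'.
Proof.
pose P (i j k l : 'I_n) := i != j -> k != l -> crossing [set i; j]%SET [set k; l]%SET ->
  B' [set i; j]%SET <> B' [set k; l]%SET.
have PC i j k l : P i j k l -> P j i k l by rewrite /P eq_sym [[set j; i]%SET]finset.setUC.
have PS i j k l : P i j k l -> P k l i j.
  by move=> H kl ij /crossing_sym cr E; exact: H ij kl cr (esym E).
have distinct (i j k l : 'I_n) : crossing [set i; j]%SET [set k; l]%SET -> [/\ k != i, k != j, l != i & l != j].
  move=> /crossing_pairs c; have [z1 z2] := orientpp (cv i) (cv j).
  by split; apply/eqP => E; move: c; rewrite E ?z1 ?z2 ?mul0r ?mulr0 ltxx.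
(* The edge vw is a side of the polygon and crosses nothing. *)
have P2 i j k l : moving v w i -> moving v w j -> P i j k l.
  move=> mi mj ij kl c; have [ki kj li lj] := distinct _ _ _ _ c.
  have fx x : x != i -> x != j -> ~~ moving v w x.
    by case: (moving_other mi mj ij) => -[-> ->] xi xj; rewrite negb_or xi ?xj.
  have /crossing_pairs := c.
  have := same_side (fx _ ki kj) (fx _ li lj).
  case: (moving_other mi mj ij) => -[-> ->].
    by move=> h /(lt_trans h); rewrite ltxx.
  by rewrite orientC [X in _ * X]orientC mulrNN => h /(lt_trans h); rewrite ltxx.
(* One edge at v and one at w: their new sheets are the old sheets of an edge at w and an edge at
   v. *)
have P11 i j k l : moving v w i -> ~~ moving v w j -> moving v w k -> ~~ moving v w l -> P i j k l.
  move=> mi fj mk fl ij kl c E; have [ki kj li lj] := distinct _ _ _ _ c.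
  move: E; have [j1 j2] := B'v fj; have [l1 l2] := B'v fl.
  case: (moving_other mk mi ki) => -[-> ->]; rewrite ?j1 ?j2 ?l1 ?l2 => E.
    by have := w_above_v fj fl; rewrite E ltnn.
  by have := w_above_v fl fj; rewrite E ltnn.
have fixedE x y : ~~ moving v w x -> ~~ moving v w y -> x != y -> B' [set x; y]%SET = B [set x; y]%SET.
  move=> fx fy xy; apply: B'o; rewrite ?edge_set2// !inE.
    by move: fx fy; rewrite !negb_or !(eq_sym v) => /andP[-> _] /andP[-> _].
  by move: fx fy; rewrite !negb_or !(eq_sym w) => /andP[_ ->] /andP[_ ->].
(* An edge that crosses [v j] also crosses [w j], so the crossing was already present in [B] for the
   edge whose sheet is inherited. *)
have P1 i j k l : moving v w i -> ~~ moving v w j -> ~~ moving v w k -> ~~ moving v w l -> P i j k l.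
  move=> mi fj fk fl ij kl c E.
  have /crossing_pairs c' := crossing_sym c.
  have ns := not_separated kl fk fl.
  have [j1 j2] := B'v fj.
  have nc x : x != j -> orient (cv k) (cv l) (cv x) * orient (cv k) (cv l) (cv j) < 0 ->
      B [set x; j]%SET <> B [set k; l]%SET.
    move=> xj o E'; apply: (ncB _ _ E'); rewrite ?edge_set2//.
    by apply/crossing_sym/crossing_pairs.
  move: mi ij c' E; rewrite [X in _ = X -> _]fixedE// => /orP[]/eqP-> ij c'; rewrite ?j1 ?j2; apply: nc => //.
  - by move: fj; rewrite negb_or eq_sym => /andP[_]; rewrite eq_sym.
  - by apply: sign_chain c'; rewrite mulrC.
  - by move: fj; rewrite negb_or eq_sym => /andP[].
  - exact: sign_chain c'.
have P0 i j k l : ~~ moving v w i -> ~~ moving v w j -> ~~ moving v w k -> ~~ moving v w l -> P i j k l.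
  by move=> fi fj fk fl ij kl c; rewrite !fixedE// => E; apply: (ncB _ _ E c); rewrite edge_set2.
move=> e f /cards2P[i [j [ij ->]]] /cards2P[k [l [kl ->]]] E c.
suff : P i j k l by move=> /(_ ij kl c).
have [mi|mi] := boolP (moving v w i); have [mj|mj] := boolP (moving v w j).
- exact: P2.
- have [mk|mk] := boolP (moving v w k); have [ml|ml] := boolP (moving v w l).
  + exact/PS/P2.
  + exact: P11.
  + by apply/PS/PC/PS; apply: P11.
  + exact: P1.
- have [mk|mk] := boolP (moving v w k); have [ml|ml] := boolP (moving v w l).
  + exact/PS/P2.
  + exact/PC/P11.
  + by apply/PC/PS/PC/PS; apply: P11.
  + exact/PC/P1.
- have [mk|mk] := boolP (moving v w k); have [ml|ml] := boolP (moving v w l).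
  + exact/PS/P2.
  + exact/PS/P1.
  + exact/PS/PC/P1.
  + exact: P0.
Qed.

Lemma exchange_book_isotopic : book_isotopic R B B'.
Proof.
have [mu mu0 muP] := orient_lower R n; have [m m0 mP] := dist_lower R n.
(* The summand 1 makes the stack strictly decreasing, the other one gives the height gap. *)
pose K := 1 + 513 / (m * mu ^+ 2).
have d0 : 0 < m * mu ^+ 2 by rewrite mulr_gt0 ?exprn_gt0.
have c0 : 0 < 513 :> R by rewrite ltr0n.
have K1 : 1 < K by rewrite /K ltrDl; exact: divr_gt0 c0 d0.
have KL : 513 <= K * m * mu ^+ 2.
  by rewrite -mulrA mulrDl divfK ?gt_eqF// mul1r lerDr ltW.
have vw := consecutive_neq.
have [H [iH HE]] := exchange_isotopy B' vw same_side not_separated w_above_v ncB (ltW K1) mu0 m0 muP mP KL.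
apply: (@book_isotopic_points R n n2 s s B B' (exchange_stack K) (exchange_stack K) H (tperm v w)) => //.
- exact: exchange_noncrossing.
- exact: exchange_stack_good (ltW K1) K1.
- exact: exchange_stack_good (ltW K1) K1.
- by move=> i j t ij t01; rewrite -(gpos0 B B' v w K i j t01) HE// (gpos1 K B'v B'o ij t01).
Qed.

End Exchange.

Lemma vertex_exchange_isotopic s (B B' : assignment n s) :
  vertex_exchange B B' -> sheets_noncrossing B ->
  sheets_noncrossing B' /\ book_isotopic R B B'.
Proof.
move=> [v [w [vw wv B'v B'o]]] ncB.
have mE x : ~~ moving v w x -> x \notin [set v; w]%SET by rewrite !inE.
have wv' x y : ~~ moving v w x -> ~~ moving v w y -> (B [set w; y]%SET < B [set v; x]%SET)%N.
  by move=> /mE hx /mE hy; exact: wv.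
have B'v' x (hx : ~~ moving v w x) := B'v x (mE x hx).
split; first exact: exchange_noncrossing vw wv' B'v' B'o ncB.
exact: exchange_book_isotopic vw wv' B'v' B'o ncB.
Qed.

End VertexExchange.

(** * The moves *)

Section EdgeMoves.
Variables (R : realType) (n s : nat).
Hypothesis n2 : (2 <= n)%N.

Definition reassigned (B B' : assignment n s) (e : {set 'I_n}) (k : 'I_s) : Prop :=
  B' e = k /\ forall f, is_edge f -> f != e -> B' f = B f.

Lemma edge_move_noncrossing (B B' : assignment n s) e k : reassigned B B' e k ->
  (forall f, is_edge f -> B f = k -> ~ crossing e f) ->
  sheets_noncrossing B -> sheets_noncrossing B'.
Proof.
move=> [Be Bo] ek ncB f g ef eg; have [->|fe] := eqVneq f e; have [->|ge] := eqVneq g e.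
- by move=> _ [a [b [c [d [ab bc cd [[-> /set2_eq[][? ?]]|[-> /set2_eq[][? ?]]]]]]]]; subst;
    rewrite ?ltnn// in ab bc cd *; move: (ltn_trans ab bc) (ltn_trans bc cd) (ltn_trans (ltn_trans ab bc) cd); rewrite !ltnn.
- by rewrite Be Bo// => E; apply: ek.
- by rewrite Be Bo// => E /crossing_sym; apply: ek.
- by rewrite !Bo//; exact: ncB.
Qed.

Lemma edge_move_consecutive (B B' : assignment n s) e k : is_edge e -> reassigned B B' e k ->
  (k : nat) = (B e).+1 \/ (B e : nat) = k.+1 ->
  sheets_noncrossing B -> sheets_noncrossing B' -> book_isotopic R B B'.
Proof.
move=> ie [Be Bo] [kE|kE] nc nc'.
  have [G [r r']] := @edge_move_shared R n s B B' e _ _ kE ie erefl Be Bo nc nc'.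
  exact: (book_isotopic_shared n2 r r').
have Bo' f : is_edge f -> f != e -> B f = B' f by move=> ? ?; rewrite Bo.
have [G [r r']] := @edge_move_shared R n s B' B e _ _ kE ie Be erefl Bo' nc' nc.
exact: (book_isotopic_shared n2 r' r).
Qed.

Definition consecutive_sheets (k l : 'I_s) : Prop := l = k.+1 :> nat \/ k = l.+1 :> nat.

Lemma ordS_val (k : 'I_s) : (ordS k = k.+1 :> nat) \/ ((k : nat) = s.-1 /\ ordS k = 0%N :> nat).
Proof.
have [lt|le] := ltnP k.+1 s; first by left; rewrite /= modn_small.
have E : k.+1 = s by apply/eqP; rewrite eqn_leq le ltn_ord.
by right; rewrite /= E modnn; split=> //; rewrite -[LHS]/(k.+1.-1) E.
Qed.

(** The cyclic pair of last and first sheet is carried by one shift to the sheets 0 and 1;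
    distinctness excludes a single sheet, which is its own successor. *)
Lemma adjacent_consecutive (k l : 'I_s) : adjacent_sheets k l -> k != l ->
  consecutive_sheets k l \/ consecutive_sheets (ordS k) (ordS l).
Proof.
have key (a b : 'I_s) : b = ordS a -> a != b ->
    b = a.+1 :> nat \/ ordS b = (ordS a).+1 :> nat.
  move=> -> ab; have [E|[E S0]] := ordS_val a; [by left|right].
  have [->//|[E' _]] := ordS_val (ordS a).
  by case/eqP: ab; apply/val_inj; exact: etrans E (esym E').
move=> [E|E] kl.
  by case: (key k l E kl) => H; [left|right]; left.
by case: (key l k E); rewrite 1?eq_sym// => H; [left|right]; right.
Qed.

Lemma edge_move_isotopic (B B' : assignment n s) : edge_move B B' -> sheets_noncrossing B ->
  sheets_noncrossing B' /\ book_isotopic R B B'.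
Proof.
move=> [e [k [ie adj ek Be Bo]]] nc.
have re : reassigned B B' e k by split.
have nc' := edge_move_noncrossing re ek nc; split=> //.
(* The edge stays where it is. [B'] then agrees with [B] on edges, though perhaps not on other sets,
   and it is reached by reversing the sheets twice. *)
have [kE|kE] := eqVneq (B e) k.
  have E f : is_edge f -> B' f = B f.
    by move=> ief; have [->|fe] := eqVneq f e; [rewrite Be|exact: Bo].
  have dr : double_reflection R B B'.
    by exists (fun f => rev_ord (B f)); split; right=> // f ief; rewrite E// rev_ordK.
  by have [] := double_reflection_isotopic n2 dr nc.
have [con|con] := adjacent_consecutive adj kE.
  exact: edge_move_consecutive ie re con nc nc'.
pose S (C : assignment n s) : assignment n s := fun f => ordS (C f).
have shift (C : assignment n s) : shifting_sheets C (S C) by left.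
have back (C : assignment n s) : shifting_sheets (S C) C by right=> f _; rewrite ordSK.
have [ncS iS] := shifting_sheets_isotopic R n2 (shift B) nc.
have [ncS' iS'] := shifting_sheets_isotopic R n2 (shift B') nc'.
have [_ iB'] := shifting_sheets_isotopic R n2 (back B') ncS'.
apply: (book_isotopic_trans ncS iS); apply: (book_isotopic_trans ncS' _ iB').
apply: edge_move_consecutive ie _ con ncS ncS'.
by split=> [|f ief fe]; rewrite /S ?Be ?Bo.
Qed.

End EdgeMoves.

Lemma book_move_isotopic (R : realType) (n : nat) (hn : (2 <= n)%N) s s'
    (B : assignment n s) (B' : assignment n s') :
  book_move R B B' -> sheets_noncrossing B ->
  sheets_noncrossing B' /\ book_isotopic R B B'.
Proof.
case=> {s s' B B'} s B B'.
- exact: rotating_vertices_isotopic.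
- exact: shifting_sheets_isotopic.
- exact: edge_move_isotopic.
- exact: vertex_exchange_isotopic.
- move=> ins nc; split; first exact: (proj1 (sheet_insertion_noncrossing ins)).
  have [G [r r']] := sheet_insertion_shared R ins nc.
  exact: (book_isotopic_shared hn r r').
- move=> ins nc; have nc' := (proj2 (sheet_insertion_noncrossing ins)) nc; split=> //.
  have [G [r r']] := sheet_insertion_shared R ins nc'.
  exact: (book_isotopic_shared hn r' r).
- exact: double_reflection_isotopic.
Qed.

Theorem theorem1 (R : realType) (n : nat) (hn : (3 <= n)%N) (s s' : nat)
    (B : assignment n s) (B' : assignment n s') (G : spatial_graph R n) :
  book_representation B G -> book_move R B B' ->
  (exists G' : spatial_graph R n, book_representation B' G') /\
  (forall G' : spatial_graph R n, book_representation B' G' ->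
     ambient_isotopic G G').
Proof.
move=> rB mv; have [nc _ _ _] := rB.
have [nc' iso] := book_move_isotopic (ltnW hn) mv nc.
split; first exact: book_representation_exists nc'.
by move=> G' rB'; exact: sphere_isotopic_ambient (iso G G' rB rB').
Qed.
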